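(* Let $R>0$ and $\alpha>0$. The weighted Bergman kernel $K^{\alpha}_{R,slice}$ of the slice hyperholomorphic Bergman space $A^{2,\alpha}_{slice}(\mathbb{B}_R)$ is given, for all $q,p\in\mathbb{B}_R$, by $$K^{\alpha}_{R,slice}(q,p)= I^{-\alpha-1}\left(\frac{\overline{q}}{R},\frac{\overline{p}}{R}\right)\left(1-2\frac{\Re(q)\,\overline{p}}{R^2}+\frac{|q|^2\,\overline{p}^2}{R^4}\right)^{-\alpha-1}$$ and $$K^{\alpha}_{R,slice}(q,p)= I^{\alpha+1}\left(\frac{q}{R},\frac{\overline{p}}{R}\right).$$
   Context: $\mathbb{H}$ is the algebra of quaternions, with conjugation $q\mapsto\overline q$, modulus $|q|$ and real part $\Re(q)$; $\mathbb{S}=\{I\in\mathbb{H}: I^2=-1\}$; for $I\in\mathbb{S}$, $\mathbb{C}_I=\mathbb{R}+\mathbb{R}I$ is the corresponding slice. $\mathbb{B}_R=\{q\in\mathbb{H}:|q|<R\}$ and $\mathbb{B}_{R,I}=\mathbb{B}_R\cap\mathbb{C}_I$. A real differentiable function $f:\mathbb{B}_R\to\mathbb{H}$ is (left) slice regular if for every $I\in\mathbb{S}$ its restriction $f_I$ to $\mathbb{B}_{R,I}$ has continuous partial derivatives and satisfies $\left(\frac{\partial}{\partial x}+I\frac{\partial}{\partial y}\right)f_I(x+yI)=0$. The slice hyperholomorphic Bergman space $A^{2,\alpha}_{slice}(\mathbb{B}_R)$ is the right $\mathbb{H}$-vector space of slice regular functions $f$ on $\mathbb{B}_R$ whose restriction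 to $\mathbb{B}_{R,I}$ is square integrable with respect to $d\lambda^\alpha_{I,R}(x+yI)=\frac{\alpha}{\pi R^2}\left(1-\frac{|x+yI|^2}{R^2}\right)^{\alpha-1}dx\,dy$ (the space does not depend on $I\in\mathbb{S}$). It is a right quaternionic Hilbert space with scalar product $\langle f,g\rangle_{\alpha,slice}=\int_{\mathbb{B}_{R,I}}\overline{f}\,g\,d\lambda^\alpha_{I,R}$, and a reproducing kernel Hilbert space: its reproducing kernel (the weighted Bergman kernel) $K^{\alpha}_{R,slice}$ is the unique function on $\mathbb{B}_R\times\mathbb{B}_R$ such that $K^{\alpha}_{R,slice}(\cdot,p)\in A^{2,\alpha}_{slice}(\mathbb{B}_R)$ for each $p$, $\overline{K^{\alpha}_{R,slice}(q,p)}=K^{\alpha}_{R,slice}(p,q)$, and $f(q)=\int_{\mathbb{B}_{R,I}}K^{\alpha}_{R,slice}(q,z)f(z)\,d\lambda^\alpha_{I,R}(z)$ for all $f\in A^{2,\alpha}_{slice}(\mathbb{B}_R)$, $q\in\mathbb{B}_R$ and $I\in\mathbb{S}$. For real $a$ and quaternions $q,p$ with $|q|,|p|<1$, $I^a(q,p):=\sum_{n=0}^\infty\frac{(a)_n}{n!}q^np^n$, where $(a)_n=a(a+1)\cdots(a+n-1)$, $(a)_0=1$. Real powers of a quaternion lying in a slice $\mathbb{C}_J$ off the half-line $(-\infty,0]$ are principal powers computed in $\mathbb{C}_J$. *)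

(* Defs.v *)
From HB Require Import structures.
From mathcomp Require Import all_boot all_order all_algebra.
From mathcomp Require Import all_classical all_reals all_analysis.
From mathcomp Require Import ring lra.

Set Implicit Arguments.
Unset Strict Implicit.
Unset Printing Implicit Defensive.

Import Order.TTheory GRing.Theory Num.Theory.
Import numFieldNormedType.Exports.

Local Open Scope classical_set_scope.
Local Open Scope ring_scope.

Record quat (R : Type) := Quat { qre : R; qi : R; qj : R; qk : R }.

Section QuatCode.
Variable R : Type.

Definition quat_code (q : quat R) : R * R * R * R := (qre q, qi q, qj q, qk q).

Definition quat_decode (c : R * R * R * R) : quat R :=
  Quat c.1.1.1 c.1.1.2 c.1.2 c.2.

Lemma quat_codeK : cancel quat_code quat_decode.
Proof. by case. Qed.

End QuatCode.

HB.instance Definition _ (R : realType) :=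
  Choice.copy (quat R) (can_type (@quat_codeK R)).

Section QuatAlgebra.
Variable R : realType.
Implicit Types (q p u : quat R) (a b : R).

Definition qadd q p :=
  Quat (qre q + qre p) (qi q + qi p) (qj q + qj p) (qk q + qk p).
Definition qopp q := Quat (- qre q) (- qi q) (- qj q) (- qk q).
Definition qmul q p :=
  Quat (qre q * qre p - qi q * qi p - qj q * qj p - qk q * qk p)
       (qre q * qi p + qi q * qre p + qj q * qk p - qk q * qj p)
       (qre q * qj p - qi q * qk p + qj q * qre p + qk q * qi p)
       (qre q * qk p + qi q * qj p - qj q * qi p + qk q * qre p).
Definition qscale a q := Quat (a * qre q) (a * qi q) (a * qj q) (a * qk q).

Lemma qaddA : associative qadd.
Proof. by move=> [????] [????] [????]; congr Quat => /=; ring. Qed.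
Lemma qaddC : commutative qadd.
Proof. by move=> [????] [????]; congr Quat => /=; ring. Qed.
Lemma qadd0 : left_id (Quat 0 0 0 0) qadd.
Proof. by move=> [????]; congr Quat => /=; ring. Qed.
Lemma qaddN : left_inverse (Quat 0 0 0 0) qopp qadd.
Proof. by move=> [????]; congr Quat => /=; ring. Qed.

HB.instance Definition _ :=
  GRing.isZmodule.Build (quat R) qaddA qaddC qadd0 qaddN.

Lemma qmulA : associative qmul.
Proof. by move=> [????] [????] [????]; congr Quat => /=; ring. Qed.
Lemma qmul1l : left_id (Quat 1 0 0 0) qmul.
Proof. by move=> [????]; congr Quat => /=; ring. Qed.
Lemma qmul1r : right_id (Quat 1 0 0 0) qmul.
Proof. by move=> [????]; congr Quat => /=; ring. Qed.
Lemma qmulDl : left_distributive qmul qadd.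
Proof. by move=> [????] [????] [????]; congr Quat => /=; ring. Qed.
Lemma qmulDr : right_distributive qmul qadd.
Proof. by move=> [????] [????] [????]; congr Quat => /=; ring. Qed.
Lemma qone_neq0 : Quat 1 0 0 0 != 0 :> quat R.
Proof. by apply/eqP => -[] /eqP; rewrite oner_eq0. Qed.

HB.instance Definition _ := GRing.Zmodule_isNzRing.Build (quat R)
  qmulA qmul1l qmul1r qmulDl qmulDr qone_neq0.

Lemma qscaleA a b q : qscale a (qscale b q) = qscale (a * b) q.
Proof. by case: q => ????; congr Quat => /=; ring. Qed.
Lemma qscale1 : left_id 1 qscale.
Proof. by move=> [????]; congr Quat => /=; ring. Qed.
Lemma qscaleDr : right_distributive qscale qadd.
Proof. by move=> ? [????] [????]; congr Quat => /=; ring. Qed.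
Lemma qscaleDl q : {morph qscale^~ q : a b / a + b}.
Proof. by move=> a b; case: q => ????; congr Quat => /=; ring. Qed.

HB.instance Definition _ := GRing.Zmodule_isLmodule.Build R (quat R)
  qscaleA qscale1 qscaleDr qscaleDl.

Lemma qscaleAl a q p : a *: (q * p) = a *: q * p.
Proof. by case: q p => ???? [????]; congr Quat => /=; ring. Qed.

HB.instance Definition _ :=
  GRing.Lmodule_isLalgebra.Build R (quat R) qscaleAl.

Lemma qscaleAr a q p : a *: (q * p) = q * (a *: p).
Proof. by case: q p => ???? [????]; congr Quat => /=; ring. Qed.

HB.instance Definition _ :=
  GRing.Lalgebra_isAlgebra.Build R (quat R) qscaleAr.

Definition qnorm q : R :=
  Num.sqrt (qre q ^+ 2 + qi q ^+ 2 + qj q ^+ 2 + qk q ^+ 2).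

Lemma qnorm_triangle q p : qnorm (q + p) <= qnorm q + qnorm p.
Proof.
case: q p => a b c d [x y z t]; rewrite /qnorm /=.
set A := a ^+ 2 + _ + _ + _; set B := x ^+ 2 + _ + _ + _.
have A0 : 0 <= A by rewrite !addr_ge0 ?sqr_ge0.
have B0 : 0 <= B by rewrite !addr_ge0 ?sqr_ge0.
have dotAB : a * x + b * y + c * z + d * t <= Num.sqrt A * Num.sqrt B.
  rewrite -sqrtrM//; apply: le_trans (ler_norm _) _.
  rewrite -sqrtr_sqr ler_wsqrtr// -subr_ge0.
  rewrite (_ : _ - _ = (a * y - b * x) ^+ 2 + (a * z - c * x) ^+ 2 +
    (a * t - d * x) ^+ 2 + (b * z - c * y) ^+ 2 + (b * t - d * y) ^+ 2 +
    (c * t - d * z) ^+ 2); last by rewrite /A /B; ring.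
  by rewrite !addr_ge0 ?sqr_ge0.
rewrite -(ler_pXn2r (n := 2))// ?nnegrE ?addr_ge0 ?sqrtr_ge0//.
rewrite (@sqr_sqrtr _ ((a + x) ^+ 2 + _ + _ + _)) ?addr_ge0 ?sqr_ge0//.
rewrite [leRHS]sqrrD !sqr_sqrtr// -/A -/B.
rewrite [leLHS](_ : _ = A + (a * x + b * y + c * z + d * t) *+ 2 + B);
  last by rewrite /A /B; ring.
by rewrite lerD2r lerD2l lerMn2r dotAB orbT.
Qed.

Lemma qnormZ a q : qnorm (a *: q) = `|a| * qnorm q.
Proof.
case: q => x y z t; rewrite /qnorm /= !exprMn -!mulrDr.
by rewrite sqrtrM ?sqr_ge0// sqrtr_sqr.
Qed.

Lemma qnorm0_eq0 q : qnorm q = 0 -> q = 0.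
Proof.
case: q => a b c d; rewrite /qnorm /= => /eqP.
rewrite sqrtr_eq0 => h.
have sq0 (x : R) : x ^+ 2 <= 0 -> x = 0.
  by move=> x0; apply/eqP; rewrite -sqrf_eq0 eq_le x0 sqr_ge0.
have [a0 b0 c0 d0] := And4 (sqr_ge0 a) (sqr_ge0 b) (sqr_ge0 c) (sqr_ge0 d).
by congr Quat; apply: sq0; lra.
Qed.

(* After this instance `|q| is the Euclidean modulus of the quaternion q and
   quat R carries the usual topology of R^4. *)
HB.instance Definition _ := Lmodule_isNormed.Build R (quat R)
  qnorm_triangle qnormZ qnorm0_eq0.

Definition qconj q := Quat (qre q) (- qi q) (- qj q) (- qk q).

Definition qim q := Quat 0 (qi q) (qj q) (qk q).

(* Writing w = x + y J with J = Im w / |Im w| and y = |Im w|, the principal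
   argument of w in C_J is acos (x / |w|), which lies in [0, pi]; replacing J
   by -J conjugates everything and gives the same power. For w a positive real,
   J = 0 in Rocq (as 0^-1 = 0), the argument is 0, and the value is the real
   power. The value is only meaningful when w is not in ]-oo, 0]. *)
Definition qpow (w : quat R) (b : R) : quat R :=
  let theta := acos (qre w / `|w|) in
  (`|w| `^ b) *:
    ((cos (b * theta))%:A + sin (b * theta) *: (`|qim w|^-1 *: qim w)).

Definition imag_unit : set (quat R) := [set I | I ^+ 2 = -1].

Definition slice_pt (I : quat R) (z : R * R) : quat R := z.1%:A + z.2 *: I.

(* Independent of I as a subset of R * R, since |x + yI|^2 = x^2 + y^2. *)
Definition slice_disc (r : R) (I : quat R) : set (R * R) :=
  [set z | `|slice_pt I z| < r].

(* Functions on the ball B_r are total functions on quat R of which only the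
   values on B_r matter. *)
Definition slice_regular (r : R) (f : quat R -> quat R) : Prop :=
  (forall q, `|q| < r -> differentiable f q) /\
  forall I, imag_unit I ->
    let fI := f \o slice_pt I in
    forall z, slice_disc r I z ->
      [/\ derivable fI z (1, 0), derivable fI z (0, 1),
          {for z, continuous (fun t => 'D_(1, 0) fI t)},
          {for z, continuous (fun t => 'D_(0, 1) fI t)} &
          'D_(1, 0) fI z + I * 'D_(0, 1) fI z = 0].

Definition lebesgue2 := (@lebesgue_measure R \x @lebesgue_measure R)%E.

Definition bergman_weight (r alpha : R) (q : quat R) : R :=
  alpha / (pi * r ^+ 2) * (1 - `|q| ^+ 2 / r ^+ 2) `^ (alpha - 1).

Definition bergman_space (r alpha : R) : set (quat R -> quat R) :=
  [set f | slice_regular r f /\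
    forall I, imag_unit I ->
      lebesgue2.-integrable (slice_disc r I)
        (fun z => (`|f (slice_pt I z)| ^+ 2 *
                   bergman_weight r alpha (slice_pt I z))%:E)].

(* Integral of g over the disc B_r \cap C_I against the weighted measure
   d lambda, taken component by component. *)
Definition slice_integral (r alpha : R) (I : quat R) (g : quat R -> quat R) :
    quat R :=
  let integ (h : quat R -> R) :=
    \int[lebesgue2]_(z in slice_disc r I)
      (h (slice_pt I z) * bergman_weight r alpha (slice_pt I z)) in
  Quat (integ (fun z => qre (g z))) (integ (fun z => qi (g z)))
       (integ (fun z => qj (g z))) (integ (fun z => qk (g z))).

Definition is_bergman_kernel (r alpha : R)
    (K : quat R -> quat R -> quat R) : Prop :=
  [/\ forall p, `|p| < r -> bergman_space r alpha (K^~ p),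
      forall q p, `|q| < r -> `|p| < r -> qconj (K q p) = K p q &
      forall f, bergman_space r alpha f ->
      forall q, `|q| < r -> forall I, imag_unit I ->
        f q = slice_integral r alpha I (fun z => K q z * f z)].

Definition pochhammer (a : R) (n : nat) : R := \prod_(i < n) (a + i%:R).

Definition Ipow (a : R) (q p : quat R) : quat R :=
  limn (series (fun n => (pochhammer a n / n`!%:R) *: (q ^+ n * p ^+ n))).

End QuatAlgebra.

(* Main.v *)
Require Import Defs.
From HB Require Import structures.
From mathcomp Require Import all_boot all_order all_algebra.
From mathcomp Require Import all_classical all_reals all_analysis.
From mathcomp Require Import measurable_realfun.
From mathcomp Require Import ring lra.
Import Order.TTheory GRing.Theory Num.Theory.
Import numFieldNormedType.Exports.
Local Open Scope classical_set_scope.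
Local Open Scope ring_scope.

(** Write a = alpha + 1, let c_n = (a)_n / n! and fix q in the ball.

    Second formula.  The function f = K(-, q) lies in the Bergman space, and
    so do the monomials z^n.  Reproducing z^n at q and conjugating the
    integral gives the coefficient identity
      \int conj(z)^n f(z) dlambda(z) = conj(q)^n          (on every slice).
    On the other hand f restricted to a slice C_I is holomorphic, hence is
    the sum of a Taylor series sum_n z^n tau_n, and orthogonality of the
    monomials on circles gives
      \int conj(z)^n f(z) dlambda(z) = m_n tau_n,
    where m_n = r^(2n) n! / (a)_n is the n-th moment of the weight.  So
    tau_n = c_n r^(-2n) conj(q)^n, and evaluating at p in C_I yields
    K(p, q) = sum_n c_n (p/r)^n (conj(q)/r)^n ([kernel_series]).

    The Taylor expansion is obtained from Stokes' formula alone, without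
    contour integrals or polar coordinates.  If chi is a real C^1 function
    with compact support in the domain of a holomorphic F, then
    (d/dx + I d/dy) chi, times F, has integral 0 ([stokes]).  Taking chi to be
    a function of |z - w|^2 shows that the integral of
    v(|z - w|^2) (z - w) F(z) depends on v only through \int v
    ([moment_exists]): this scalar invariance replaces independence of the
    radius of a circle.  Applied to F(z) / (z - w) and to bumps v shrinking to
    w it is the mean value property ([mean_value]); a product of two cutoffs,
    one around 0 and one around w, gives Cauchy's formula
    ([cauchy_formula]), and expanding the Cauchy kernel in a geometric series
    gives the Taylor coefficients as annular averages of z^(-n) F(z)
    ([taylor_expansion]).  As the averages do not see the profile v, those
    profiles may be let increase to the Bergman weight, with
    conj(z)^n = |z|^(2n) z^(-n) ([weighted_coefficient]).

    First formula.  Put x = conj(p)/r and rescale q by 1/r.  Then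
    S(s) = sum_n c_n s^n q^n x^n satisfies
      Z' = s q Z' x + a q Z x,   Z(0) = 1     ([binomial_series_ode]).
    Let B be the same series for conj(q) and -a, and
    P(s) = 1 - 2 Re(q) s x + |q|^2 s^2 x^2.  The operators Z |-> q Z x and
    Z |-> conj(q) Z x commute, and P acts on the right as the product of
    1 - s q (-) x and 1 - s conj(q) (-) x; a computation in the algebra they
    generate shows that B P^(-a) solves the same problem
    ([quadratic_product_ode]).  As |q| |x| < 1, the equation determines Z'
    from Z, with a bound linear in |Z|, so Gronwall's argument gives
    uniqueness ([linear_ode_unique]) and S(1) = B(1) P(1)^(-a).

    In the slice of x, P(s) factors as (1 - s zeta)(1 - s eta) with |zeta| < 1
    and |eta| < 1.  Both factors have positive real part, so the sum of their
    arguments stays in ]-pi, pi[: the product of their powers is smooth in s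
    and is the principal power of P(s) ([segment_power_qpow]). *)

Set Implicit Arguments.
Unset Strict Implicit.
Unset Printing Implicit Defensive.

(** * Pointwise rules for continuity and derivatives *)

Section PointwiseCalculus.
Variable R : realType.

Section Continuity.
Variable T : topologicalType.
Implicit Types (f g : T -> R) (x : T).

Lemma contC (a : R) x : {for x, continuous (fun _ : T => a)}.
Proof. exact: cvg_cst. Qed.

Lemma contD f g x : {for x, continuous f} -> {for x, continuous g} ->
  {for x, continuous (fun t => f t + g t)}.
Proof. exact: continuousD. Qed.

Lemma contB f g x : {for x, continuous f} -> {for x, continuous g} ->
  {for x, continuous (fun t => f t - g t)}.
Proof. exact: continuousB. Qed.

Lemma contN f x : {for x, continuous f} -> {for x, continuous (fun t => - f t)}.
Proof. exact: continuousN. Qed.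

Lemma contM f g x : {for x, continuous f} -> {for x, continuous g} ->
  {for x, continuous (fun t => f t * g t)}.
Proof. exact: continuousM. Qed.

Lemma contV f x : f x != 0 -> {for x, continuous f} ->
  {for x, continuous (fun t => (f t)^-1)}.
Proof. exact: continuousV. Qed.

Lemma contX f n x : {for x, continuous f} -> {for x, continuous (fun t => f t ^+ n)}.
Proof.
move=> cf; elim: n => [|n IHn]; first exact: contC.
have -> : (fun t => f t ^+ n.+1) = (fun t => f t * f t ^+ n).
  by apply/funext => t; rewrite exprS.
exact: contM.
Qed.

Lemma cont_comp (f : T -> R) (h : R -> R) x : {for x, continuous f} ->
  {for f x, continuous h} -> {for x, continuous (fun t => h (f t))}.
Proof. by move=> cf ch; apply: (@continuous_comp _ _ _ f h). Qed.

End Continuity.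

Section Derivatives.
Implicit Types (f g h : R -> R) (t a b : R).

Lemma drvE f t a b : is_derive t (1:R) f a -> a = b -> is_derive t (1:R) f b.
Proof. by move=> + <-. Qed.

Lemma drvC a t : is_derive t (1:R) (fun _ : R => a) 0.
Proof. exact: is_derive_cst. Qed.

Lemma drvI t : is_derive t (1:R) (fun u : R => u) 1.
Proof. exact: is_derive_id. Qed.

Lemma drvD f g t a b : is_derive t (1:R) f a -> is_derive t (1:R) g b ->
  is_derive t (1:R) (fun u => f u + g u) (a + b).
Proof. by move=> ? ?; exact: is_deriveD. Qed.

Lemma drvB f g t a b : is_derive t (1:R) f a -> is_derive t (1:R) g b ->
  is_derive t (1:R) (fun u => f u - g u) (a - b).
Proof. by move=> ? ?; exact: is_deriveB. Qed.

Lemma drvN f t a : is_derive t (1:R) f a ->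
  is_derive t (1:R) (fun u => - f u) (- a).
Proof. by move=> ?; exact: is_deriveN. Qed.

Lemma drvM f g t a b : is_derive t (1:R) f a -> is_derive t (1:R) g b ->
  is_derive t (1:R) (fun u => f u * g u) (a * g t + f t * b).
Proof.
move=> df dg; apply: drvE (is_deriveM df dg) _.
by rewrite /GRing.scale/= addrC (mulrC (g t)).
Qed.

Lemma drv_comp f h t a b : is_derive t (1:R) f a -> is_derive (f t) (1:R) h b ->
  is_derive t (1:R) (fun u => h (f u)) (b * a).
Proof. by move=> df dh; exact: is_derive1_comp. Qed.

Lemma drvX f n t a : is_derive t (1:R) f a ->
  is_derive t (1:R) (fun u => f u ^+ n) (n%:R * f t ^+ n.-1 * a).
Proof.
move=> df; elim: n => [|n IHn]; first by rewrite !mul0r; exact: drvC.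
have -> : (fun u => f u ^+ n.+1) = (fun u => f u * f u ^+ n).
  by apply/funext => u; rewrite exprS.
apply: drvE (drvM df IHn) _ => /=; case: n {IHn} => [|n]/=; first by rewrite expr0 !mul0r mulr0 addr0 !mul1r mulr1.
by rewrite -[n.+2]addn1 natrD exprS; ring.
Qed.

Lemma drvV f t a : f t != 0 -> is_derive t (1:R) f a ->
  is_derive t (1:R) (fun u => (f u)^-1) (- a / f t ^+ 2).
Proof.
move=> f0 df; apply: drvE (is_deriveV f0 df) _.
by rewrite /GRing.scale/= -exprVn; ring.
Qed.

Lemma drv_continuous f t a : is_derive t (1:R) f a -> {for t, continuous f}.
Proof. by move=> -[df _]; apply: differentiable_continuous; exact/derivable1_diffP. Qed.

End Derivatives.
End PointwiseCalculus.

(** * Integration over the plane *)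

Notation plane R := (measurableTypeR R * measurableTypeR R)%type.
Notation area R := (@lebesgue_measure R \x @lebesgue_measure R)%E.

Section Plane.
Variable R : realType.
Implicit Types (x y e : R) (z w : R * R).

(** An open set of the plane is a countable union of rational boxes, so that
    the product of the Borel sigma-algebras contains all open sets. *)
Lemma open_measurable_plane (A : set (R * R)) :
  open A -> measurable (A : set (plane R)).
Proof.
move=> oA.
pose box (a b c : rat) : set (plane R) :=
  (ball (ratr a : R) (ratr c : R)) `*` (ball (ratr b : R) (ratr c : R)).
pose F (a b c : rat) := if `[< box a b c `<=` A >] then box a b c else set0.
have -> : A = \bigcup_a \bigcup_b \bigcup_c F a b c.
  apply/seteqP; split => [[x y] Axy|z]; last first.
    by move=> [a _ [b _ [c _]]]; rewrite /F; case: asboolP => // h /h.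
  have /nbhs_ballP[e /= e0 eA] : nbhs (x, y) A by apply: open_nbhs_nbhs.
  have [c] : exists c : rat, ratr c \in `](0:R), e / 2[.
    by apply: rat_in_itvoo; lra.
  rewrite in_itv/= => /andP[c0 ce].
  have [a] : exists a : rat, ratr a \in `](x - ratr c), x + ratr c[.
    by apply: rat_in_itvoo; lra.
  rewrite in_itv/= => /andP[a1 a2].
  have [b] : exists b : rat, ratr b \in `](y - ratr c), y + ratr c[.
    by apply: rat_in_itvoo; lra.
  rewrite in_itv/= => /andP[b1 b2].
  exists a => //; exists b => //; exists c => //; rewrite /F.
  case: asboolP => [_|]; last first.
    case=> -[u v] [/=]; rewrite /ball/= => h1 h2; apply: eA; split; rewrite /ball/=.
      by move: h1; rewrite !ltr_norml => /andP[? ?]; apply/andP; split; lra.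
    by move: h2; rewrite !ltr_norml => /andP[? ?]; apply/andP; split; lra.
  by split; rewrite /= /ball/= ltr_norml; apply/andP; split; lra.
apply: bigcupT_measurable_rat => a; apply: bigcupT_measurable_rat => b.
apply: bigcupT_measurable_rat => c; rewrite /F; case: ifP => // _.
by apply: measurableX; rewrite ball_itv; exact: measurable_itv.
Qed.

Lemma open_continuous_measurable_plane (A : set (R * R)) (f : R * R -> R) :
  open A -> {in A, continuous f} ->
  measurable_fun (A : set (plane R)) (f : plane R -> measurableTypeR R).
Proof.
move=> oA cf; apply: (measurability _ (measurable_realfun.RGenOInfty.measurableE R)) => _ [_ [a ->] <-].
apply: open_measurable_plane; rewrite openE => z -[Az fz].
rewrite /interior; near=> t; split; near: t; first exact: open_nbhs_nbhs.
have : nbhs (f z) [set` `]a, +oo[] by apply: open_nbhs_nbhs; split => //; exact: interval_open.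
by move/(cf z (mem_set Az)).
Unshelve. all: by end_near. Qed.

Lemma continuous_measurable_plane (f : R * R -> R) : continuous f ->
  measurable_fun setT (f : plane R -> measurableTypeR R).
Proof. by move=> cf; apply: open_continuous_measurable_plane => //; exact: openT. Qed.

Lemma plane_box (M : R) z : (`|z| <= M) = (`|z.1| <= M) && (`|z.2| <= M).
Proof. by rewrite [`|z|]prod_normE ge_max. Qed.

Lemma plane_boxE (M : R) :
  [set z : R * R | `|z| <= M] = [set` `[-M, M]] `*` [set` `[-M, M]].
Proof.
apply/seteqP; split => z /=; rewrite plane_box !in_itv/= !ler_norml; first by move/andP.
by move=> ?; apply/andP.
Qed.

Lemma measurable_plane_box (M : R) :
  measurable ([set z | `|z| <= M] : set (plane R)).
Proof.
by rewrite (plane_boxE M); apply: measurableX; exact: measurable_itv.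
Qed.

Lemma area_plane_box (M : R) : 0 <= M ->
  area R [set z | `|z| <= M] = (((M *+ 2) ^+ 2)%:E)%E.
Proof.
move=> M0; rewrite (plane_boxE M).
rewrite product_measure1E; [|exact: measurable_itv..].
have E : lebesgue_measure [set` `[-M, M]] = (M *+ 2)%:E :> \bar R.
  rewrite lebesgue_measure_itv/= lte_fin; case: ltP => h.
    by rewrite -EFinD; congr (_%:E); rewrite mulr2n; lra.
  by rewrite (_ : M = 0) ?mul0rn//; lra.
by transitivity ((M *+ 2)%:E * (M *+ 2)%:E)%E; [congr (_ * _)%E; exact: E|].
Qed.

Lemma compact_support_bounded (M : R) (g : R * R -> R) :
  continuous g -> (forall z, M < `|z| -> g z = 0) ->
  exists2 B, 0 <= B & forall z, `|g z| <= B.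
Proof.
move=> cg g0.
have cD : compact ([set` `[-M, M]] `*` [set` `[-M, M]] : set (R * R)).
  by apply: compact_setX; exact: segment_compact.
have := compact_bounded (continuous_compact (continuous_subspaceT cg) cD).
move=> [B [Br hB]]; exists (`|B| + 1); first by rewrite addr_ge0.
move=> z; have [Mz|Mz] := leP `|z| M; last by rewrite g0// normr0 addr_ge0.
apply: hB; first by rewrite (le_lt_trans (ler_norm B))// ltrDl.
exists z => //; move: Mz; rewrite plane_box => /andP[? ?].
by split; rewrite /= in_itv/= -ler_norml.
Qed.

Lemma compact_support_integrable (M : R) (g : R * R -> R) :
  continuous g -> (forall z, M < `|z| -> g z = 0) ->
  (area R).-integrable setT (EFin \o g : plane R -> \bar R).
Proof.
move=> cg g0.
pose N := Num.max M 0.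
have N0 : 0 <= N by rewrite le_max lexx orbT.
have gN z : N < `|z| -> g z = 0.
  by move=> h; apply: g0; apply: le_lt_trans h; rewrite le_max lexx.
pose D := [set z : plane R | `|z| <= N].
have mD : measurable D by exact: measurable_plane_box.
have -> : (EFin \o g : plane R -> \bar R) = (EFin \o g) \_ D.
  apply/funext => z; rewrite patchE; case: ifPn => //; rewrite notin_setE /D /= => /negP.
  by rewrite -ltNge => /gN ->.
apply/(integrable_mkcond (EFin \o g : plane R -> \bar R) mD).
apply: measurable_bounded_integrable => //.
- by rewrite [X in (X < _)%E]area_plane_box// ltry.
- by apply: measurable_funTS; exact: continuous_measurable_plane.
- have [B B0 gB] := compact_support_bounded cg g0.
  by exists B; split; [exact: ger0_real|move=> x Bx z _; exact: le_trans (gB z) (ltW Bx)].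
Qed.

Lemma integral_line (N : R) (h dh : R -> R) : 0 < N ->
  continuous dh -> (forall t : R, is_derive t (1 : R) h (dh t)) ->
  (forall t, N <= `|t| -> h t = 0) -> (forall t, N <= `|t| -> dh t = 0) ->
  (\int[@lebesgue_measure R]_t (dh t)%:E = 0)%E.
Proof.
move=> N0 cdh dh' h0 dh0.
have ch (t : R) : {for t, continuous h}.
  by apply: differentiable_continuous; apply/derivable1_diffP; have [] := dh' t.
have -> : (fun t => (dh t)%:E) = (EFin \o dh) \_ `[-N, N].
  apply/funext => t; rewrite patchE; case: ifPn => //.
  rewrite notin_setE/= in_itv/= => /negP; rewrite -ler_norml -ltNge => /ltW /dh0 ->//.
rewrite -integral_mkcond.
rewrite (@continuous_FTC2 _ dh h).
- rewrite !h0 ?normrN ?(gtr0_norm N0)//; exact: subee.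
- by lra.
- exact: continuous_subspaceT.
- split.
  + by move=> t _; have [] := dh' t.
  + by apply: cvg_at_right_filter; exact: ch.
  + by apply: cvg_at_left_filter; exact: ch.
- by move=> t _; rewrite derive1E; have [_ ->] := dh' t.
Qed.

Lemma pairr_continuous y : continuous (fun t : R => (t, y)).
Proof. by move=> t; exact: (cvg_pair (@cvg_id _ _) (cvg_cst _)). Qed.

Lemma pairl_continuous x : continuous (fun t : R => (x, t)).
Proof. by move=> t; exact: (cvg_pair (cvg_cst _) (@cvg_id _ _)). Qed.

(** By Fubini, since each horizontal section is the derivative of a compactly
    supported function; this and [integral_dy] are what remains of Stokes'
    theorem after multiplication by a cutoff. *)
Lemma integral_dx (M : R) (g gx : R * R -> R) :
  continuous gx ->
  (forall z, M < `|z| -> g z = 0) -> (forall z, M < `|z| -> gx z = 0) ->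
  (forall x y : R, is_derive x (1 : R) (fun t : R => g (t, y)) (gx (x, y))) ->
  \int[area R]_z (gx z : R) = 0.
Proof.
move=> cgx g0 gx0 dg; pose N := Num.max M 0 + 1.
have N0 : 0 < N by rewrite ltr_wpDl// le_max lexx orbT.
have MN : M < N by rewrite (@le_lt_trans _ _ (Num.max M 0)) ?le_max ?lexx// ltrDl.
rewrite /Rintegral -integral21_prod_meas1; last exact: compact_support_integrable gx0.
rewrite integral0_eq//= => y _; rewrite /fubini_G/=.
apply: (@integral_line N (fun t => g (t, y)) (fun t => gx (t, y)) N0).
- by move=> t; apply: (@continuous_comp _ _ _ (fun t => (t, y)) gx) ; [exact: pairr_continuous|exact: cgx].
- by move=> t Nt; apply: g0; rewrite [`|_|]prod_normE lt_max (lt_le_trans MN Nt).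
- by move=> t Nt; apply: gx0; rewrite [`|_|]prod_normE lt_max (lt_le_trans MN Nt).
Qed.

Lemma integral_dy (M : R) (g gy : R * R -> R) :
  continuous gy ->
  (forall z, M < `|z| -> g z = 0) -> (forall z, M < `|z| -> gy z = 0) ->
  (forall x y : R, is_derive y (1 : R) (fun t : R => g (x, t)) (gy (x, y))) ->
  \int[area R]_z (gy z : R) = 0.
Proof.
move=> cgy g0 gy0 dg; pose N := Num.max M 0 + 1.
have N0 : 0 < N by rewrite ltr_wpDl// le_max lexx orbT.
have MN : M < N by rewrite (@le_lt_trans _ _ (Num.max M 0)) ?le_max ?lexx// ltrDl.
rewrite /Rintegral -integral12_prod_meas1; last exact: compact_support_integrable gy0.
rewrite integral0_eq//= => x _; rewrite /fubini_F/=.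
apply: (@integral_line N (fun t => g (x, t)) (fun t => gy (x, t)) N0).
- by move=> t; apply: (@continuous_comp _ _ _ (fun t => (x, t)) gy) ; [exact: pairl_continuous|exact: cgy].
- by move=> t Nt; apply: g0; rewrite [`|_|]prod_normE lt_max (lt_le_trans MN Nt) orbT.
- by move=> t Nt; apply: gy0; rewrite [`|_|]prod_normE lt_max (lt_le_trans MN Nt) orbT.
Qed.
End Plane.

(** * Discs and radial integrals *)

Section Radial.
Variable R : realType.
Implicit Types (s t x y : R) (w z : R * R).

Definition sqdist w z : R := (z.1 - w.1) ^+ 2 + (z.2 - w.2) ^+ 2.

Lemma sqdist_ge0 w z : 0 <= sqdist w z.
Proof. by rewrite addr_ge0 ?sqr_ge0. Qed.

Lemma continuous_sqdist w : continuous (sqdist w).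
Proof.
move=> z; suff : {for z : R * R, continuous (fun z : R * R => (z.1 - w.1) ^+ 2 + (z.2 - w.2) ^+ 2)} by [].
apply: contD; apply: contX; apply: contB; try exact: contC.
  exact: cvg_fst.
exact: cvg_snd.
Qed.

Lemma measurable_sqdist w :
  measurable_fun setT (sqdist w : plane R -> measurableTypeR R).
Proof. by apply: continuous_measurable_plane; exact: continuous_sqdist. Qed.

(** The primitive is (x - c) k + 2 s atan ((x - c) / (rho + k)), with k the
    half chord. The half-angle form of the arcsine keeps it continuous up to
    both endpoints, where atan takes the values -pi/4 and pi/4. *)
Lemma integral_half_disc (c s : R) : 0 < s ->
  (\int[@lebesgue_measure R]_x (2 * Num.sqrt (s - (x - c) ^+ 2))%:E = (pi * s)%:E)%E.
Proof.
move=> s0; set rho := Num.sqrt s.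
have rho0 : 0 < rho by rewrite sqrtr_gt0.
have rho2 : rho ^+ 2 = s by rewrite sqr_sqrtr// ltW.
pose k x := Num.sqrt (s - (x - c) ^+ 2).
have k0 x : 0 <= k x by exact: sqrtr_ge0.
have cc (x : R) : {for x, continuous (fun x : R => x - c)}.
  by apply: contB; [exact: cvg_id|exact: contC].
have ck (x : R) : {for x, continuous k}.
  apply: (@cont_comp _ _ (fun x => s - (x - c) ^+ 2) Num.sqrt); last exact: sqrt_continuous.
  by apply: contB; [exact: contC|exact/contX/cc].
pose G x := (x - c) * k x + (2 * s) * atan ((x - c) / (rho + k x)).
have cG (x : R) : {for x, continuous G}.
  suff : {for x, continuous (fun x : R => (x - c) * k x + (2 * s) * atan ((x - c) / (rho + k x)))} by [].
  apply: contD; first by apply: contM; [exact: cc|exact: ck].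
  apply: contM; first exact: contC.
  apply: (@cont_comp _ _ (fun x => (x - c) / (rho + k x))); last exact: continuous_atan.
  apply: contM; [exact: cc|apply: contV]; first by rewrite gt_eqF// ltr_pwDl.
  by apply: contD; [exact: contC|exact: ck].
have dG x : c - rho < x < c + rho -> is_derive x (1:R) G (2 * k x).
  move=> /andP[x1 x2].
  have px : 0 < s - (x - c) ^+ 2 by rewrite -rho2; nra.
  have kx : 0 < k x by rewrite sqrtr_gt0.
  have rk : rho + k x != 0 by rewrite gt_eqF// addr_gt0.
  have k2 : (x - c) ^+ 2 = rho ^+ 2 - k x ^+ 2 by rewrite rho2 (sqr_sqrtr (ltW px)); lra.
  have dc : is_derive x (1:R) (fun x => x - c) 1.
    by apply: drvE (drvB (drvI x) (drvC c x)) _; rewrite subr0.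
  have dk : is_derive x (1:R) k (- (x - c) / k x).
    have ds := drvB (drvC s x) (drvX 2 dc).
    apply: drvE (drv_comp ds (is_derive1_sqrt px)) _.
    by rewrite -/(k x) /=; field; rewrite ?rk ?(gt_eqF kx) ?(gt_eqF rho0).
  have dq := drvM dc (@drvV _ (fun u => rho + k u) _ _ rk (drvD (drvC rho x) dk)).
  have dG' := drvD (drvM dc dk) (drvM (drvC (2 * s) x) (drv_comp dq (is_derive1_atan _))).
  apply: (drvE dG').
  set u := x - c in k2 *; set kk := k x in kx rk k2 *.
  have h1 : 1 + (u / (rho + kk)) ^+ 2 = 2 * rho / (rho + kk).
    by rewrite expr_div_n k2; field.
  rewrite /= h1.
  have -> : 1 * (rho + kk)^-1 + u * (- (0 + - u / kk) / (rho + kk) ^+ 2) = rho / (kk * (rho + kk)).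
    transitivity ((rho + kk)^-1 + u ^+ 2 / (kk * (rho + kk) ^+ 2)); first by field; rewrite ?rk ?(gt_eqF kx) ?(gt_eqF rho0).
    by rewrite k2; field; rewrite ?rk ?(gt_eqF kx) ?(gt_eqF rho0).
  rewrite -rho2.
  transitivity (kk - u ^+ 2 / kk + rho ^+ 2 / kk); first by field; rewrite ?rk ?(gt_eqF kx) ?(gt_eqF rho0).
  by rewrite k2; field; rewrite ?rk ?(gt_eqF kx) ?(gt_eqF rho0).
have -> : (fun x => (2 * Num.sqrt (s - (x - c) ^+ 2))%:E) =
    (EFin \o (fun x => 2 * k x)) \_ `[c - rho, c + rho].
  apply/funext => x; rewrite patchE; case: ifPn => //.
  rewrite notin_setE/= in_itv/= => /negP; rewrite negb_and -!ltNge => h.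
  have h2 : s < (x - c) ^+ 2.
    by rewrite -rho2; case/orP: h => h; nra.
  by rewrite ler0_sqrtr ?mulr0//; lra.
rewrite -integral_mkcond (@continuous_FTC2 _ (fun x => 2 * k x) G).
- have ep : c + rho - c = rho by ring.
  have em : c - rho - c = - rho by ring.
  have kp : k (c + rho) = 0 by rewrite /k ep rho2 subrr sqrtr0.
  have km : k (c - rho) = 0 by rewrite /k em sqrrN rho2 subrr sqrtr0.
  rewrite /G kp km ep em !mulr0 !add0r addr0 mulNr divff ?gt_eqF// atanN atan1 -EFinB.
  by congr (_%:E); lra.
- by lra.
- apply: continuous_subspaceT => x.
  by apply: (@contM _ _ (fun=> 2) k); [exact: contC|exact: ck].
- split.
  + by move=> x; rewrite in_itv/= => /dG[].
  + by apply: cvg_at_right_filter; exact: cG.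
  + by apply: cvg_at_left_filter; exact: cG.
- by move=> x; rewrite in_itv/= => /dG[_ E]; rewrite derive1E E.
Qed.

End Radial.

Section RadialIntegral.
Variable R : realType.
Implicit Types (s t x y : R) (w z : R * R).

(** Slicing vertically, the section of the disc at x is an interval of length
    2 sqrt(s - (x - c)^2), whence the integral of a half chord. *)
Lemma area_disc w s : area R [set z | sqdist w z < s] = (pi * Num.max s 0)%:E.
Proof.
have [s0|s0] := leP s 0.
  rewrite (_ : [set z | _] = set0) ?measure0 ?mulr0//.
  by apply/seteqP; split => // z /= /lt_le_trans /(_ s0); rewrite ltNge sqdist_ge0.
rewrite -(integral_half_disc w.1 s0).
rewrite /product_measure1/=; apply: eq_integral => x _ /=.
set d := s - (x - w.1) ^+ 2.
have -> : xsection [set z | sqdist w z < s] x =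
    [set` `]w.2 - Num.sqrt d, w.2 + Num.sqrt d[ ].
  apply/seteqP; split => y; rewrite /xsection/= inE/= in_itv/= -ltr_distl.
    rewrite /sqdist/= => h.
    rewrite -sqrtr_sqr ltr_sqrt//; rewrite /d; first lra.
    by apply: le_lt_trans (sqr_ge0 (y - w.2)) _; lra.
  move=> h.
  have d0 : 0 < d.
    rewrite ltNge; apply/negP => d0; move: h; rewrite ler0_sqrtr//.
    by rewrite ltNge normr_ge0.
  by move: h; rewrite -sqrtr_sqr ltr_sqrt// /sqdist /d/=; lra.
rewrite lebesgue_measure_itv/= lte_fin; case: ltP => h.
  by rewrite -EFinD; congr (_%:E); ring.
have : 0 <= Num.sqrt d by exact: sqrtr_ge0.
move=> h0; have -> : Num.sqrt d = 0 by lra.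
by rewrite mulr0.
Qed.

Let nneg : set (measurableTypeR R) := [set` `[0%R, +oo[ ].
Let mnneg : measurable nneg. Proof. exact: measurable_itv. Qed.

Let pinn : {nonneg R} := NngNum (pi_ge0 R).

(** Both sides are measures in B that agree on the half-lines ]-oo, s[, by the
    area of the disc, and these half-lines generate the Borel sets. *)
Lemma pushforward_sqdist w (B : set (measurableTypeR R)) : measurable B ->
  area R (sqdist w @^-1` B) = (pi%:E * lebesgue_measure (B `&` nneg))%E.
Proof.
move=> mB.
pose push := [the {measure set (measurableTypeR R) -> \bar R} of
  pushforward (area R) (sqdist w : plane R -> measurableTypeR R)].
pose m1 := push (measurable_sqdist w).
pose m2 := [the {measure set (measurableTypeR R) -> \bar R} of
  mscale pinn (mrestr (@lebesgue_measure R) mnneg)].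
have m1E s : m1 `]-oo, s[%classic = (pi * Num.max s 0)%:E.
  rewrite -(area_disc w s) /m1 /push /= /pushforward; congr (area R).
have m2E s : m2 `]-oo, s[%classic = (pi * Num.max s 0)%:E.
  transitivity (pi%:E * lebesgue_measure (`]-oo, s[%classic `&` nneg))%E; first by [].
  rewrite EFinM (_ : _ `&` _ = [set` `[0%R, s[ ]); last first.
    apply/seteqP; split => z; rewrite /nneg/= !in_itv/=.
      by move=> [-> /andP[-> _]].
    by move=> /andP[-> ->].
  by rewrite lebesgue_measure_itv/= lte_fin; case: ltP => // h; rewrite -EFinD subr0.
suff : m1 B = m2 B by [].
pose G := @measurable_realfun.RGenInftyO.G R.
have mG : (measurable : set (set (measurableTypeR R))) = <<s G >>.
  exact: measurable_realfun.RGenInftyO.measurableE.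
apply: (@measure_unique _ R (measurableTypeR R) G (fun n => `]-oo, n%:R[%classic) mG
  _ _ _ m1 m2 _ _ B mB).
- move=> _ _ [x ->] [y ->]; exists (Num.min x y).
  by apply/seteqP; split => z; rewrite /= !in_itv/= lt_min; [move=> [-> ->]|move=> /andP[]].
- by move=> n; exists n%:R.
- apply/seteqP; split => // x _; exists (Num.truncn `|x|).+1 => //=.
  by rewrite in_itv/= (le_lt_trans (ler_norm x))// truncnS_gt.
- by move=> _ [x ->]; exact: etrans (m1E x) (esym (m2E x)).
- by move=> n; rewrite [X in (X < _)%E]m1E ltry.
Qed.

Lemma integral_radial w (g : R -> \bar R) :
  measurable_fun setT (g : measurableTypeR R -> \bar R) -> (forall s, 0 <= g s)%E ->
  (\int[area R]_z g (sqdist w z) = pi%:E * \int[lebesgue_measure]_(s in `[0%R, +oo[) g s)%E.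
Proof.
move=> mg g0.
have E : (\int[area R]_z g (sqdist w z) =
    \int[area R]_(z in sqdist w @^-1` nneg) (g \o (sqdist w : plane R -> measurableTypeR R)) z)%E.
  rewrite (_ : _ @^-1` _ = setT)//; apply/seteqP; split => // z _.
  by rewrite /nneg/= in_itv/= sqdist_ge0.
rewrite E -(ge0_integral_pushforward (measurable_sqdist w) _ mnneg) => [| |y _]; last 2 first.
- exact: measurable_funTS.
- exact: g0.
pose push := [the {measure set (measurableTypeR R) -> \bar R} of
  pushforward (area R) (sqdist w : plane R -> measurableTypeR R)].
have me (B : set (measurableTypeR R)) : measurable B -> B `<=` nneg ->
    push (measurable_sqdist w) B = mscale pinn (@lebesgue_measure R) B.
  move=> mB Bn; apply: etrans (pushforward_sqdist w mB) _.
  by rewrite (setIidl Bn).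
transitivity (\int[mscale pinn (@lebesgue_measure R)]_(y in nneg) g y)%E.
  exact: (eq_measure_integral (mscale pinn (@lebesgue_measure R))
    (m1 := push (measurable_sqdist w))).
rewrite ge0_integral_mscale//; exact: measurable_funTS.
Qed.
End RadialIntegral.

(** * Quaternions and slices *)

Section Quaternions.
Variable R : realType.
Implicit Types (q p u I : quat R) (a b : R) (z w : R * R).

Lemma qnorm_sqr q : `|q| ^+ 2 = qre q ^+ 2 + qi q ^+ 2 + qj q ^+ 2 + qk q ^+ 2.
Proof. by rewrite [`|q|]/Num.norm/= /qnorm sqr_sqrtr// !addr_ge0 ?sqr_ge0. Qed.

Lemma quat_eqP q p : [/\ qre q = qre p, qi q = qi p, qj q = qj p & qk q = qk p] ->
  q = p.
Proof. by case: q p => ???? [????] /= [-> -> -> ->]. Qed.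

Lemma qre0 : qre (0 : quat R) = 0. Proof. by []. Qed.
Lemma qreD q p : qre (q + p) = qre q + qre p. Proof. by []. Qed.
Lemma qreN q : qre (- q) = - qre q. Proof. by []. Qed.
Lemma qreB q p : qre (q - p) = qre q - qre p. Proof. by []. Qed.
Lemma qreZ a q : qre (a *: q) = a * qre q. Proof. by []. Qed.
Lemma qre_sum (n : nat) (F : nat -> quat R) :
  qre (\sum_(i < n) F i) = \sum_(i < n) qre (F i).
Proof. by elim/big_ind2 : _ => // ? ? ? ? <- <-. Qed.

(** The functionals q |-> Re (u q) separate quaternions. All the analysis of
    quaternion-valued functions is reduced to real functions through them,
    because they absorb left multiplications: Re (u (v q)) = Re ((u v) q). *)
Lemma qre_eqP q p : (forall u, qre (u * q) = qre (u * p)) -> q = p.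
Proof.
move=> h; have := h (Quat 1 0 0 0); have := h (Quat 0 1 0 0).
have := h (Quat 0 0 1 0); have := h (Quat 0 0 0 1).
by case: q p {h} => a b c d [x y z t] /= *; apply: quat_eqP; split => /=; lra.
Qed.

Lemma quat_algE a : a%:A = Quat a 0 0 0 :> quat R.
Proof. by apply: quat_eqP; split => /=; rewrite ?mulr1 ?mulr0. Qed.

Lemma qmul_algl a q : a%:A * q = a *: q.
Proof. by rewrite -scalerAl mul1r. Qed.

(** The modulus is multiplicative by Euler's four-square identity. *)
Lemma quat_normM q p : `|q * p| = `|q| * `|p|.
Proof.
apply/eqP; rewrite -(@eqrXn2 _ 2)// ?mulr_ge0// exprMn !qnorm_sqr; apply/eqP.
by case: q p => a b c d [x y z t] /=; ring.
Qed.

Lemma quat_norm1 : `|1 : quat R| = 1.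
Proof.
apply/eqP; rewrite -(@eqrXn2 _ 2)// qnorm_sqr /=; apply/eqP.
by rewrite expr1n expr0n /= !addr0.
Qed.

Lemma quat_normX q n : `|q ^+ n| = `|q| ^+ n.
Proof. by elim: n => [|n IHn]; rewrite ?quat_norm1// !exprS quat_normM IHn. Qed.

Lemma qconj_norm q : `|qconj q| = `|q|.
Proof.
by apply/eqP; rewrite -(@eqrXn2 _ 2)// !qnorm_sqr /= !sqrrN.
Qed.

Lemma qconjM q p : qconj (q * p) = qconj p * qconj q.
Proof. by case: q p => a b c d [x y z t]; apply: quat_eqP; split => /=; ring. Qed.

Lemma qconjX q n : qconj (q ^+ n) = qconj q ^+ n.
Proof.
elim: n => [|n IHn]; last by rewrite exprSr qconjM IHn exprS.
by apply: quat_eqP; split => //=; rewrite oppr0.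
Qed.

Lemma qconjK q : qconj (qconj q) = q.
Proof. by case: q => a b c d; rewrite /qconj /= !opprK. Qed.

Lemma qconj_mul q : qconj q * q = (`|q| ^+ 2)%:A.
Proof.
rewrite qnorm_sqr quat_algE.
by case: q => a b c d; apply: quat_eqP; split => /=; ring.
Qed.

Lemma qmul_conj q : q * qconj q = (`|q| ^+ 2)%:A.
Proof. by rewrite -(qconj_norm q) -qconj_mul qconjK. Qed.

Lemma normr_qre q : `|qre q| <= `|q|.
Proof.
rewrite -(@ler_pXn2r _ 2)// ?nnegrE// qnorm_sqr.
by rewrite real_normK ?num_real// -!addrA lerDl !addr_ge0 ?sqr_ge0.
Qed.

Lemma normr_qre_mul u q : `|qre (u * q)| <= `|u| * `|q|.
Proof. by rewrite -quat_normM normr_qre. Qed.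

(** The bound is attained at u = conj q / |q|. *)
Lemma norm_qre_le (b : R) q : 0 <= b -> (forall u, `|u| <= 1 -> `|qre (u * q)| <= b) ->
  `|q| <= b.
Proof.
move=> b0 h; have [->|q0] := eqVneq q 0; first by rewrite normr0.
have nq : 0 < `|q| by rewrite normr_gt0.
have := h (`|q|^-1 *: qconj q).
rewrite normrZ qconj_norm normrV ?unitfE ?gt_eqF// normr_id mulVf ?gt_eqF// lexx => /(_ isT).
rewrite -scalerAl qconj_mul qreZ quat_algE /= expr2 mulrA mulVf ?gt_eqF// mul1r normr_id.
exact.
Qed.

Lemma imag_unitE I : imag_unit I -> qre I = 0 /\ qi I ^+ 2 + qj I ^+ 2 + qk I ^+ 2 = 1.
Proof.
rewrite /imag_unit /= expr2; case: I => a b c d [] /= h1 h2 h3 h4.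
have a0 : a = 0.
  apply/eqP; apply/negP => /negP a0.
  have b0 : b = 0 by apply: (mulfI a0); lra.
  have c0 : c = 0 by apply: (mulfI a0); lra.
  have d0 : d = 0 by apply: (mulfI a0); lra.
  by have := sqr_ge0 a; rewrite expr2; subst; lra.
by subst; split => //; rewrite !expr2; lra.
Qed.

Lemma imag_unit_sqr I : imag_unit I -> I * I = -1.
Proof. by rewrite -expr2. Qed.

Lemma slice_ptM I z w : imag_unit I ->
  slice_pt I z * slice_pt I w =
  slice_pt I (z.1 * w.1 - z.2 * w.2, z.1 * w.2 + z.2 * w.1).
Proof.
move=> /imag_unit_sqr h.
have -> : slice_pt I z * slice_pt I w =
    (z.1 * w.1)%:A + (z.1 * w.2 + z.2 * w.1) *: I + (z.2 * w.2) *: (I * I).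
  rewrite /slice_pt !quat_algE; case: I {h} => a b c d.
  by apply: quat_eqP; split => /=; ring.
by rewrite h /slice_pt scalerN scalerBl addrAC.
Qed.

Lemma slice_ptC I z w : imag_unit I ->
  slice_pt I z * slice_pt I w = slice_pt I w * slice_pt I z.
Proof. by move=> h; rewrite !slice_ptM//; congr slice_pt; congr pair; ring. Qed.

Lemma slice_pt_norm I z : imag_unit I -> `|slice_pt I z| ^+ 2 = z.1 ^+ 2 + z.2 ^+ 2.
Proof.
move=> /imag_unitE[h0 h1]; rewrite qnorm_sqr /slice_pt quat_algE /= h0 !mulr0 !add0r addr0.
by rewrite -!addrA; congr (_ + _); rewrite !exprMn -!mulrDr addrA h1 mulr1.
Qed.

Lemma slice_pt_conj I z : imag_unit I -> qconj (slice_pt I z) = slice_pt (- I) z.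
Proof.
move=> /imag_unitE[h0 _].
by rewrite /slice_pt !quat_algE; apply: quat_eqP; split => /=; rewrite ?h0; lra.
Qed.

Lemma slice_ptB I z w : slice_pt I (z - w) = slice_pt I z - slice_pt I w.
Proof.
by rewrite /slice_pt /= !scalerBl opprD addrACA.
Qed.

(** Take I = Im q / |Im q|; a real quaternion lies in every slice. *)
Lemma mem_slice q : exists2 I, imag_unit I & exists z, q = slice_pt I z.
Proof.
have [q0|q0] := eqVneq (qim q) 0.
  exists (Quat 0 1 0 0).
    by rewrite /imag_unit /= expr2; apply: quat_eqP; split => /=; ring.
  exists (qre q, 0); rewrite /slice_pt /= scale0r addr0 quat_algE.
  by move: q0 => [? ? ?]; apply: quat_eqP.
have nq : 0 < `|qim q| by rewrite normr_gt0.
exists (`|qim q|^-1 *: qim q).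
  rewrite /imag_unit /= exprZn exprVn.
  have -> : qim q ^+ 2 = - (`|qim q| ^+ 2)%:A.
    by rewrite qnorm_sqr quat_algE expr2; apply: quat_eqP; split => /=; ring.
  by rewrite scalerN scalerA mulVf ?scale1r// expf_neq0// gt_eqF.
exists (qre q, `|qim q|); rewrite /slice_pt /= scalerA divff ?gt_eqF// scale1r quat_algE.
by apply: quat_eqP; split => /=; rewrite ?addr0 ?add0r.
Qed.

Lemma qnorm_le_sum q : `|q| <= `|qre q| + `|qi q| + `|qj q| + `|qk q|.
Proof.
rewrite -(@ler_pXn2r _ 2)// ?nnegrE ?addr_ge0// qnorm_sqr.
rewrite -(real_normK (num_real (qre q))) -(real_normK (num_real (qi q))).
rewrite -(real_normK (num_real (qj q))) -(real_normK (num_real (qk q))).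
have := normr_ge0 (qre q); have := normr_ge0 (qi q).
have := normr_ge0 (qj q); have := normr_ge0 (qk q).
move: `|qre q| `|qi q| `|qj q| `|qk q| => x y s t t0 s0 y0 x0.
have := mulr_ge0 x0 y0; have := mulr_ge0 x0 s0; have := mulr_ge0 x0 t0.
have := mulr_ge0 y0 s0; have := mulr_ge0 y0 t0; have := mulr_ge0 s0 t0.
nra.
Qed.

Lemma qre_mulZ u (a : R) q : qre (u * (a *: q)) = a * qre (u * q).
Proof. by rewrite -scalerAr qreZ. Qed.

Lemma slice_pt_mul u I z q :
  qre (u * (slice_pt I z * q)) = z.1 * qre (u * q) + z.2 * qre (u * I * q).
Proof.
by rewrite /slice_pt mulrDl qmul_algl -scalerAl mulrDr -!scalerAr qreD !qreZ mulrA.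
Qed.

Lemma slice_pt_mull I z q : slice_pt I z * q = z.1 *: q + z.2 *: (I * q).
Proof. by rewrite /slice_pt mulrDl qmul_algl -scalerAl. Qed.

Lemma slice_conjE I z : imag_unit I ->
  qconj (slice_pt I z) = slice_pt I (z.1, - z.2).
Proof. by move=> hI; rewrite slice_pt_conj// /slice_pt /= scalerN scaleNr. Qed.

End Quaternions.

(** * Quaternion-valued functions *)

Section QuaternionCalculus.
Variable R : realType.
Implicit Types (q p u I : quat R) (a b : R) (z w : R * R).
Implicit Types (F G : R * R -> quat R).

(** Continuity, derivatives and integrals are all tested on the functionals q
    |-> Re (u q), so that left multiplication by a constant preserves them by
    mere reassociation. *)
Definition qcont (T : topologicalType) (F : T -> quat R) (x : T) :=
  forall u, {for x, continuous (fun t => qre (u * F t))}.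

Definition qderiv (f : R -> quat R) (t : R) (d : quat R) :=
  forall u, is_derive t (1:R) (fun s => qre (u * f s)) (qre (u * d)).

Definition qintegrable F :=
  forall u, (area R).-integrable setT (fun z : plane R => (qre (u * F z))%:E).

Definition qint F : quat R :=
  Quat (\int[area R]_z qre (F z)) (\int[area R]_z qi (F z))
       (\int[area R]_z qj (F z)) (\int[area R]_z qk (F z)).

Lemma plane_integrableZ a (h : plane R -> R) :
  (area R).-integrable setT (fun z => (h z)%:E) ->
  (area R).-integrable setT (fun z => (a * h z)%:E).
Proof. by move=> ih; exact: (integrableZl measurableT a ih). Qed.

Lemma plane_integrableB (h k : plane R -> R) :
  (area R).-integrable setT (fun z => (h z)%:E) ->
  (area R).-integrable setT (fun z => (k z)%:E) ->
  (area R).-integrable setT (fun z => (h z - k z)%:E).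
Proof. by move=> ih ik; exact: (integrableB measurableT ih ik). Qed.

Lemma qre_comp_mul u q :
  qre (u * q) = qre u * qre q - qi u * qi q - qj u * qj q - qk u * qk q.
Proof. by []. Qed.

(** The case u = 1, -i, -j, -k is the definition of [qint]; the general one
    follows by linearity. *)
Lemma qint_re u F : qintegrable F ->
  qre (u * qint F) = \int[area R]_z qre (u * F z).
Proof.
move=> iF.
have E (v : quat R) (h : quat R -> R) : (forall q, qre (v * q) = h q) ->
    (area R).-integrable setT (fun z : plane R => (h (F z))%:E).
  by move=> vh; have := iF v; under eq_fun do rewrite vh.
have i0 := E 1 _ (fun q => congr1 _ (mul1r q)).
have i1 := E (Quat 0 (-1) 0 0) (@qi R) ltac:(by case=> ????/=; ring).
have i2 := E (Quat 0 0 (-1) 0) (@qj R) ltac:(by case=> ????/=; ring).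
have i3 := E (Quat 0 0 0 (-1)) (@qk R) ltac:(by case=> ????/=; ring).
rewrite qre_comp_mul /= -!RintegralZl//.
have [j0 j1 j2 j3] := And4 (plane_integrableZ (qre u) i0) (plane_integrableZ (qi u) i1)
  (plane_integrableZ (qj u) i2) (plane_integrableZ (qk u) i3).
have j01 := plane_integrableB j0 j1; have j012 := plane_integrableB j01 j2.
by rewrite -(RintegralB measurableT j0 j1) -(RintegralB measurableT j01 j2) -(RintegralB measurableT j012 j3).
Qed.

Lemma eq_qint F G : F =1 G -> qint F = qint G.
Proof. by move=> /funext ->. Qed.

Lemma qintegrableMl c F : qintegrable F -> qintegrable (fun z => c * F z).
Proof. by move=> iF u; have := iF (u * c); under eq_fun do rewrite -mulrA. Qed.

Lemma qintegrableZ a F : qintegrable F -> qintegrable (fun z => a *: F z).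
Proof.
move=> iF u; have := iF (a *: u).
by under eq_fun do rewrite -scalerAl scalerAr.
Qed.

Lemma qintegrableD F G : qintegrable F -> qintegrable G ->
  qintegrable (fun z => F z + G z).
Proof.
move=> iF iG u; under eq_fun do rewrite mulrDr qreD EFinD.
by apply: integrableD.
Qed.

Lemma qintMl c F : qintegrable F -> qint (fun z => c * F z) = c * qint F.
Proof.
move=> iF; apply: qre_eqP => u; rewrite qint_re; last exact: qintegrableMl.
rewrite mulrA qint_re//; apply: eq_Rintegral => z _; by rewrite mulrA.
Qed.

Lemma qintZ a F : qintegrable F -> qint (fun z => a *: F z) = a *: qint F.
Proof.
by move=> iF; rewrite -qmul_algl -qintMl//; apply: eq_qint => z; rewrite qmul_algl.
Qed.

Lemma qintD F G : qintegrable F -> qintegrable G ->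
  qint (fun z => F z + G z) = qint F + qint G.
Proof.
move=> iF iG; apply: qre_eqP => u; rewrite mulrDr qreD !qint_re//; last exact: qintegrableD.
by rewrite -(RintegralD measurableT (iF u) (iG u)); apply: eq_Rintegral => z _; rewrite mulrDr.
Qed.

Lemma qintB F G : qintegrable F -> qintegrable G ->
  qint (fun z => F z - G z) = qint F - qint G.
Proof.
move=> iF iG; rewrite -[in RHS]scaleN1r -qintZ// -qintD//; last exact: qintegrableZ.
by apply: eq_qint => z; rewrite scaleN1r.
Qed.

Lemma qint_sum (n : nat) (F : nat -> R * R -> quat R) :
  (forall i, qintegrable (F i)) ->
  qintegrable (fun z => \sum_(i < n) F i z) /\
  qint (fun z => \sum_(i < n) F i z) = \sum_(i < n) qint (F i).
Proof.
move=> iF; elim: n => [|n [IH1 IH2]].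
  split.
    move=> u; under eq_fun do rewrite big_ord0 mulr0.
    exact: integrable0.
  rewrite big_ord0; apply: qre_eqP => u.
  have i0 : qintegrable (fun z => \sum_(i < 0) F i z).
    by move=> v; under eq_fun do rewrite big_ord0 mulr0; exact: integrable0.
  rewrite qint_re// mulr0; under eq_Rintegral do rewrite big_ord0 mulr0.
  by rewrite /Rintegral integral0.
have -> : (fun z => \sum_(i < n.+1) F i z) = (fun z => \sum_(i < n) F i z + F n z).
  by apply/funext => z; rewrite big_ord_recr.
split; first exact: qintegrableD.
by rewrite qintD// IH2 big_ord_recr.
Qed.

(** The square of side 2 M contains the support; [norm_qre_le] reduces the
    bound to real integrands. *)
Lemma qint_norm_le (B M : R) F : 0 <= B -> 0 <= M -> qintegrable F ->
  (forall z, M < `|z| -> F z = 0) -> (forall z, `|F z| <= B) ->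
  `|qint F| <= B * (M *+ 2) ^+ 2.
Proof.
move=> B0 M0 iF F0 FB; apply: norm_qre_le => [|u u1].
  by rewrite mulr_ge0// sqr_ge0.
rewrite qint_re//; apply: (le_trans (le_normr_Rintegral measurableT (iF u))).
pose D := [set z : plane R | `|z| <= M].
have mD : measurable D by exact: measurable_plane_box.
have aD : area R D = ((M *+ 2) ^+ 2)%:E by exact: area_plane_box.
have -> : (fun z : plane R => `|qre (u * F z)|) = (fun z : plane R => `|qre (u * F z)|) \_ D.
  apply/funext => z; rewrite patchE; case: ifPn => // zD.
  rewrite F0 ?mulr0; first by rewrite qre0 normr0.
  by move: zD; rewrite notin_setE/D/= => /negP; rewrite -ltNge.
rewrite -Rintegral_mkcond.
have ic : (area R).-integrable D (EFin \o (fun=> B)).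
  apply: measurable_bounded_integrable => //; first by rewrite [X in (X < _)%E]aD ltry.
  by exists `|B|; split => // x Bx z _; exact: ltW.
apply: (@le_trans _ _ (\int[area R]_(z in D) B)); last first.
  by rewrite Rintegral_cst// [X in fine X]aD.
apply: le_Rintegral => //.
- by apply: integrableS (integrable_norm (iF u)).
- move=> z _; apply: (le_trans (normr_qre_mul _ _)).
  by rewrite -[B]mul1r ler_pM.
Qed.

Lemma qcont_compact_support (M : R) F : (forall z, qcont F z) ->
  (forall z, M < `|z| -> F z = 0) -> qintegrable F.
Proof.
move=> cF F0 u; apply: (@compact_support_integrable R M (fun z => qre (u * F z))).
  by move=> z; exact: cF.
by move=> z Mz; rewrite F0// mulr0.
Qed.

End QuaternionCalculus.

(** * Holomorphic functions on a slice and Stokes' formula *)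

Section Regular.
Variable R : realType.
Implicit Types (q p u I : quat R) (a b : R) (z w : R * R) (C Om : set (R * R)).
Implicit Types (F G Fx Fy : R * R -> quat R).

(** The partial derivatives Fx, Fy are part of the data, which avoids
    reasoning about the derivatives of the explicit functions to which this is
    applied. *)
Definition regular_with I Om F Fx Fy := forall z, Om z ->
  [/\ qcont F z, qcont Fx z, qcont Fy z,
      qderiv (fun t => F (t, z.2)) z.1 (Fx z) /\
      qderiv (fun t => F (z.1, t)) z.2 (Fy z) &
      Fx z + I * Fy z = 0].

Definition plane_C1 (k kx ky : R * R -> R) Om := forall z, Om z ->
  [/\ {for z, continuous k}, {for z, continuous kx}, {for z, continuous ky},
      is_derive z.1 (1:R) (fun t : R => k (t, z.2)) (kx z) &
      is_derive z.2 (1:R) (fun t : R => k (z.1, t)) (ky z)].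

Lemma near_drv (f g : R -> R) (t a : R) : (\forall s \near t, f s = g s) ->
  is_derive t (1:R) g a -> is_derive t (1:R) f a.
Proof.
move=> fg; apply: near_eq_is_derive.
by near=> s; apply/esym; near: s.
Unshelve. all: by end_near. Qed.

(** Near a point outside the closed set C the product vanishes identically, so
    nothing is required of g there. *)
Lemma cutoff_continuous C Om (k g : R * R -> R) : closed C -> C `<=` Om ->
  continuous k -> (forall z, ~ C z -> k z = 0) ->
  (forall z, Om z -> {for z, continuous g}) ->
  continuous (fun z => k z * g z).
Proof.
move=> cC COm ck k0 cg z; have [Omz|nOm] := pselect (Om z).
  suff : {for z, continuous (fun z => k z * g z)} by [].
  by apply: contM; [exact: ck|exact: cg].
have nC : ~ C z by move/COm.
have nb : nbhs z (~` C) by apply: open_nbhs_nbhs; split => //; exact: closed_openC.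
rewrite /continuous_at k0// mul0r; apply: cvg_near_cst.
by near=> s; rewrite k0 ?mul0r//; near: s.
Unshelve. all: by end_near. Qed.

Lemma cutoff_drv_x C (k : R * R -> R) (z : R * R) : closed C ->
  (forall z, ~ C z -> k z = 0) -> ~ C z ->
  is_derive z.1 (1:R) (fun t => k (t, z.2)) 0.
Proof.
case: z => x y /= cC k0 nC.
apply: (@near_drv _ (fun=> 0)).
have nb : nbhs (x, y) (~` C) by apply: open_nbhs_nbhs; split => //; exact: closed_openC.
have H := @pairr_continuous R y x _ nb.
by near=> t; apply: k0; near: t; exact: H.
Unshelve. all: by end_near. Qed.

Lemma cutoff_drv_y C (k : R * R -> R) (z : R * R) : closed C ->
  (forall z, ~ C z -> k z = 0) -> ~ C z ->
  is_derive z.2 (1:R) (fun t => k (z.1, t)) 0.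
Proof.
case: z => x y /= cC k0 nC.
apply: (@near_drv _ (fun=> 0)).
have nb : nbhs (x, y) (~` C) by apply: open_nbhs_nbhs; split => //; exact: closed_openC.
have H := @pairl_continuous R x y _ nb.
by near=> t; apply: k0; near: t; exact: H.
Unshelve. all: by end_near. Qed.

(** The integrand is (d/dx + I d/dy) (k F), because (d/dx + I d/dy) F = 0 and
    k is real; each of the two partial derivatives integrates to 0. *)
Lemma stokes I (M : R) C Om (k kx ky : R * R -> R) F Fx Fy :
  closed C -> C `<=` Om -> (forall z, C z -> `|z| <= M) ->
  plane_C1 k kx ky setT ->
  (forall z, ~ C z -> [/\ k z = 0, kx z = 0 & ky z = 0]) ->
  regular_with I Om F Fx Fy ->
  let G := (fun z => kx z *: F z + ky z *: (I * F z)) in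
  [/\ forall z, qcont G z, forall z, M < `|z| -> G z = 0 & qint G = 0].
Proof.
move=> cC COm CM kC1 k0 rF G.
have kz z : ~ C z -> k z = 0 by move=> /k0[].
have kxz z : ~ C z -> kx z = 0 by move=> /k0[].
have kyz z : ~ C z -> ky z = 0 by move=> /k0[].
have ck : continuous k by move=> z; have [] := kC1 z Logic.I.
have ckx : continuous kx by move=> z; have [] := kC1 z Logic.I.
have cky : continuous ky by move=> z; have [] := kC1 z Logic.I.
have CMN z : M < `|z| -> ~ C z by move=> h /CM; rewrite leNgt h.
have cG z : qcont G z.
  move=> u.
  have -> : (fun t => qre (u * G t)) =
      (fun t => kx t * qre (u * F t) + ky t * qre (u * I * F t)).
    by apply/funext => t; rewrite /G mulrDr qreD -!scalerAr !qreZ mulrA.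
  apply: contD.
    apply: (cutoff_continuous (g := fun t => qre (u * F t)) cC COm ckx kxz) => t /rF[h _ _ _ _].
    exact: h.
  apply: (cutoff_continuous (g := fun t => qre (u * I * F t)) cC COm cky kyz) => t /rF[h _ _ _ _].
  exact: h.
have G0 z : M < `|z| -> G z = 0.
  by move=> /CMN h; rewrite /G kxz// kyz// !scale0r addr0.
split => //.
apply: qre_eqP => u; rewrite qint_re; last exact: qcont_compact_support cG G0.
rewrite mulr0.
pose g z := k z * qre (u * F z).
pose gx z := kx z * qre (u * F z) + k z * qre (u * Fx z).
pose h z := k z * qre (u * I * F z).
pose hy z := ky z * qre (u * I * F z) + k z * qre (u * I * Fy z).
have cgx : continuous gx.
  move=> z; suff : {for z, continuous gx} by [].
  apply: contD.
    apply: (cutoff_continuous (g := fun t => qre (u * F t)) cC COm ckx kxz) => t /rF[H _ _ _ _].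
    exact: H.
  apply: (cutoff_continuous (g := fun t => qre (u * Fx t)) cC COm ck kz) => t /rF[_ H _ _ _].
  exact: H.
have chy : continuous hy.
  move=> z; suff : {for z, continuous hy} by [].
  apply: contD.
    apply: (cutoff_continuous (g := fun t => qre (u * I * F t)) cC COm cky kyz) => t /rF[H _ _ _ _].
    exact: H.
  apply: (cutoff_continuous (g := fun t => qre (u * I * Fy t)) cC COm ck kz) => t /rF[_ _ H _ _].
  exact: H.
have gx0 z : M < `|z| -> gx z = 0.
  by move=> /CMN H; rewrite /gx kxz// kz// !mul0r addr0.
have hy0 z : M < `|z| -> hy z = 0.
  by move=> /CMN H; rewrite /hy kyz// kz// !mul0r addr0.
have ig : \int[area R]_z (gx z : R) = 0.
  apply: (integral_dx (M := M) (g := g)) => //.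
    by move=> z /CMN H; rewrite /g kz// mul0r.
  move=> x y; have [Cz|nCz] := pselect (C (x, y)).
    have [_ _ _ dk _] := kC1 (x, y) Logic.I.
    have [_ _ _ [dF _] _] := rF _ (COm _ Cz).
    exact: drvM dk (dF u).
  rewrite /gx kxz// kz// !mul0r addr0.
  by apply: (@cutoff_drv_x C g (x, y)) => // z nz; rewrite /g kz// mul0r.
have ih : \int[area R]_z (hy z : R) = 0.
  apply: (integral_dy (M := M) (g := h)) => //.
    by move=> z /CMN H; rewrite /h kz// mul0r.
  move=> x y; have [Cz|nCz] := pselect (C (x, y)).
    have [_ _ _ _ dk] := kC1 (x, y) Logic.I.
    have [_ _ _ [_ dF] _] := rF _ (COm _ Cz).
    exact: drvM dk (dF (u * I)).
  rewrite /hy kyz// kz// !mul0r addr0.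
  by apply: (@cutoff_drv_y C h (x, y)) => // z nz; rewrite /h kz// mul0r.
have igx := compact_support_integrable cgx gx0.
have ihy := compact_support_integrable chy hy0.
transitivity (\int[area R]_z (gx z + hy z)); last first.
  by rewrite (RintegralD measurableT igx ihy) ig ih addr0.
apply: eq_Rintegral => z _; rewrite /gx /hy /G mulrDr qreD -!scalerAr !qreZ mulrA.
have [Cz|nCz] := pselect (C z); last by rewrite kz// kxz// kyz// !mul0r !addr0.
have [_ _ _ _ CR] := rF _ (COm _ Cz).
have : qre (u * Fx z) + qre (u * I * Fy z) = 0.
  by rewrite -mulrA -qreD -mulrDr CR mulr0.
by move=> /(congr1 (fun t => k z * t)); rewrite mulr0 mulrDr; lra.
Qed.

End Regular.

(** * Holomorphic factors *)

Section HolomorphicFactors.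
Variable R : realType.
Implicit Types (q p u I : quat R) (a b : R) (z w : R * R) (C Om : set (R * R)).
Implicit Types (F G Fx Fy : R * R -> quat R).

(** Left multiplication by a + b I, with a, b real functions satisfying the
    Cauchy-Riemann equations. Quaternions do not commute, but a + b I commutes
    with the I of the operator d/dx + I d/dy. *)
Lemma regular_mul I Om (a ax ay b bx by' : R * R -> R) F Fx Fy :
  imag_unit I ->
  plane_C1 a ax ay Om -> plane_C1 b bx by' Om ->
  (forall z, Om z -> ax z = by' z) -> (forall z, Om z -> ay z = - bx z) ->
  regular_with I Om F Fx Fy ->
  regular_with I Om (fun z => slice_pt I (a z, b z) * F z)
    (fun z => slice_pt I (ax z, bx z) * F z + slice_pt I (a z, b z) * Fx z)
    (fun z => slice_pt I (ay z, by' z) * F z + slice_pt I (a z, b z) * Fy z).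
Proof.
move=> hI ca cb e1 e2 rF z Omz.
have [ka kax kay dax day] := ca z Omz; have [kb kbx kby dbx dby] := cb z Omz.
have [kF kFx kFy [dFx dFy] CR] := rF z Omz.
split.
- move=> u.
  have -> : (fun t => qre (u * (slice_pt I (a t, b t) * F t))) =
      (fun t => a t * qre (u * F t) + b t * qre (u * I * F t)).
    by apply/funext => t; rewrite slice_pt_mul.
  by apply: contD; apply: contM => //.
- move=> u.
  have -> : (fun t => qre (u * (slice_pt I (ax t, bx t) * F t + slice_pt I (a t, b t) * Fx t))) =
      (fun t => (ax t * qre (u * F t) + bx t * qre (u * I * F t)) +
                (a t * qre (u * Fx t) + b t * qre (u * I * Fx t))).
    by apply/funext => t; rewrite mulrDr qreD !slice_pt_mul.
  by apply: contD; apply: contD; apply: contM => //.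
- move=> u.
  have -> : (fun t => qre (u * (slice_pt I (ay t, by' t) * F t + slice_pt I (a t, b t) * Fy t))) =
      (fun t => (ay t * qre (u * F t) + by' t * qre (u * I * F t)) +
                (a t * qre (u * Fy t) + b t * qre (u * I * Fy t))).
    by apply/funext => t; rewrite mulrDr qreD !slice_pt_mul.
  by apply: contD; apply: contD; apply: contM => //.
- split=> u.
  + have -> : (fun t => qre (u * (slice_pt I (a (t, z.2), b (t, z.2)) * F (t, z.2)))) =
        (fun t => a (t, z.2) * qre (u * F (t, z.2)) + b (t, z.2) * qre (u * I * F (t, z.2))).
      by apply/funext => t; rewrite slice_pt_mul.
    apply: drvE (drvD (drvM dax (dFx u)) (drvM dbx (dFx (u * I)))) _.
    by rewrite (mulrDr u) qreD !slice_pt_mul -surjective_pairing /=; ring.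
  + have -> : (fun t => qre (u * (slice_pt I (a (z.1, t), b (z.1, t)) * F (z.1, t)))) =
        (fun t => a (z.1, t) * qre (u * F (z.1, t)) + b (z.1, t) * qre (u * I * F (z.1, t))).
      by apply/funext => t; rewrite slice_pt_mul.
    apply: drvE (drvD (drvM day (dFy u)) (drvM dby (dFy (u * I)))) _.
    by rewrite (mulrDr u) qreD !slice_pt_mul -surjective_pairing /=; ring.
- have E : I = slice_pt I (0, 1) by rewrite /slice_pt /= scale0r add0r scale1r.
  have comm : I * slice_pt I (a z, b z) = slice_pt I (a z, b z) * I.
    by rewrite {1 4}E slice_ptC.
  have I0 : slice_pt I (ax z, bx z) + I * slice_pt I (ay z, by' z) = 0.
    rewrite {2}E slice_ptM//= !mul0r !mul1r sub0r add0r e1// e2//.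
    by rewrite /slice_pt /= addrACA -!scalerDl !subrr !scale0r addr0.
  rewrite mulrDr !mulrA comm addrACA -!mulrA -mulrDr CR mulr0 addr0 mulrA -mulrDl.
  by rewrite I0 mul0r.
Qed.

Lemma drv_sqdist_x w z : is_derive z.1 (1:R) (fun t => sqdist w (t, z.2)) (2 * (z.1 - w.1)).
Proof.
apply: drvE (drvD (drvX 2 (drvB (drvI _) (drvC w.1 _))) (drvC ((z.2 - w.2) ^+ 2) _)) _.
by rewrite /=; ring.
Qed.

Lemma drv_sqdist_y w z : is_derive z.2 (1:R) (fun t => sqdist w (z.1, t)) (2 * (z.2 - w.2)).
Proof.
apply: drvE (drvD (drvC ((z.1 - w.1) ^+ 2) _) (drvX 2 (drvB (drvI _) (drvC w.2 _)))) _.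
by rewrite /=; ring.
Qed.

Lemma cont_fstB w z : {for z, continuous (fun t : R * R => t.1 - w.1)}.
Proof. by apply: contB; [exact: cvg_fst|exact: contC]. Qed.

Lemma cont_sndB w z : {for z, continuous (fun t : R * R => t.2 - w.2)}.
Proof. by apply: contB; [exact: cvg_snd|exact: contC]. Qed.

Lemma C1_sqdist_comp w (V v : R -> R) : (forall t : R, {for t, continuous v}) ->
  (forall t : R, is_derive t (1:R) V (v t)) ->
  plane_C1 (fun z => V (sqdist w z))
    (fun z => v (sqdist w z) * (2 * (z.1 - w.1)))
    (fun z => v (sqdist w z) * (2 * (z.2 - w.2))) setT.
Proof.
move=> cv dV z _; split.
- by apply: cont_comp; [exact: continuous_sqdist|exact: drv_continuous (dV _)].
- apply: contM; first by apply: cont_comp; [exact: continuous_sqdist|exact: cv].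
  by apply: contM; [exact: contC|exact: cont_fstB].
- apply: contM; first by apply: cont_comp; [exact: continuous_sqdist|exact: cv].
  by apply: contM; [exact: contC|exact: cont_sndB].
- by apply: drv_comp (drv_sqdist_x w z) _; rewrite -surjective_pairing.
- by apply: drv_comp (drv_sqdist_y w z) _; rewrite -surjective_pairing.
Qed.

(** The inverse of z - w inside the slice of I, that is conj (z - w) / |z -
    w|^2. *)
Definition slice_inv I w z : quat R :=
  slice_pt I ((z.1 - w.1) / sqdist w z, - (z.2 - w.2) / sqdist w z).

Lemma sqdist_neq0 w z : z <> w -> sqdist w z != 0.
Proof.
move=> zw; apply/negP => /eqP h; apply: zw.
have h1 : z.1 - w.1 = 0.
  apply/eqP; rewrite -sqrf_eq0; apply/eqP; move: h; rewrite /sqdist.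
  by have := sqr_ge0 (z.1 - w.1); have := sqr_ge0 (z.2 - w.2); lra.
have h2 : z.2 - w.2 = 0.
  apply/eqP; rewrite -sqrf_eq0; apply/eqP; move: h; rewrite /sqdist.
  by have := sqr_ge0 (z.1 - w.1); have := sqr_ge0 (z.2 - w.2); lra.
by case: z w {h} h1 h2 => x y [x0 y0] /= *; congr pair; lra.
Qed.

Lemma slice_invK I w z : imag_unit I -> z <> w ->
  slice_pt I (z - w) * slice_inv I w z = 1.
Proof.
move=> hI /sqdist_neq0 h; rewrite /slice_inv slice_ptM//=.
have -> : (z.1 - w.1) * ((z.1 - w.1) / sqdist w z) -
    (z.2 - w.2) * (- (z.2 - w.2) / sqdist w z) = 1.
  by move: h; rewrite /sqdist => h; field.
have -> : (z.1 - w.1) * (- (z.2 - w.2) / sqdist w z) +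
    (z.2 - w.2) * ((z.1 - w.1) / sqdist w z) = 0.
  by move: h; rewrite /sqdist => h; field.
by rewrite /slice_pt /= scale0r addr0 scale1r.
Qed.

Lemma regular_mul_inv I w Om F Fx Fy : imag_unit I -> ~ Om w ->
  regular_with I Om F Fx Fy ->
  exists Gx Gy, regular_with I Om (fun z => slice_inv I w z * F z) Gx Gy.
Proof.
move=> hI nw rF.
pose S z := sqdist w z.
pose X z : R := z.1 - w.1.
pose Y z : R := z.2 - w.2.
have cX z : {for z, continuous X} by exact: cont_fstB.
have cY z : {for z, continuous Y} by exact: cont_sndB.
have cS z : {for z, continuous S} by exact: continuous_sqdist.
have S0 z : Om z -> S z != 0 by move=> Oz; apply: sqdist_neq0 => zw; apply: nw; rewrite -zw.
have cSV z : Om z -> {for z, continuous (fun t => (S t)^-1)}.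
  by move=> /S0 h; apply: contV.
have ca : plane_C1 (fun z => X z / S z) (fun z => (Y z ^+ 2 - X z ^+ 2) * (S z)^-1 ^+ 2)
    (fun z => - (2 * X z * Y z * (S z)^-1 ^+ 2)) Om.
  move=> z Oz; split.
  - by apply: contM => //; exact: cSV.
  - apply: contM; last by apply/contX/cSV.
    by apply: contB; apply: contX.
  - apply/contN/contM; last by apply/contX/cSV.
    by apply: contM => //; apply: contM => //; exact: contC.
  - have dS := drv_sqdist_x w z.
    apply: drvE (drvM (drvB (drvI _) (drvC w.1 _)) (@drvV _ (fun t => S (t, z.2)) z.1 _ _ dS)) _.
      by rewrite -surjective_pairing S0.
    rewrite -surjective_pairing; have := S0 z Oz; rewrite /S /sqdist /X /Y => h.
    by field.
  - have dS := drv_sqdist_y w z.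
    apply: drvE (drvM (drvC (z.1 - w.1) _) (@drvV _ (fun t => S (z.1, t)) z.2 _ _ dS)) _.
      by rewrite -surjective_pairing S0.
    rewrite -surjective_pairing; have := S0 z Oz; rewrite /S /sqdist /X /Y => h.
    by field.
have cb : plane_C1 (fun z => - Y z / S z) (fun z => 2 * X z * Y z * (S z)^-1 ^+ 2)
    (fun z => (Y z ^+ 2 - X z ^+ 2) * (S z)^-1 ^+ 2) Om.
  move=> z Oz; split.
  - by apply: contM; [exact: contN|exact: cSV].
  - apply: contM; last by apply/contX/cSV.
    by apply: contM => //; apply: contM => //; exact: contC.
  - apply: contM; last by apply/contX/cSV.
    by apply: contB; apply: contX.
  - have dS := drv_sqdist_x w z.
    apply: drvE (drvM (drvC (- (z.2 - w.2)) _) (@drvV _ (fun t => S (t, z.2)) z.1 _ _ dS)) _.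
      by rewrite -surjective_pairing S0.
    rewrite -surjective_pairing; have := S0 z Oz; rewrite /S /sqdist /X /Y => h.
    by field.
  - have dS := drv_sqdist_y w z.
    apply: drvE (drvM (drvN (drvB (drvI _) (drvC w.2 _))) (@drvV _ (fun t => S (z.1, t)) z.2 _ _ dS)) _.
      by rewrite -surjective_pairing S0.
    rewrite -surjective_pairing; have := S0 z Oz; rewrite /S /sqdist /X /Y => h.
    by field.
by eexists; eexists; apply: regular_mul hI ca cb _ _ rF.
Qed.

End HolomorphicFactors.

(** * Moments over annuli *)

Section Moments.
Variable R : realType.
Implicit Types (q p u I : quat R) (a b : R) (z w : R * R) (C Om : set (R * R)).
Implicit Types (F G Fx Fy : R * R -> quat R) (v V : R -> R).

Notation leb := (@lebesgue_measure R).

(** Cutoffs are functions of |z - w|^2; the profile v is a function of the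
    squared distance supported in [e, d], so that no square roots enter. *)
Definition supported v (e d : R) := forall t, t < e \/ d < t -> v t = 0.

Lemma supported_integrable v e d : continuous v -> supported v e d ->
  leb.-integrable setT (EFin \o v).
Proof.
move=> cv v0.
have -> : (EFin \o v) = (EFin \o v) \_ `[e, d].
  apply/funext => t; rewrite patchE; case: ifPn => //.
  rewrite notin_setE/= in_itv/= => /negP; rewrite negb_and -!ltNge => /orP h.
  by rewrite v0.
have mD : measurable (`[e, d]%classic : set (measurableTypeR R)) by exact: measurable_itv.
apply/(integrable_mkcond (EFin \o v : measurableTypeR R -> \bar R) mD).
apply: continuous_compact_integrable; first exact: segment_compact.
exact: continuous_subspaceT.
Qed.

Lemma primitive_exists v e d : continuous v -> supported v e d ->
  exists V, [/\ forall t : R, is_derive t (1:R) V (v t),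
    forall t, t < e -> V t = 0 & forall t, d < t -> V t = \int[leb]_t v t].
Proof.
move=> cv v0.
have intv := supported_integrable cv v0.
exists (fun s => \int[leb]_(t in `]-oo, s]) v t); split => t.
- have [| | | |dF dE] := @continuous_FTC1 R v -oo%O t (t + 1).
  + by lra.
  + by apply: integrableS intv => //; exact: measurable_itv.
  + by rewrite ltNyr.
  + exact: cv.
  exact: (DeriveDef dF (etrans (esym (derive1E _ _)) dE)).
- move=> te.
  apply: etrans (eq_Rintegral (g := fun=> 0) _ _) _; last by rewrite Rintegral_cst ?mul0r//; exact: measurable_itv.
  move=> s; rewrite inE/= in_itv/= => st; rewrite v0//; left; exact: le_lt_trans te.
- move=> dt; rewrite [LHS]Rintegral_mkcond; apply: eq_Rintegral => s _.
  rewrite patchE; case: ifPn => //; rewrite notin_setE/= in_itv/= => /negP.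
  by rewrite -ltNge => ts; rewrite v0//; right; exact: lt_trans ts.
Qed.

(** A profile of integral 0 is the derivative of a profile with the same
    support, hence yields an admissible cutoff for Stokes' formula. *)
Lemma antiderivative v e d : continuous v -> supported v e d ->
  \int[leb]_t v t = 0 ->
  exists2 V, (forall t : R, is_derive t (1:R) V (v t)) & supported V e d.
Proof.
move=> cv v0 iv; have [V [dV V0 V1]] := primitive_exists cv v0.
by exists V => // t [/V0//|/V1 ->].
Qed.

(** A continuous bump supported in [e, d]; the constant normalizes its
    integral to 1. *)
Definition hat (e d t : R) : R := 6 / (d - e) ^+ 3 * Num.max 0 ((t - e) * (d - t)).

Lemma hat_continuous e d : continuous (hat e d).
Proof.
move=> t; suff : {for t, continuous (fun t : R => 6 / (d - e) ^+ 3 * Num.max 0 ((t - e) * (d - t)))} by [].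
apply: contM; first exact: contC.
apply: (@continuous_max _ _ (fun=> 0) (fun t => (t - e) * (d - t))); first exact: contC.
by apply: contM; apply: contB; try exact: contC; exact: cvg_id.
Qed.

Lemma hat_ge0 e d t : e < d -> 0 <= hat e d t.
Proof.
move=> ed; rewrite /hat mulr_ge0 ?le_max ?lexx// divr_ge0// exprn_ge0//; lra.
Qed.

Lemma hat_supported e d : e < d -> supported (hat e d) e d.
Proof.
move=> ed t h; rewrite /hat max_l ?mulr0//.
by case: h => h; nra.
Qed.

Lemma hat_integral e d : e < d -> \int[leb]_t hat e d t = 1.
Proof.
move=> ed; pose c := 6 / (d - e) ^+ 3.
pose B t := c * ((t - e) ^+ 2 * (d - e) / 2 - (t - e) ^+ 3 / 3).
pose b t := c * ((t - e) * (d - t)).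
have -> : \int[leb]_t hat e d t = \int[leb]_(t in `[e, d]) b t.
  rewrite [RHS]Rintegral_mkcond; apply: eq_Rintegral => t _; rewrite patchE.
  case: ifPn => [|]; last first.
    rewrite notin_setE/= in_itv/= => /negP; rewrite negb_and -!ltNge => /orP h.
    by rewrite (hat_supported ed).
  rewrite inE/= in_itv/= => /andP[h1 h2]; rewrite /hat /b max_r//.
  by rewrite mulr_ge0//; lra.
have dB t : is_derive t (1:R) B (b t).
  have dt := drvB (drvI t) (drvC e t).
  have := drvM (drvC c t) (drvB (drvM (drvX 2 dt) (drvC ((d - e) / 2) t)) (drvM (drvX 3 dt) (drvC (3^-1) t))).
  have -> : (fun s : R => c * ((s - e) ^+ 2 * ((d - e) / 2) - (s - e) ^+ 3 / 3)) = B.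
    by apply/funext => s; rewrite /B mulrA.
  by move=> h; apply: drvE h _; rewrite /b /=; lra.
rewrite /Rintegral (@continuous_FTC2 _ b B)//.
- rewrite /B -EFinB /= /c; field.
  by rewrite subr_eq0 gt_eqF.
- apply: continuous_subspaceT => t.
  suff : {for t, continuous (fun t : R => c * ((t - e) * (d - t)))} by [].
  by apply: contM; first exact: contC; apply: contM; apply: contB; try exact: contC; exact: cvg_id.
- have cB (t : R) : {for t, continuous B} by exact: drv_continuous (dB t).
  split.
  + by move=> t _; have [] := dB t.
  + by apply: cvg_at_right_filter; exact: cB.
  + by apply: cvg_at_left_filter; exact: cB.
- by move=> t _; rewrite derive1E; have [_ ->] := dB t.
Qed.

Lemma annulus_bound w d z : sqdist w z <= d -> `|z| <= `|w| + (1 + `|d|).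
Proof.
move=> h; have wE := plane_box `|w| w; rewrite lexx in wE.
have /andP[w1 w2] := esym wE.
have dd := ler_norm d.
have aux (x y : R) : (x - y) ^+ 2 <= `|d| -> `|x| <= `|y| + (1 + `|d|).
  move=> xy; rewrite -[x](subrK y) addrC; apply: (le_trans (ler_normD _ _)).
  rewrite lerD2l; move: xy; rewrite -real_normK ?num_real// => xy.
  by have := normr_ge0 (x - y); nra.
rewrite plane_box; apply/andP; split.
  by apply: (le_trans (aux _ w.1 _)); [move: h; rewrite /sqdist; have := sqr_ge0 (z.2 - w.2); lra|rewrite lerD2r].
by apply: (le_trans (aux _ w.2 _)); [move: h; rewrite /sqdist; have := sqr_ge0 (z.1 - w.1); lra|rewrite lerD2r].
Qed.

Definition annulus w (e d : R) := [set z | e <= sqdist w z <= d].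

Lemma closed_annulus w e d : closed (annulus w e d).
Proof.
have -> : annulus w e d = sqdist w @^-1` [set` `[e, d]].
  by apply/seteqP; split => z; rewrite /annulus/= in_itv.
by apply: closed_comp; [move=> z _; exact: continuous_sqdist|exact: interval_closed].
Qed.

Lemma annulus_supported v e d w z : supported v e d -> ~ annulus w e d z ->
  v (sqdist w z) = 0.
Proof.
move=> v0 h; apply: v0; rewrite !ltNge.
by have [?|?] := leP e (sqdist w z); have [?|?] := leP (sqdist w z) d; auto; exfalso; apply: h; apply/andP.
Qed.

Lemma annulus_qcont v e d w Om F : continuous v -> supported v e d ->
  annulus w e d `<=` Om -> (forall z, Om z -> qcont F z) ->
  forall z, qcont (fun z => v (sqdist w z) *: F z) z.
Proof.
move=> cv v0 aO cF z u.
have -> : (fun t => qre (u * (v (sqdist w t) *: F t))) =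
    (fun t => v (sqdist w t) * qre (u * F t)).
  by apply/funext => t; rewrite -scalerAr qreZ.
apply: (cutoff_continuous (C := annulus w e d) (Om := Om)
  (k := fun t => v (sqdist w t)) (g := fun t => qre (u * F t))) => //.
- exact: closed_annulus.
- move=> t; suff : {for t, continuous (fun t => v (sqdist w t))} by [].
  by apply: cont_comp; [exact: continuous_sqdist|exact: cv].
- by move=> t; exact: annulus_supported.
- by move=> t /cF; apply.
Qed.

Lemma annulus_compact_support v e d w F z : supported v e d ->
  `|w| + (1 + `|d|) < `|z| -> v (sqdist w z) *: F z = 0.
Proof.
move=> v0 hz; rewrite v0 ?scale0r//; right; rewrite ltNge; apply/negP => /annulus_bound.
by rewrite leNgt hz.
Qed.

Lemma annulus_qintegrable v e d w Om F : continuous v -> supported v e d ->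
  annulus w e d `<=` Om -> (forall z, Om z -> qcont F z) ->
  qintegrable (fun z => v (sqdist w z) *: F z).
Proof.
move=> cv v0 aO cF; apply: (@qcont_compact_support R (`|w| + (1 + `|d|))).
  exact: annulus_qcont aO cF.
by move=> z hz; exact: (annulus_compact_support F v0 hz).
Qed.

Lemma qcont_slice_mul I (a b : R * R -> R) F z : {for z, continuous a} ->
  {for z, continuous b} -> qcont F z -> qcont (fun z => slice_pt I (a z, b z) * F z) z.
Proof.
move=> ca cb cF u.
have -> : (fun t => qre (u * (slice_pt I (a t, b t) * F t))) =
    (fun t => a t * qre (u * F t) + b t * qre (u * I * F t)).
  by apply/funext => t; rewrite slice_pt_mul.
by apply: contD; apply: contM; [exact: ca|exact: cF|exact: cb|exact: (cF (u * I))].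
Qed.

(** Stokes' formula for the cutoff V(|z - w|^2), whose gradient is 2 v(|z -
    w|^2) (z - w). *)
Lemma annulus_vanish I w Om F Fx Fy v V e d :
  regular_with I Om F Fx Fy -> continuous v ->
  (forall t : R, is_derive t (1:R) V (v t)) ->
  supported v e d -> supported V e d -> annulus w e d `<=` Om ->
  qint (fun z => v (sqdist w z) *: (slice_pt I (z - w) * F z)) = 0.
Proof.
move=> rF cv dV v0 V0 aO.
have := stokes (@closed_annulus w e d) aO (M := `|w| + (1 + `|d|)) _
  (C1_sqdist_comp w cv dV) _ rF.
case=> [z /andP[_ /annulus_bound//]|z nz|cG G0 iG].
  by rewrite !(annulus_supported _ nz)// !mul0r.
have iF := qcont_compact_support cG G0.
rewrite -[RHS](scaler0 _ (2^-1 : R)) -iG -qintZ//; apply: eq_qint => z.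
rewrite /slice_pt mulrDl qmul_algl -scalerAl !scalerDr !scalerA.
by congr (_ *: _ + _ *: _) => /=; field.
Qed.

(** Two profiles of equal integral differ by a derivative, to which
    [annulus_vanish] applies; so the left side is a linear function of the
    integral of v. This plays the part of the independence of a circle
    integral from the radius. *)
Lemma moment_exists I w Om F Fx Fy (rho : R) : 0 < rho ->
  regular_with I Om F Fx Fy ->
  (forall z, 0 < sqdist w z < rho -> Om z) ->
  exists t : quat R, forall v e d, 0 < e -> d < rho -> continuous v -> supported v e d ->
    qint (fun z => v (sqdist w z) *: (slice_pt I (z - w) * F z)) = (\int[leb]_t v t) *: t.
Proof.
move=> rho0 rF aO; pose b := hat (rho / 4) (rho / 2).
have h42 : rho / 4 < rho / 2 by lra.
exists (qint (fun z => b (sqdist w z) *: (slice_pt I (z - w) * F z))).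
move=> v e d e0 drho cv v0; set c := \int[leb]_t v t.
pose e' := Num.min e (rho / 4); pose d' := Num.max d (rho / 2).
have ann : annulus w e' d' `<=` Om.
  move=> z /andP[z1 z2]; apply: aO; apply/andP; split.
    by apply: lt_le_trans z1; rewrite /e' lt_min e0; lra.
  by apply: (le_lt_trans z2); rewrite /d' gt_max drho; lra.
have sv : supported v e' d'.
  move=> t h; apply: v0; move: h; rewrite /e' /d' lt_min gt_max.
  by move=> [/andP[]|/andP[]]; auto.
have sb : supported b e' d'.
  move=> t h; apply: hat_supported => //; move: h; rewrite /e' /d' lt_min gt_max.
  by move=> [/andP[]|/andP[]]; auto.
have cb : continuous b by exact: hat_continuous.
have cFz z : Om z -> qcont (fun z => slice_pt I (z - w) * F z) z.
  move=> Oz u; have [cF _ _ _ _] := rF z Oz.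
  suff : qcont (fun z => slice_pt I (z.1 - w.1, z.2 - w.2) * F z) z by apply.
  by apply: qcont_slice_mul => //; [exact: cont_fstB|exact: cont_sndB].
have cc : continuous (fun t => v t - c * b t).
  move=> t; suff : {for t, continuous (fun t => v t - c * b t)} by [].
  by apply: contB; [exact: cv|apply: contM; [exact: contC|exact: cb]].
have sc : supported (fun t => v t - c * b t) e' d'.
  by move=> t h; rewrite sv// sb// mulr0 subr0.
have iv := supported_integrable cv sv.
have ib := supported_integrable cb sb.
have ic : \int[leb]_t (v t - c * b t) = 0.
  have icb : leb.-integrable setT (EFin \o (fun t => c * b t)).
    exact: (integrableZl measurableT c ib).
  rewrite (RintegralB measurableT iv icb) (RintegralZl c measurableT ib).
  by rewrite hat_integral// mulr1 subrr.
have [V dV sV] := antiderivative cc sc ic.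
have := annulus_vanish rF cc dV sc sV ann.
have jv := annulus_qintegrable cv sv ann cFz.
have jb := annulus_qintegrable cb sb ann cFz.
rewrite -qintZ// => h.
apply/eqP; rewrite -subr_eq0 -qintB//; last exact: qintegrableZ.
by rewrite -[X in _ == X]h; apply/eqP; apply: eq_qint => z; rewrite scalerA scalerBl.
Qed.

End Moments.

(** * The mean value property *)

Section MeanValue.
Variable R : realType.
Implicit Types (q p u I : quat R) (a b : R) (z w : R * R) (C Om : set (R * R)).
Implicit Types (F G Fx Fy : R * R -> quat R) (v V : R -> R).

Notation leb := (@lebesgue_measure R).

Lemma integral_radial_supported v e d w : 0 < e -> continuous v ->
  supported v e d -> (forall t, 0 <= v t) ->
  \int[area R]_z v (sqdist w z) = pi * \int[leb]_t v t.
Proof.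
move=> e0 cv v0 vge0.
have mv : measurable_fun setT (fun t : measurableTypeR R => (v t)%:E).
  by apply/measurable_EFinP; exact: continuous_measurable_fun.
rewrite /Rintegral.
have -> := integral_radial w mv (fun s => _ : (0 <= (v s)%:E)%E).
  rewrite fineM//.
    congr (_ * fine _); rewrite [LHS]integral_mkcond; apply: eq_integral => t _.
    rewrite patchE; case: ifPn => //; rewrite notin_setE/= in_itv/= andbT => /negP.
    by rewrite -ltNge => t0; rewrite v0//; left; exact: lt_trans e0.
  apply: integrable_fin_num => //.
  by apply: integrableS (supported_integrable cv v0) => //; exact: measurable_itv.
by move=> s; rewrite lee_fin.
Qed.

Lemma regular_restrict I Om Om' F Fx Fy : Om' `<=` Om ->
  regular_with I Om F Fx Fy -> regular_with I Om' F Fx Fy.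
Proof. by move=> h rF z /h /rF. Qed.

Lemma sqdist_self w : sqdist w w = 0.
Proof. by rewrite /sqdist !subrr expr0n/= addr0. Qed.

(** By [moment_exists] for F(z) / (z - w), the average of F against v(|z -
    w|^2) is (\int v) t with t independent of v. Profiles concentrating at w,
    together with the radial integration formula, identify t as pi F(w). *)
Lemma mean_value I w Om F Fx Fy (rho : R) : imag_unit I -> 0 < rho ->
  regular_with I Om F Fx Fy ->
  (forall z, sqdist w z < rho -> Om z) ->
  forall v e d, 0 < e -> d < rho -> continuous v -> supported v e d ->
    qint (fun z => v (sqdist w z) *: F z) = (pi * \int[leb]_t v t) *: F w.
Proof.
move=> hI rho0 rF aO.
have rF' : regular_with I (Om `\ w) F Fx Fy.
  by apply: regular_restrict rF; exact: subDsetl.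
have nw : ~ (Om `\ w) w by case=> _; apply.
have [Gx [Gy rG]] := regular_mul_inv hI nw rF'.
have aO' z : 0 < sqdist w z < rho -> (Om `\ w) z.
  move=> /andP[z0 z1]; split; first exact: aO.
  by move=> /= zw; move: z0; rewrite zw sqdist_self ltxx.
have [t Ht] := moment_exists rho0 rG aO'.
have {}Ht v e d : 0 < e -> d < rho -> continuous v -> supported v e d ->
    qint (fun z => v (sqdist w z) *: F z) = (\int[leb]_t v t) *: t.
  move=> e0 dr cv v0; rewrite -(Ht v e d)//; apply: eq_qint => z.
  have [->|zw] := pselect (z = w).
    by rewrite sqdist_self v0 ?scale0r//; left.
  by rewrite mulrA slice_invK// mul1r.
suff tE : t = pi *: F w.
  by move=> v e d *; rewrite (Ht v e d)// tE scalerA mulrC.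
apply: qre_eqP => u; apply/eqP; rewrite -subr_eq0; apply/negP => /negP X0.
set X := _ - _ in X0; have pX : 0 < `|X| by rewrite normr_gt0.
have pi0 := pi_gt0 R.
have ep : 0 < `|X| / (2 * pi) by rewrite divr_gt0// mulr_gt0.
have Ow : Om w by apply: aO; rewrite sqdist_self.
have [cF _ _ _ _] := rF w Ow.
have /cvgrPdist_le/(_ _ ep)/nbhs_ballP[eta /= eta0 hball] := cF u.
(* F varies by at most |X| / (2 pi) on the disc |z - w|^2 <= d, so that the
   average of F over it differs from pi F(w) by at most |X| / 2. *)
pose d := Num.min (eta ^+ 2 / 2) (rho / 2).
have d0 : 0 < d by rewrite lt_min !divr_gt0// exprn_gt0.
have de : d < eta ^+ 2.
  by rewrite gt_min; apply/orP; left; rewrite ltr_pdivrMr// ltr_pMr ?exprn_gt0//; lra.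
have dr : d < rho by rewrite gt_min; apply/orP; right; lra.
pose v := hat (d / 2) d.
have hd : d / 2 < d by lra.
have cv : continuous v by exact: hat_continuous.
have sv : supported v (d / 2) d by exact: hat_supported.
have e0 : 0 < d / 2 by lra.
have iv : \int[leb]_t v t = 1 by exact: hat_integral.
have vge0 s : 0 <= v s by exact: hat_ge0.
have jF : qintegrable (fun z => v (sqdist w z) *: F z).
  apply: (annulus_qintegrable (Om := Om) cv sv) => [z /andP[_ zd]|z Oz].
    by apply: aO; exact: le_lt_trans dr.
  by have [] := rF z Oz.
have jc : qintegrable (fun z => v (sqdist w z) *: F w).
  apply: (annulus_qintegrable (Om := setT) (F := fun=> F w) cv sv) => // z _ u'.
  exact: contC.
have j1 : (area R).-integrable setT (fun z : plane R => (v (sqdist w z))%:E).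
  have := annulus_qintegrable (Om := setT) (F := fun=> 1) cv sv (w := w) _ _ 1.
  under [X in _ -> _ -> _.-integrable _ X]eq_fun do rewrite mul1r qreZ mulr1.
  by apply => // z _ u'; exact: contC.
have E1 : qre (u * t) = \int[area R]_z qre (u * (v (sqdist w z) *: F z)).
  by rewrite -qint_re// (Ht v (d / 2) d)// iv scale1r.
have E2 : qre (u * (pi *: F w)) = \int[area R]_z qre (u * (v (sqdist w z) *: F w)).
  have rad := integral_radial_supported w e0 cv sv vge0.
  rewrite iv mulr1 in rad.
  rewrite -scalerAr qreZ -rad -(RintegralZr _ measurableT j1).
  by apply: eq_Rintegral => z _; rewrite -scalerAr qreZ.
have XE : X = \int[area R]_z (v (sqdist w z) * (qre (u * F z) - qre (u * F w))).
  rewrite /X E1 E2 -(RintegralB measurableT (jF u) (jc u)).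
  by apply: eq_Rintegral => z _; rewrite -!scalerAr !qreZ [RHS]mulrBr.
have jX : (area R).-integrable setT (fun z : plane R =>
    (v (sqdist w z) * (qre (u * F z) - qre (u * F w)))%:E).
  have := plane_integrableB (jF u) (jc u).
  by under eq_fun do rewrite -!scalerAr !qreZ -mulrBr.
have j2 : (area R).-integrable setT (fun z : plane R => (v (sqdist w z) * (`|X| / (2 * pi)))%:E).
  exact: (integrableZr measurableT _ j1).
have : `|X| <= \int[area R]_z (v (sqdist w z) * (`|X| / (2 * pi))).
  rewrite {1}XE; apply: (le_trans (le_normr_Rintegral measurableT jX)).
  apply: le_Rintegral => //; first exact: (integrable_norm jX).
  move=> z _; rewrite normrM ger0_norm//.
  have [zd|zd] := leP (sqdist w z) d; last first.
    by rewrite sv ?mul0r//; right.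
  rewrite ler_wpM2l// distrC; apply: hball.
  rewrite -ball_normE /=.
  have aux (x y : R) : (x - y) ^+ 2 <= d -> `|y - x| < eta.
    move=> xy; rewrite distrC -(@ltr_pXn2r _ 2) ?nnegrE// ?ltW//.
    by rewrite real_normK ?num_real// (le_lt_trans xy).
  rewrite [`|_|]prod_normE gt_max /=; apply/andP; split; apply: aux; apply: le_trans zd.
    by rewrite /sqdist lerDl sqr_ge0.
  by rewrite /sqdist lerDr sqr_ge0.
rewrite (RintegralZr _ measurableT j1) (integral_radial_supported w e0 cv sv vge0) iv mulr1.
have -> : pi * (`|X| / (2 * pi)) = `|X| / 2.
  by move: (pi : R) (lt0r_neq0 pi0) => P P0; field.
by lra.
Qed.

End MeanValue.

(** * Cauchy's formula *)

Section CauchyFormula.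
Variable R : realType.
Implicit Types (q p u I : quat R) (a b : R) (z w : R * R) (C Om : set (R * R)).
Implicit Types (F G Fx Fy : R * R -> quat R) (v V : R -> R).

Notation leb := (@lebesgue_measure R).

(** The disc as a subset of the real plane, on which all slices are modelled. *)
Definition disc (r : R) : set (R * R) := [set z | sqdist 0 z < r ^+ 2].

Lemma C1_mul (k kx ky l lx ly : R * R -> R) Om :
  plane_C1 k kx ky Om -> plane_C1 l lx ly Om ->
  plane_C1 (fun z => k z * l z) (fun z => kx z * l z + k z * lx z)
    (fun z => ky z * l z + k z * ly z) Om.
Proof.
move=> ck cl z Oz; have [k1 k2 k3 k4 k5] := ck z Oz; have [l1 l2 l3 l4 l5] := cl z Oz.
split; [exact: contM|by apply: contD; apply: contM|by apply: contD; apply: contM| |].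
  by apply: drvE (drvM k4 l4) _; rewrite -surjective_pairing.
by apply: drvE (drvM k5 l5) _; rewrite -surjective_pairing.
Qed.

Lemma sqdist_ball w z (eta : R) : 0 < eta -> sqdist w z < eta ^+ 2 -> ball w eta z.
Proof.
move=> eta0 zd; rewrite -ball_normE /=.
have aux (x y : R) : (x - y) ^+ 2 < eta ^+ 2 -> `|y - x| < eta.
  move=> xy; rewrite distrC -(@ltr_pXn2r _ 2) ?nnegrE// ?ltW//.
  by rewrite real_normK ?num_real.
rewrite [`|_|]prod_normE gt_max /=; apply/andP; split; apply: aux; apply: le_lt_trans zd.
  by rewrite /sqdist lerDl sqr_ge0.
by rewrite /sqdist lerDr sqr_ge0.
Qed.

Lemma sqdist_near w (s : R) : sqdist 0 w < s ->
  exists2 rho, 0 < rho & forall z, sqdist w z < rho -> sqdist 0 z < s.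
Proof.
move=> ws.
have : \forall z \near w, sqdist 0 z < s.
  have : nbhs (sqdist 0 w) [set t : R | t < s] by exact: lt_nbhsl.
  exact: continuous_sqdist.
move=> /nbhs_ballP[eta /= eta0 h]; exists (eta ^+ 2); first exact: exprn_gt0.
by move=> z hz; apply: h; exact: sqdist_ball.
Qed.

(** Stokes' formula for F(z) / (z - w) and the cutoff (1 - B(|z|^2)) K(|z -
    w|^2), where B rises from 0 to 1 between rho1 and rho2, and K rises near w
    and so removes the pole. The gradient of K contributes an average of F
    around w, equal to pi F(w) by the mean value property; that of B
    contributes the integral on the left. *)
Lemma cauchy_formula I (r : R) F Fx Fy w (rho1 rho2 : R) : imag_unit I ->
  regular_with I (disc r) F Fx Fy ->
  sqdist 0 w < rho1 -> rho1 < rho2 -> rho2 < r ^+ 2 ->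
  qint (fun z => hat rho1 rho2 (sqdist 0 z) *:
    (slice_pt I z * (slice_inv I w z * F z))) = pi *: F w.
Proof.
move=> hI rF wr r12 r2r.
pose b0 := hat rho1 rho2.
have cb0 : continuous b0 by exact: hat_continuous.
have sb0 : supported b0 rho1 rho2 by exact: hat_supported.
have [B [dB B0 B1]] := primitive_exists cb0 sb0.
rewrite hat_integral// in B1.
have [rho rho0 rsub] := sqdist_near wr.
have rsub' z : sqdist w z < rho -> disc r z.
  by move=> /rsub h; rewrite /disc/=; lra.
pose d := rho / 2.
have d0 : 0 < d by rewrite /d; lra.
have dr : d < rho by rewrite /d; lra.
have dsub z : sqdist w z <= d -> sqdist 0 z < rho1.
  by move=> h; apply: rsub; exact: le_lt_trans dr.
have hd : d / 2 < d by lra.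
pose b1 := hat (d / 2) d.
have cb1 : continuous b1 by exact: hat_continuous.
have sb1 : supported b1 (d / 2) d by exact: hat_supported.
have [K [dK K0 K1]] := primitive_exists cb1 sb1.
rewrite hat_integral// in K1.
have rF' : regular_with I (disc r `\ w) F Fx Fy.
  by apply: regular_restrict rF; exact: subDsetl.
have nw : ~ (disc r `\ w) w by case=> _; apply.
have [Gx [Gy rG]] := regular_mul_inv hI nw rF'.
have dH (t : R) : is_derive t (1:R) (fun t => 1 - B t) (- b0 t).
  by apply: drvE (drvB (drvC 1 t) (dB t)) _; rewrite sub0r.
have cnb0 : continuous (fun t => - b0 t) by move=> t; exact: contN (cb0 t).
have C1 := C1_mul (C1_sqdist_comp 0 cnb0 dH) (C1_sqdist_comp w cb1 dK).
(* The cutoff vanishes off C: beyond rho2 because B = 1, near w because K = 0. *)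
pose C := [set z | sqdist 0 z <= rho2] `&` [set z | d / 2 <= sqdist w z].
have cC : closed C.
  apply: closedI.
    apply: (@closed_comp _ _ (sqdist 0) [set t | t <= rho2]).
      by move=> z _; exact: continuous_sqdist.
    exact: closed_le.
  apply: (@closed_comp _ _ (sqdist w) [set t | d / 2 <= t]).
    by move=> z _; exact: continuous_sqdist.
  exact: closed_ge.
have CO : C `<=` disc r `\ w.
  move=> z [/= z1 z2]; split; first by rewrite /disc/=; exact: le_lt_trans r2r.
  by move=> /= zw; move: z2; rewrite zw sqdist_self; lra.
have CM z : C z -> `|z| <= `|0 : R * R| + (1 + `|rho2|).
  by move=> [/= /annulus_bound].
have [] := stokes cC CO CM C1 _ rG.
  move=> z nC.
  have [z1|z1] := leP (sqdist 0 z) rho2; last first.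
    by rewrite B1// sb0 ?subrr ?oppr0 ?mul0r ?addr0//; right.
  have [z2|z2] := leP (d / 2) (sqdist w z); first by exfalso; apply: nC.
  by rewrite K0// sb1 ?mul0r ?mulr0 ?addr0//; left.
set G := (X in qint X) => cG G0 iG.
have jG := qcont_compact_support cG G0.
pose G1 z := b0 (sqdist 0 z) *: (slice_pt I z * (slice_inv I w z * F z)).
pose G2 z := b1 (sqdist w z) *: F z.
have GE z : G z = 2 *: (G2 z - G1 z).
  rewrite /G /G1 /G2; set H := slice_inv I w z * F z.
  have [zd|zd] := leP (sqdist w z) d.
    have zr := dsub z zd; rewrite sb0; last by left.
    rewrite B0// oppr0 !mul0r !add0r !addr0 !mul1r scale0r subr0.
    have [->|zw] := pselect (z = w).
      by rewrite sqdist_self sb1 ?mul0r ?scale0r ?addr0 ?scaler0//; left; lra.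
    have -> : F z = slice_pt I (z - w) * H by rewrite /H mulrA slice_invK// mul1r.
    rewrite slice_pt_mull !scalerDr !scalerA.
    by congr (_ *: _ + _ *: _) => /=; ring.
  rewrite K1// sb1; last by right.
  rewrite !mul0r !mulr0 !addr0 !mulr1 scale0r sub0r.
  rewrite slice_pt_mull -(scaleNr (b0 (sqdist 0 z))) scalerA scalerDr !scalerA.
  by congr (_ *: _ + _ *: _); rewrite (_ : (0 : R * R) = (0, 0))//=; ring.
have j2 : qintegrable G2.
  apply: (annulus_qintegrable (Om := disc r) cb1 sb1) => z.
    by move=> /andP[_ /dsub h]; rewrite /disc/=; lra.
  by move=> /rF[].
have j1 : qintegrable G1.
  have -> : G1 = (fun z => G2 z - 2^-1 *: G z).
    apply/funext => z; rewrite GE scalerA mulVf ?pnatr_eq0// scale1r.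
    by rewrite opprB addrC subrK.
  by have := qintegrableD j2 (qintegrableZ (- 2^-1) jG); under eq_fun do rewrite scaleNr.
have : qint (fun z => 2 *: (G2 z - G1 z)) = 0.
  by rewrite -iG; apply: eq_qint => z; rewrite GE.
have j21 : qintegrable (fun z => G2 z - G1 z).
  by have := qintegrableD j2 (qintegrableZ (-1) j1); under eq_fun do rewrite scaleN1r.
rewrite qintZ// => /eqP; rewrite scaler_eq0 pnatr_eq0 /= qintB// subr_eq0 => /eqP <-.
have e0 : 0 < d / 2 by lra.
by rewrite /G2 (mean_value hI rho0 rF rsub' e0 dr cb1 sb1) hat_integral// mulr1.
Qed.

End CauchyFormula.

(** * Taylor expansion on a slice *)

Section TaylorSeries.
Variable R : realType.
Implicit Types (q p u I : quat R) (a b : R) (z w : R * R) (C Om : set (R * R)).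
Implicit Types (F G Fx Fy : R * R -> quat R) (v V : R -> R).

Notation leb := (@lebesgue_measure R).

Lemma qcont_bounded (M : R) F : (forall z, qcont F z) ->
  (forall z, M < `|z| -> F z = 0) -> exists2 B, 0 <= B & forall z, `|F z| <= B.
Proof.
move=> cF F0.
have bd u : exists2 B, 0 <= B & forall z, `|qre (u * F z)| <= B.
  apply: (@compact_support_bounded R M (fun z => qre (u * F z))).
    by move=> z; exact: cF.
  by move=> z /F0 ->; rewrite mulr0.
have [B0 B00 h0] := bd 1; have [B1 B10 h1] := bd (Quat 0 (-1) 0 0).
have [B2 B20 h2] := bd (Quat 0 0 (-1) 0); have [B3 B30 h3] := bd (Quat 0 0 0 (-1)).
exists (B0 + B1 + B2 + B3); first by rewrite !addr_ge0.
move=> z; apply: (le_trans (qnorm_le_sum _)).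
have E0 : qre (F z) = qre (1 * F z) by rewrite mul1r.
have E1 : qi (F z) = qre (Quat 0 (-1) 0 0 * F z) by rewrite /=; ring.
have E2 : qj (F z) = qre (Quat 0 0 (-1) 0 * F z) by rewrite /=; ring.
have E3 : qk (F z) = qre (Quat 0 0 0 (-1) * F z) by rewrite /=; ring.
by rewrite E0 E1 E2 E3 !lerD.
Qed.

Lemma regular_iter_inv I (r : R) F Fx Fy : imag_unit I ->
  regular_with I (disc r) F Fx Fy -> forall n, exists Gx Gy,
  regular_with I (disc r `\ 0) (fun z => slice_inv I 0 z ^+ n * F z) Gx Gy.
Proof.
move=> hI rF n.
have nw : ~ (disc r `\ (0 : R * R)) 0 by case=> _; apply.
elim: n => [|n [Gx [Gy rG]]].
  exists Fx, Fy.
  have -> : (fun z => slice_inv I 0 z ^+ 0 * F z) = F.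
    by apply/funext => z; rewrite expr0 mul1r.
  by apply: regular_restrict rF; exact: subDsetl.
have -> : (fun z => slice_inv I 0 z ^+ n.+1 * F z) =
    (fun z => slice_inv I 0 z * (slice_inv I 0 z ^+ n * F z)).
  by apply/funext => z; rewrite exprS mulrA.
exact: regular_mul_inv nw rG.
Qed.

Lemma slice_inv_norm I z w : imag_unit I -> z <> w ->
  `|slice_inv I w z| ^+ 2 = (sqdist w z)^-1.
Proof.
move=> hI /sqdist_neq0 h; rewrite /slice_inv slice_pt_norm//=.
by move: h; rewrite /sqdist => h; field.
Qed.

(** Used with A = z / (z - w) and x = w / z, the expansion of the Cauchy
    kernel with its remainder. *)
Lemma geometric_sum_inv (A x : quat R) N : A = 1 + x * A ->
  A = \sum_(i < N) x ^+ i + x ^+ N * A.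
Proof.
move=> hA; elim: N => [|N IHN]; first by rewrite big_ord0 add0r expr0 mul1r.
rewrite big_ord_recr /= exprSr -mulrA -addrA.
suff -> : x ^+ N + x ^+ N * (x * A) = x ^+ N * A by [].
by rewrite [in RHS]hA mulrDr mulr1.
Qed.

(** In [cauchy_formula] the kernel z / (z - w) is expanded in powers of w / z.
    On the support of the bump |w / z| <= theta < 1, so that the remainder
    tends to 0 geometrically; the coefficients are the annular averages of
    z^(-n) F(z), which exist by [moment_exists]. The factor pi is the area
    normalization of these averages. *)
Lemma taylor_expansion I (r : R) F Fx Fy : imag_unit I -> 0 < r ->
  regular_with I (disc r) F Fx Fy ->
  exists t : nat -> quat R,
  (forall n v e d, 0 < e -> d < r ^+ 2 -> continuous v -> supported v e d ->
    qint (fun z => v (sqdist 0 z) *: (slice_inv I 0 z ^+ n * F z)) =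
      (\int[leb]_t v t) *: t n) /\
  (forall w, disc r w ->
    (fun N => \sum_(i < N) slice_pt I w ^+ i * t i) @ \oo --> (pi : R) *: F w).
Proof.
move=> hI r0 rF.
have r20 : 0 < r ^+ 2 by exact: exprn_gt0.
have inv0 z : z <> 0 -> slice_pt I z * slice_inv I 0 z = 1.
  by move=> z0; have /= := slice_invK hI z0; rewrite subr0.
have mom n : exists tn : quat R, forall v e d, 0 < e -> d < r ^+ 2 ->
    continuous v -> supported v e d ->
    qint (fun z => v (sqdist 0 z) *: (slice_inv I 0 z ^+ n * F z)) = (\int[leb]_t v t) *: tn.
  have [Gx [Gy rG]] := regular_iter_inv hI rF n.+1.
  have ann z : 0 < sqdist 0 z < r ^+ 2 -> (disc r `\ 0) z.
    move=> /andP[z0 z1]; split; first exact: z1.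
    by move=> /= zw; move: z0; rewrite zw sqdist_self ltxx.
  have [tn H] := moment_exists r20 rG ann.
  exists tn => v e d e0 dr cv v0; rewrite -(H v e d)//; apply: eq_qint => z.
  have [->|z0] := pselect (z = 0).
    by rewrite sqdist_self v0 ?scale0r//; left.
  by rewrite subr0 exprS !mulrA inv0// mul1r.
have [t Ht] := choice mom.
exists t; split=> // w ww.
(* Two radii between |w|^2 = s and r^2: the bump lives between them. *)
pose s := sqdist 0 w; pose rho1 := (2 * s + r ^+ 2) / 3; pose rho2 := (s + 2 * r ^+ 2) / 3.
have sr : s < r ^+ 2 by [].
have s0 : 0 <= s by exact: sqdist_ge0.
have sr1 : s < rho1 by rewrite /rho1; lra.
have r12 : rho1 < rho2 by rewrite /rho1 /rho2; lra.
have r2r : rho2 < r ^+ 2 by rewrite /rho2; lra.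
have rho10 : 0 < rho1 by lra.
have CF := cauchy_formula hI rF sr1 r12 r2r.
pose b := hat rho1 rho2.
have cb : continuous b by exact: hat_continuous.
have sb : supported b rho1 rho2 by exact: hat_supported.
have ib : \int[leb]_t b t = 1 by exact: hat_integral.
pose Q z := b (sqdist 0 z) *: (slice_pt I z * (slice_inv I w z * F z)).
pose P i z := b (sqdist 0 z) *: (slice_inv I 0 z ^+ i * F z).
have annw : annulus 0 rho1 rho2 `<=` disc r `\ w.
  move=> z /andP[z1 z2]; split; first by rewrite /disc/=; lra.
  by move=> /= zw; move: z1; rewrite zw -/s; lra.
have ann0 : annulus 0 rho1 rho2 `<=` disc r `\ 0.
  move=> z /andP[z1 z2]; split; first by rewrite /disc/=; lra.
  by move=> /= zw; move: z1; rewrite zw sqdist_self; lra.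
have cQ z : qcont Q z.
  apply: (annulus_qcont (Om := disc r `\ w) cb sb annw) => {}z Oz.
  have nw : ~ (disc r `\ w) w by case=> _; apply.
  have rF' : regular_with I (disc r `\ w) F Fx Fy.
    by apply: regular_restrict rF; exact: subDsetl.
  have [Gx [Gy rG]] := regular_mul_inv hI nw rF'.
  have [cG _ _ _ _] := rG z Oz.
  have -> : (fun z => slice_pt I z * (slice_inv I w z * F z)) =
      (fun z => slice_pt I (z.1, z.2) * (slice_inv I w z * F z)).
    by apply/funext => -[].
  apply: (@qcont_slice_mul R I (fun z => z.1) (fun z => z.2)
    (fun z => slice_inv I w z * F z)); [exact: cvg_fst|exact: cvg_snd|exact: cG].
pose M := `|0 : R * R| + (1 + `|rho2|).
have M0 : 0 <= M by rewrite !addr_ge0.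
have Q0 z : M < `|z| -> Q z = 0 by move=> Mz; exact: (annulus_compact_support (fun z => slice_pt I z * (slice_inv I w z * F z)) sb Mz).
have jQ := qcont_compact_support cQ Q0.
have jP i : qintegrable (P i).
  have [Gx [Gy rG]] := regular_iter_inv hI rF i.
  by apply: (annulus_qintegrable (Om := disc r `\ 0) cb sb ann0) => z /rG[].
have [B B0 QB] := qcont_bounded cQ Q0.
pose theta := Num.sqrt (s / rho1).
have th0 : 0 <= theta by exact: sqrtr_ge0.
have th1 : theta < 1.
  by rewrite -sqrtr1 ltr_sqrt// ltr_pdivrMr// mul1r.
pose x z := slice_pt I w * slice_inv I 0 z.
have xN z N : annulus 0 rho1 rho2 z -> `|x z ^+ N| <= theta ^+ N.
  move=> /[dup] zann /ann0[_ /= z0]; move: zann => /andP[z1 z2].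
  have h2 : `|x z| ^+ 2 <= theta ^+ 2.
    rewrite /theta (sqr_sqrtr (divr_ge0 s0 (ltW rho10))).
    rewrite (_ : `|x z| = `|slice_pt I w| * `|slice_inv I 0 z|) ?exprMn; last exact: quat_normM.
    rewrite slice_inv_norm// slice_pt_norm//.
    have -> : w.1 ^+ 2 + w.2 ^+ 2 = s by rewrite /s /sqdist /= !subr0.
    by rewrite ler_wpM2l// lef_pV2 ?posrE//; lra.
  rewrite quat_normX lerXn2r ?nnegrE//.
  by rewrite -(@ler_pXn2r _ 2) ?nnegrE.
(* The remainder of the geometric expansion of z / (z - w). *)
have QE N z : Q z - \sum_(i < N) slice_pt I w ^+ i * P i z = x z ^+ N * Q z.
  have [nz|/annulus_supported h] := pselect (annulus 0 rho1 rho2 z); last first.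
    rewrite /Q (h _ sb) scale0r mulr0 big1 ?subr0// => i _.
    by rewrite /P (h _ sb) scale0r mulr0.
  have [_ /= zw] := annw _ nz; have [_ /= z0] := ann0 _ nz.
  set A := slice_pt I z * slice_inv I w z.
  have AE : A = 1 + x z * A.
    rewrite /A /x mulrA -(mulrA (slice_pt I w)).
    rewrite (slice_ptC _ z hI) inv0// mulr1.
    have zE : slice_pt I z = slice_pt I (z - w) + slice_pt I w by rewrite slice_ptB subrK.
    by rewrite {1}zE mulrDl slice_invK.
  have QA : Q z = b (sqdist 0 z) *: (A * F z) by rewrite /Q mulrA.
  apply/eqP; rewrite subr_eq addrC; apply/eqP.
  rewrite QA {1}(geometric_sum_inv N AE) mulrDl scalerDr -scalerAr -mulrA; congr (_ + _).
  rewrite mulr_suml scaler_sumr; apply: eq_bigr => i _.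
  rewrite /P -scalerAr mulrA; congr (_ *: (_ * _)).
  by rewrite /x exprMn_comm// /GRing.comm slice_ptC.
have main N : `|pi *: F w - \sum_(i < N) slice_pt I w ^+ i * t i| <=
    theta ^+ N * (B * (M *+ 2) ^+ 2).
  have jS i : qintegrable (fun z => slice_pt I w ^+ i * P i z) by exact: qintegrableMl.
  have [jsum isum] := qint_sum N jS.
  have -> : pi *: F w - \sum_(i < N) slice_pt I w ^+ i * t i =
      qint (fun z => Q z - \sum_(i < N) slice_pt I w ^+ i * P i z).
    rewrite qintB// isum CF; congr (_ - _); apply: eq_bigr => i _.
    by rewrite qintMl// (Ht i b rho1 rho2)// ib scale1r.
  rewrite mulrA; apply: qint_norm_le => //.
  - by rewrite mulr_ge0// exprn_ge0.
  - by have := qintegrableD jQ (qintegrableZ (-1) jsum); under eq_fun do rewrite scaleN1r.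
  - by move=> z /Q0 h; rewrite QE h mulr0.
  - move=> z; rewrite QE.
    have [nz|/annulus_supported h] := pselect (annulus 0 rho1 rho2 z).
      by rewrite quat_normM ler_pM// xN.
    by rewrite /Q (h _ sb) scale0r mulr0 normr0 mulr_ge0// exprn_ge0.
have cth : theta ^+ N * (B * (M *+ 2) ^+ 2) @[N --> \oo] --> (0 : R).
  rewrite -[X in _ --> X](mul0r (B * (M *+ 2) ^+ 2)); apply: cvgM; last exact: cvg_cst.
  by apply: cvg_expr; rewrite ger0_norm.
apply/cvgrPdist_le => eps eps0.
have /cvgrPdist_le/(_ _ eps0) := cth.
apply: filterS => N /=; rewrite sub0r normrN => h.
by apply: (le_trans (main N)); apply: le_trans h; exact: ler_norm.
Qed.

End TaylorSeries.

(** * Moments of the Bergman weight *)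

Section Weight.
Variable R : realType.
Variables (r alpha : R).
Hypothesis r_gt0 : 0 < r.
Hypothesis alpha_gt0 : 0 < alpha.
Implicit Types (s t : R) (n k : nat).

Notation leb := (@lebesgue_measure R).

(** The Bergman weight as a function of s = |z|^2. *)
Definition radial_weight s : R :=
  alpha / (pi * r ^+ 2) * (1 - s / r ^+ 2) `^ (alpha - 1).

Let r2_gt0 : 0 < r ^+ 2. Proof. exact: exprn_gt0. Qed.

Lemma radial_weight_ge0 s : 0 <= radial_weight s.
Proof.
by rewrite /radial_weight mulr_ge0 ?powR_ge0// ltW// divr_gt0// mulr_gt0// pi_gt0.
Qed.

Lemma one_sub_gt0 s : s < r ^+ 2 -> 0 < 1 - s / r ^+ 2.
Proof. by move=> h; rewrite subr_gt0 ltr_pdivrMr// mul1r. Qed.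

Lemma drv_one_sub s : is_derive s (1:R) (fun t => 1 - t / r ^+ 2) (- (r ^+ 2)^-1).
Proof.
by apply: drvE (drvB (drvC 1 s) (drvM (drvI s) (drvC (r ^+ 2)^-1 s))) _; ring.
Qed.

Lemma radial_weight_continuous s : s < r ^+ 2 -> {for s, continuous radial_weight}.
Proof.
move=> sr; suff : {for s, continuous (fun t => alpha / (pi * r ^+ 2) * (1 - t / r ^+ 2) `^ (alpha - 1))} by [].
apply: contM; first exact: contC.
have c1 := drv_continuous (drv_one_sub s).
have c2 := drv_continuous (is_derive1_powR (alpha - 1) (one_sub_gt0 sr)).
exact: (cont_comp c1 c2).
Qed.

(** The recursion comes from integrating s^(n+1) (1 - s / r^2)^(alpha - 1) by
    parts and solving for the integral; the primitive is normalized to vanish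
    at s = r^2. *)
Fixpoint weight_primitive n s : R :=
  if n is m.+1 then
    r ^+ 2 / (m.+1%:R + alpha) * (m.+1%:R * weight_primitive m s -
      alpha / (pi * r ^+ 2) * (s ^+ m.+1 * (1 - s / r ^+ 2) `^ alpha))
  else - pi^-1 * (1 - s / r ^+ 2) `^ alpha.

Lemma drv_powR_one_sub s : s < r ^+ 2 ->
  is_derive s (1:R) (fun t => (1 - t / r ^+ 2) `^ alpha)
    (- (alpha / r ^+ 2) * (1 - s / r ^+ 2) `^ (alpha - 1)).
Proof.
move=> sr.
apply: drvE (drv_comp (drv_one_sub s) (is_derive1_powR alpha (one_sub_gt0 sr))) _.
by ring.
Qed.

Lemma weight_primitive_drv n s : s < r ^+ 2 ->
  is_derive s (1:R) (weight_primitive n) (s ^+ n * radial_weight s).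
Proof.
move=> sr; have pi0 := lt0r_neq0 (pi_gt0 R); have r20 := lt0r_neq0 r2_gt0.
elim: n => [|n IHn].
  apply: drvE (drvM (drvC (- pi^-1) s) (drv_powR_one_sub sr)) _.
  rewrite /radial_weight expr0 mul1r mul0r add0r.
  by move: (pi : R) pi0 => P P0; move: (_ `^ _) => X; field; rewrite P0 (lt0r_neq0 r_gt0).
apply: drvE (drvM (drvC (r ^+ 2 / (n.+1%:R + alpha)) s) (drvB (drvM (drvC n.+1%:R s) IHn)
  (drvM (drvC (alpha / (pi * r ^+ 2)) s) (drvM (drvX n.+1 (drvI s)) (drv_powR_one_sub sr))))) _.
have n0 : n.+1%:R + alpha != 0 by rewrite lt0r_neq0// ltr_wpDl.
rewrite /radial_weight -(mulr_powRB1 (ltW (one_sub_gt0 sr)) alpha_gt0).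
move: (pi : R) pi0 => P P0; move: (_ `^ _) => X; move: (n.+1%:R : R) n0 => N N0.
by rewrite !exprS /=; field; rewrite P0 N0 (lt0r_neq0 r_gt0).
Qed.

Lemma weight_primitive0 n :
  weight_primitive n 0 = - (pi^-1 * (r ^+ (2 * n) * n`!%:R / pochhammer (alpha + 1) n)).
Proof.
elim: n => [|n IHn].
  by rewrite /= mul0r subr0 powR1 mulr1 /pochhammer big_ord0 muln0 expr0 fact0 divr1 !mulr1.
rewrite /= IHn mul0r subr0 powR1 /pochhammer big_ord_recr /= -/(pochhammer _ _).
rewrite expr0n /= mul0r mulr0 subr0 factS natrM mulnS exprD.
have n0 : n.+1%:R + alpha != 0 by rewrite lt0r_neq0// ltr_wpDl.
have E : alpha + 1 + n%:R = n.+1%:R + alpha by rewrite -natr1; ring.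
rewrite E invfM.
by ring.
Qed.

Let cutpoint k : R := r ^+ 2 * (1 - k.+2%:R^-1).

(** A beta integral. For alpha < 1 the weight blows up at s = r^2, so the
    fundamental theorem is applied on [0, cutpoint k] and monotone convergence
    concludes. *)
Lemma weight_moment n :
  (\int[leb]_(s in `[0%R, (r ^+ 2)%R[) (s ^+ n * radial_weight s)%:E =
   (pi^-1 * (r ^+ (2 * n) * n`!%:R / pochhammer (alpha + 1) n))%:E)%E.
Proof.
have inv0 k : 0 < k.+2%:R^-1 :> R by rewrite invr_gt0.
have inv1 k : k.+2%:R^-1 < 1 :> R by rewrite invf_lt1// ltr1n.
have cut0 k : 0 < cutpoint k by rewrite mulr_gt0// subr_gt0.
have cutr k : cutpoint k < r ^+ 2.
  by rewrite /cutpoint mulrBr mulr1 ltrBlDr ltrDl mulr_gt0.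
have cutE k : 1 - cutpoint k / r ^+ 2 = k.+2%:R^-1.
  by rewrite /cutpoint mulrC mulKf ?lt0r_neq0// opprB addrC subrK.
pose f s := s ^+ n * radial_weight s.
have cf s : s < r ^+ 2 -> {for s, continuous f}.
  move=> sr; apply: contM; last exact: radial_weight_continuous.
  by apply: contX; exact: cvg_id.
have ftc k : (\int[leb]_(s in `[0%R, cutpoint k]) (f s)%:E =
    (weight_primitive n (cutpoint k) - weight_primitive n 0)%:E)%E.
  have cP s : s < r ^+ 2 -> {for s, continuous (weight_primitive n)}.
    by move=> /(weight_primitive_drv n) /drv_continuous.
  rewrite (@continuous_FTC2 _ f (weight_primitive n))// ?EFinB//.
  - apply: continuous_in_subspaceT => s; rewrite inE/= in_itv/= => /andP[_ s1].
    by apply: cf; exact: le_lt_trans (cutr k).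
  - split.
    + move=> s; rewrite in_itv/= => /andP[_ s1].
      by have [] := weight_primitive_drv n (lt_trans s1 (cutr k)).
    + by apply: cvg_at_right_filter; exact: cP.
    + by apply: cvg_at_left_filter; exact: cP.
  - move=> s; rewrite in_itv/= => /andP[_ s1]; rewrite derive1E.
    by have [_ ->] := weight_primitive_drv n (lt_trans s1 (cutr k)).
have cinv : (fun k => k.+2%:R^-1 : R) @ \oo --> (0 : R).
  by have := @cvg_harmonic R; rewrite -cvg_shiftS.
have ccut : cutpoint k @[k --> \oo] --> r ^+ 2.
  have : cutpoint k @[k --> \oo] --> r ^+ 2 * (1 - 0).
    by apply: cvgM; [exact: cvg_cst|apply: cvgB; [exact: cvg_cst|exact: cinv]].
  by rewrite subr0 mulr1.
have cpow : (1 - cutpoint k / r ^+ 2) `^ alpha @[k --> \oo] --> (0 : R).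
  under eq_fun do rewrite cutE.
  have /cvg_at_rightP := powR_cvg0 alpha_gt0.
  by apply.
have cprim m : weight_primitive m (cutpoint k) @[k --> \oo] --> (0 : R).
  elim: m => [|m IHm].
    have : weight_primitive 0 (cutpoint k) @[k --> \oo] --> - pi^-1 * (0 : R).
      by apply: cvgM; [exact: cvg_cst|exact: cpow].
    by rewrite mulr0.
  have : weight_primitive m.+1 (cutpoint k) @[k --> \oo] -->
      r ^+ 2 / (m.+1%:R + alpha) * (m.+1%:R * 0 - alpha / (pi * r ^+ 2) * ((r ^+ 2) ^+ m.+1 * (0 : R))).
    apply: cvgM; first exact: cvg_cst.
    apply: cvgB; apply: cvgM; try exact: cvg_cst; first exact: IHm.
    apply: cvgM; last exact: cpow.
    exact: (cvg_comp _ _ ccut (@exprn_continuous R m.+1 (r ^+ 2))).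
  by rewrite !mulr0 subrr mulr0.
pose F k := [set` `[0, cutpoint k]] : set (measurableTypeR R).
have fge0 k s : F k s -> (0 <= (f s)%:E)%E.
  rewrite /F/= in_itv/= => /andP[s0 _].
  by rewrite lee_fin mulr_ge0 ?exprn_ge0// radial_weight_ge0.
have mF k : measurable (F k) by exact: measurable_itv.
have ndF : {homo F : m k / (m <= k)%N >-> (m <= k)%O}.
  move=> m k mk; apply/subsetPset => s; rewrite /F/= !in_itv/= => /andP[-> h]/=.
  apply: (le_trans h); rewrite /cutpoint ler_pM2l// lerB// lef_pV2 ?posrE//.
  by rewrite ler_nat.
have mf k : measurable_fun (F k) (fun s => (f s)%:E).
  have cfF : {within `[0, cutpoint k], continuous f}.
    apply: continuous_in_subspaceT => s; rewrite inE/= in_itv/= => /andP[_ s1].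
    by apply: cf; exact: le_lt_trans (cutr k).
  by apply/measurable_EFinP; exact: subspace_continuous_measurable_fun cfF.
have := ge0_nondecreasing_set_cvg_integral (mu := leb) ndF mF mf fge0.
have -> : \bigcup_k F k = [set` `[0, r ^+ 2[ ].
  apply/seteqP; split => s.
    move=> [k _]; rewrite /F/= !in_itv/= => /andP[-> h]/=.
    exact: le_lt_trans (cutr k).
  rewrite /= in_itv/= => /andP[s0 sr].
  have /cvgrPdist_lt/(_ _ (one_sub_gt0 sr)) [k _ /(_ k (leqnn k))] := cinv.
  rewrite /= sub0r normrN gtr0_norm// => h.
  exists k => //; rewrite /F/= in_itv/= s0/= /cutpoint mulrC -ler_pdivrMr//.
  by rewrite lerBrDr -lerBrDl ltW.
under eq_fun do rewrite ftc.
move=> lim1.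
have lim2 : ((weight_primitive n (cutpoint k) - weight_primitive n 0)%:E @[k --> \oo] -->
    (0 - weight_primitive n 0)%:E)%E.
  apply/cvg_EFin; first by near=> k.
  by apply: cvgB; [exact: cprim|exact: cvg_cst].
rewrite (cvg_unique _ lim1 lim2)//.
by rewrite sub0r weight_primitive0 opprK.
Unshelve. all: by end_near. Qed.

End Weight.

Section WeightedMoments.
Variable R : realType.
Variables (r alpha : R).
Hypothesis r_gt0 : 0 < r.
Hypothesis alpha_gt0 : 0 < alpha.
Implicit Types (q p u I : quat R) (z w : R * R) (s t : R) (n k : nat).
Implicit Types (F G Fx Fy : R * R -> quat R).

Notation leb := (@lebesgue_measure R).
Notation W := (radial_weight r alpha).

Let r2_gt0 : 0 < r ^+ 2. Proof. exact: exprn_gt0. Qed.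

(** A continuous approximation of the indicator of ]0, r^2[ supported away
    from both endpoints: 0 has to be avoided because of z^(-n), and r^2
    because the weight may be unbounded there. *)
Definition plateau k s : R :=
  Num.min 1 (Num.max 0 (k.+1%:R * Num.min s (r ^+ 2 - s) - 1)).

Lemma plateau_ge0 k s : 0 <= plateau k s.
Proof. by rewrite le_min ler01 le_max lexx. Qed.

Lemma plateau_le1 k s : plateau k s <= 1.
Proof. by rewrite ge_min lexx. Qed.

Lemma plateau_continuous k : continuous (plateau k).
Proof.
move=> s.
suff : {for s, continuous (fun s => Num.min 1 (Num.max 0 (k.+1%:R * Num.min s (r ^+ 2 - s) - 1)))} by [].
apply: (@continuous_min _ _ (fun=> 1) (fun s => Num.max 0 (k.+1%:R * Num.min s (r ^+ 2 - s) - 1))).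
  exact: contC.
apply: (@continuous_max _ _ (fun=> 0) (fun s => k.+1%:R * Num.min s (r ^+ 2 - s) - 1)).
  exact: contC.
apply: contB; last exact: contC.
apply: contM; first exact: contC.
apply: (@continuous_min _ _ (fun s => s) (fun s => r ^+ 2 - s)); first exact: cvg_id.
by apply: contB; [exact: contC|exact: cvg_id].
Qed.

Lemma plateau_supported k : supported (plateau k) k.+1%:R^-1 (r ^+ 2 - k.+1%:R^-1).
Proof.
move=> s h; rewrite /plateau.
suff h0 : k.+1%:R * Num.min s (r ^+ 2 - s) - 1 <= 0 by rewrite (max_l h0) min_r.
rewrite subr_le0 -ler_pdivlMl// mulr1 ge_min.
case: h => h; apply/orP; [left; exact: ltW|right].
by rewrite lerBlDr -lerBlDl ltW.
Qed.

Lemma plateau_cvg s : 0 < s < r ^+ 2 -> plateau k s @[k --> \oo] --> (1 : R).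
Proof.
move=> /andP[s0 sr]; pose m := Num.min s (r ^+ 2 - s).
have m0 : 0 < m / 2 by rewrite divr_gt0// lt_min s0 subr_gt0.
apply: cvg_near_cst.
have /cvgrPdist_lt/(_ _ m0) := @cvg_harmonic R.
apply: filterS => k; rewrite /harmonic /= sub0r normrN gtr0_norm ?invr_gt0// => h.
apply/esym; rewrite /plateau -/m min_l// le_max; apply/orP; right.
rewrite lerBrDr -ler_pdivrMl// mulrDr mulr1.
by move: h; move: (k.+1%:R^-1) => y h; lra.
Qed.

Definition cut_weight n k s := plateau k s * (s ^+ n * W s).

Lemma cut_weight_supported n k :
  supported (cut_weight n k) k.+1%:R^-1 (r ^+ 2 - k.+1%:R^-1).
Proof. by move=> s /plateau_supported h; rewrite /cut_weight h mul0r. Qed.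

Lemma cut_weight_continuous n k : continuous (cut_weight n k).
Proof.
move=> s; have [sr|sr] := ltP s (r ^+ 2).
  suff : {for s, continuous (fun s => plateau k s * (s ^+ n * W s))} by [].
  apply: contM; first exact: plateau_continuous.
  apply: contM; last exact: radial_weight_continuous.
  by apply: contX; exact: cvg_id.
have kinv : 0 < k.+1%:R^-1 :> R by rewrite invr_gt0.
have Z t : r ^+ 2 - k.+1%:R^-1 < t -> cut_weight n k t = 0.
  by move=> h; apply: cut_weight_supported; right.
have ks : r ^+ 2 - k.+1%:R^-1 < s by rewrite ltrBlDr (le_lt_trans sr)// ltrDl.
rewrite /continuous_at Z//.
apply: cvg_near_cst; near=> t; apply: Z; near: t.
exact: lt_nbhsr.
Unshelve. all: by end_near. Qed.

Lemma measurable_weight n :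
  measurable_fun setT (fun s : measurableTypeR R => s ^+ n * W s).
Proof.
apply: measurable_funM; first exact: measurable_funX.
apply: measurable_funM => //.
have m1 : measurable_fun setT (fun s : measurableTypeR R => 1 - s / r ^+ 2).
  by apply: measurable_funB => //; apply: measurable_funM.
exact: (measurableT_comp (measurable_powR (alpha - 1)) m1).
Qed.

Lemma weight_integrable n :
  leb.-integrable [set` `[0%R, (r ^+ 2)%R[ ] (fun s => (s ^+ n * W s)%:E).
Proof.
apply/integrableP; split.
  by apply/measurable_EFinP; apply: measurable_funTS; exact: measurable_weight.
under eq_integral => s.
  rewrite inE/= in_itv/= => /andP[s0 _].
  rewrite ger0_norm; last by rewrite mulr_ge0 ?exprn_ge0// radial_weight_ge0.
  over.
by rewrite weight_moment// ltry.
Qed.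

Definition moment n : R := pi^-1 * (r ^+ (2 * n) * n`!%:R / pochhammer (alpha + 1) n).

(** Dominated convergence, with the bound s^n W(s) provided by
    [weight_moment]. *)
Lemma cut_weight_cvg n : \int[leb]_s cut_weight n k s @[k --> \oo] --> moment n.
Proof.
pose D := [set` `[0%R, (r ^+ 2)%R[ ] : set (measurableTypeR R).
have mD : measurable D by exact: measurable_itv.
have E k : \int[leb]_s cut_weight n k s = fine (\int[leb]_(s in D) (cut_weight n k s)%:E)%E.
  rewrite Rintegral_mkcond [RHS]Rintegral_mkcond; apply: eq_Rintegral => s _.
  rewrite !patchE in_setT; case: ifPn => //.
  rewrite notin_setE/D/= in_itv/= => /negP; rewrite negb_and -ltNge -leNgt => /orP h.
  have kinv : 0 < k.+1%:R^-1 :> R by rewrite invr_gt0.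
  apply: cut_weight_supported; case: h => h; [left; exact: lt_trans kinv|right].
  by rewrite ltrBlDr (le_lt_trans h)// ltrDl.
under eq_fun do rewrite E.
have Dge0 s : D s -> 0 <= s ^+ n * W s.
  by rewrite /D/= in_itv/= => /andP[s0 _]; rewrite mulr_ge0 ?exprn_ge0// radial_weight_ge0.
have := @dominated_convergence _ _ R leb D mD (fun k s => (cut_weight n k s)%:E)
  (fun s => (s ^+ n * W s)%:E) (fun s => (s ^+ n * W s)%:E) _ _ _ (weight_integrable n) _.
case.
- move=> k; apply/measurable_EFinP; apply: measurable_funTS.
  by apply: continuous_measurable_fun; exact: cut_weight_continuous.
- by apply/measurable_EFinP; apply: measurable_funTS; exact: measurable_weight.
- exists [set 0]; split => //; first exact: lebesgue_measure_set1.
  move=> s /= /not_implyP[]; rewrite /D/= in_itv/= => /andP[s0 sr] h.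
  apply: contrapT => /eqP sn0; apply: h.
  apply/cvg_EFin; first by near=> k.
  have : plateau k s * (s ^+ n * W s) @[k --> \oo] --> 1 * (s ^+ n * W s).
    by apply: cvgM; [apply: plateau_cvg; rewrite lt_neqAle eq_sym sn0 s0|exact: cvg_cst].
  by rewrite mul1r.
- apply: aeW => s k Ds; rewrite lee_fin ger0_norm.
    by rewrite /cut_weight ler_piMl ?plateau_le1// Dge0.
  by rewrite mulr_ge0 ?plateau_ge0// Dge0.
move=> _ _ h.
have -> : moment n = fine (\int[leb]_(s in D) (s ^+ n * W s)%:E)%E by rewrite weight_moment.
apply: fine_cvg; rewrite fineK; first exact: h.
by rewrite weight_moment.
Unshelve. all: by end_near. Qed.

End WeightedMoments.

(** * Weighted Taylor coefficients *)

Section WeightedCoefficients.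
Variable R : realType.
Variables (r alpha : R).
Hypothesis r_gt0 : 0 < r.
Hypothesis alpha_gt0 : 0 < alpha.
Implicit Types (q p u I : quat R) (z w : R * R) (s t : R) (n k : nat).
Implicit Types (F G Fx Fy : R * R -> quat R).

Notation leb := (@lebesgue_measure R).
Notation W := (radial_weight r alpha).

Let r2_gt0 : 0 < r ^+ 2. Proof. exact: exprn_gt0. Qed.

Lemma open_disc : open (disc r).
Proof.
have -> : disc r = sqdist 0 @^-1` [set t | t < r ^+ 2] by [].
by apply: open_comp; [move=> z _; exact: continuous_sqdist|exact: open_lt].
Qed.

Lemma measurable_disc : measurable (disc r : set (plane R)).
Proof. exact: open_measurable_plane open_disc. Qed.

(** Square integrability of z^n; radial integration reduces it to the moments
    of the weight. *)
Lemma weight_area_integrable n : (area R).-integrable (disc r : set (plane R))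
  (fun z => (sqdist 0 z ^+ n * W (sqdist 0 z))%:E).
Proof.
pose D := [set` `[0%R, (r ^+ 2)%R[ ] : set (measurableTypeR R).
have mD : measurable D by exact: measurable_itv.
pose g := (fun s : measurableTypeR R => (s ^+ n * W s)%:E) \_ D.
have g0 s : (0 <= g s)%E.
  rewrite /g patchE; case: ifPn => //; rewrite inE /D/= in_itv/= => /andP[s0 _].
  by rewrite lee_fin mulr_ge0 ?exprn_ge0// radial_weight_ge0.
have mg : measurable_fun setT g.
  apply/(measurable_restrictT _ mD); apply/measurable_EFinP; apply: measurable_funTS.
  exact: measurable_weight.
have mz : measurable_fun setT (fun z : plane R => g (sqdist 0 z)).
  exact: measurableT_comp mg (measurable_sqdist 0).
have gE : (fun z : plane R => (sqdist 0 z ^+ n * W (sqdist 0 z))%:E) \_ (disc r : set (plane R)) =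
    (fun z : plane R => g (sqdist 0 z)).
  apply/funext => z; rewrite /g !patchE.
  have -> : (z \in (disc r : set (plane R))) = (sqdist 0 z \in D).
    by apply/idP/idP; rewrite !inE /D/disc/= in_itv/= sqdist_ge0.
  by [].
apply/(integrable_mkcond _ measurable_disc); rewrite gE.
apply/integrableP; split => //.
under eq_integral do rewrite gee0_abs//.
rewrite (integral_radial 0 mg g0) /g -integral_mkcondr.
have -> : `[0%R, +oo[%classic `&` D = D.
  by apply/seteqP; split => s; rewrite /D/= !in_itv/=; [case|move=> h; split => //; case/andP: h => ->].
by rewrite weight_moment// -EFinM ltry.
Qed.

Lemma slice_inv0E I z : imag_unit I -> z <> 0 ->
  sqdist 0 z *: slice_inv I 0 z = qconj (slice_pt I z).
Proof.
move=> hI /sqdist_neq0 h; rewrite slice_conjE// /slice_inv /slice_pt /= !subr0.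
by rewrite scalerDr !scalerA !(mulrC (sqdist 0 z)) !divfK.
Qed.

Lemma qcont_conj_pow I n F z : imag_unit I -> qcont F z ->
  qcont (fun z => qconj (slice_pt I z) ^+ n * F z) z.
Proof.
move=> hI cF; elim: n => [|n IHn].
  have -> : (fun z => qconj (slice_pt I z) ^+ 0 * F z) = F.
    by apply/funext => t; rewrite expr0 mul1r.
  exact: cF.
have -> : (fun z => qconj (slice_pt I z) ^+ n.+1 * F z) =
    (fun z => slice_pt I (z.1, - z.2) * (qconj (slice_pt I z) ^+ n * F z)).
  by apply/funext => t; rewrite exprS slice_conjE// mulrA.
apply: (@qcont_slice_mul R I (fun z => z.1) (fun z => - z.2)
  (fun z => qconj (slice_pt I z) ^+ n * F z)); [exact: cvg_fst| |exact: IHn].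
by apply: contN; exact: cvg_snd.
Qed.

Section Coefficient.
Variables (I : quat R) (F Fx Fy : R * R -> quat R) (t : nat -> quat R).
Hypothesis hI : imag_unit I.
Hypothesis rF : regular_with I (disc r) F Fx Fy.
Hypothesis iF : (area R).-integrable (disc r : set (plane R))
  (fun z => (`|F z| ^+ 2 * W (sqdist 0 z))%:E).
Hypothesis ht : forall n v e d, 0 < e -> d < r ^+ 2 -> continuous v ->
  supported v e d ->
  qint (fun z => v (sqdist 0 z) *: (slice_inv I 0 z ^+ n * F z)) =
    (\int[leb]_t v t) *: t n.

Let g u n z := qre (u * (qconj (slice_pt I z) ^+ n * F z)) * W (sqdist 0 z).

Lemma coefficient_measurable u n :
  measurable_fun (disc r : set (plane R)) (g u n : plane R -> measurableTypeR R).
Proof.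
apply: open_continuous_measurable_plane; first exact: open_disc.
move=> z; rewrite inE => Dz.
have [cF _ _ _ _] := rF Dz.
suff : {for z, continuous (fun z => qre (u * (qconj (slice_pt I z) ^+ n * F z)) * W (sqdist 0 z))} by [].
apply: contM; first exact: qcont_conj_pow.
apply: cont_comp; first exact: continuous_sqdist.
exact: radial_weight_continuous.
Qed.

(** |F| W is integrable because |F| <= 1 + |F|^2 and the weight is integrable. *)
Lemma coefficient_integrable u n :
  (area R).-integrable (disc r : set (plane R)) (fun z => (g u n z)%:E).
Proof.
have i1 : (area R).-integrable (disc r : set (plane R))
    (fun z => ((`|u| * r ^+ n) * (W (sqdist 0 z) + `|F z| ^+ 2 * W (sqdist 0 z)))%:E).
  have iW : (area R).-integrable (disc r : set (plane R)) (fun z => (W (sqdist 0 z))%:E).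
    by have := weight_area_integrable 0; under eq_fun do rewrite expr0 mul1r.
  have iWF := integrableD measurable_disc iW iF.
  exact: (integrableZl measurable_disc (`|u| * r ^+ n) iWF).
apply: (le_integrable measurable_disc _ _ i1).
  by apply/measurable_EFinP; exact: coefficient_measurable.
move=> z Dz /=; rewrite lee_fin.
have W0 : 0 <= W (sqdist 0 z) by exact: radial_weight_ge0.
rewrite [leRHS]ger0_norm; last first.
  by rewrite mulr_ge0// ?mulr_ge0// ?exprn_ge0 ?(ltW r_gt0)// addr_ge0// mulr_ge0// sqr_ge0.
rewrite /g normrM (ger0_norm W0).
have -> : W (sqdist 0 z) + `|F z| ^+ 2 * W (sqdist 0 z) = (1 + `|F z| ^+ 2) * W (sqdist 0 z).
  by rewrite mulrDl mul1r.
rewrite [leRHS]mulrA ler_wpM2r//.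
apply: (le_trans (normr_qre_mul _ _)); rewrite -mulrA ler_wpM2l//.
rewrite quat_normM quat_normX qconj_norm.
have zr : `|slice_pt I z| <= r.
  rewrite -(@ler_pXn2r _ 2) ?nnegrE// ?(ltW r_gt0)// slice_pt_norm//.
  by move: Dz; rewrite /disc/= /sqdist /= !subr0 => /ltW.
apply: ler_pM; rewrite ?exprn_ge0//.
  by rewrite lerXn2r ?nnegrE// (ltW r_gt0).
have := sqr_ge0 (`|F z| - 1); have := sqr_ge0 (`|F z|); have := normr_ge0 (F z).
by nra.
Qed.

(** For the truncated weight the identity is the property of the Taylor
    coefficients t, because conj(z)^n = |z|^(2n) z^(-n); dominated convergence
    removes the truncation on both sides. *)
Lemma weighted_coefficient u n :
  \int[area R]_(z in (disc r : set (plane R))) g u n z = moment r alpha n * qre (u * t n).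
Proof.
have mD := measurable_disc.
have ig := coefficient_integrable u n.
have kinv k : 0 < k.+1%:R^-1 :> R by rewrite invr_gt0.
have E k : \int[leb]_s cut_weight r alpha n k s * qre (u * t n) =
    fine (\int[area R]_(z in (disc r : set (plane R))) (plateau r k (sqdist 0 z) * g u n z)%:E)%E.
  rewrite -qreZ scalerAr -(@ht n _ _ _ (kinv k) _ (@cut_weight_continuous _ r alpha r_gt0 n k) (@cut_weight_supported _ r alpha n k)); last first.
    by rewrite ltrBlDr ltrDl.
  rewrite qint_re; last first.
    apply: (annulus_qintegrable (Om := disc r `\ 0) (@cut_weight_continuous _ r alpha r_gt0 n k)
      (@cut_weight_supported _ r alpha n k)).
      move=> z /andP[z1 z2]; split.
        by apply: (le_lt_trans z2); rewrite ltrBlDr ltrDl.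
      by move=> /= z0; move: z1; rewrite z0 sqdist_self leNgt kinv.
    have [Gx [Gy rG]] := regular_iter_inv hI rF n.
    by move=> z /rG[].
  rewrite -/(Rintegral _ _ _) [RHS]Rintegral_mkcond; apply: eq_Rintegral => z _.
  rewrite patchE; case: ifPn => zD; last first.
    have h : r ^+ 2 <= sqdist 0 z.
      by move: zD; rewrite notin_setE /disc/= => /negP; rewrite -leNgt.
    have -> : cut_weight r alpha n k (sqdist 0 z) = 0.
      by apply: cut_weight_supported; right; rewrite ltrBlDr (le_lt_trans h)// ltrDl.
    by rewrite scale0r mulr0.
  have [->|z0] := pselect (z = 0).
    have p0 : plateau r k 0 = 0 by apply: plateau_supported; left; exact: kinv.
    by rewrite sqdist_self /cut_weight p0 !mul0r scale0r mulr0.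
  rewrite /g -(slice_inv0E hI z0) exprZn.
  rewrite (_ : _ *: slice_inv I 0 z ^+ n * F z =
    sqdist 0 z ^+ n *: (slice_inv I 0 z ^+ n * F z)); last by rewrite -scalerAl.
  rewrite !qre_mulZ /cut_weight.
  by move: (qre _) (W _) (plateau _ _ _) (_ ^+ n) => a b c d; ring.
have := @dominated_convergence _ _ R (area R) _ mD
  (fun k z => (plateau r k (sqdist 0 z) * g u n z)%:E)
  (fun z => (g u n z)%:E) (fun z => `|(g u n z)%:E|)%E _ _ _ (integrable_abse ig) _.
case.
- move=> k; apply/measurable_EFinP; apply: measurable_funM; last exact: coefficient_measurable.
  apply: measurable_funTS; apply: continuous_measurable_plane => z.
  suff : {for z, continuous (fun z => plateau r k (sqdist 0 z))} by [].
  by apply: cont_comp; [exact: continuous_sqdist|exact: plateau_continuous].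
- by apply/measurable_EFinP; exact: coefficient_measurable.
- exists [set 0]; split => //.
  + have -> : [set (0 : R * R)] = [set (0 : R)] `*` [set (0 : R)].
      by apply/seteqP; split => [z /= ->//|[x y] /= [-> ->]].
    by apply: measurableX; exact: measurable_set1.
  + have -> : [set (0 : R * R)] = [set (0 : R)] `*` [set (0 : R)].
      by apply/seteqP; split => [z /= ->//|[x y] /= [-> ->]].
    have a0 : area R ([set (0 : R)] `*` [set (0 : R)]) = 0%E.
      rewrite product_measure1E; [|exact: measurable_set1..].
      by rewrite [X in (X * _)%E](lebesgue_measure_set1 (0 : R)) mul0e.
    exact: a0.
  move=> z /= /not_implyP[]; rewrite /disc/= => zr h.
  apply: contrapT => z0; apply: h.
  apply/cvg_EFin; first by near=> k.
  have : plateau r k (sqdist 0 z) * g u n z @[k --> \oo] --> 1 * g u n z.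
    apply: cvgM; last exact: cvg_cst; apply: plateau_cvg; rewrite zr andbT.
    by rewrite lt_neqAle eq_sym sqdist_neq0//= sqdist_ge0.
  by rewrite mul1r.
- apply: aeW => z k Dz; rewrite !abse_EFin lee_fin normrM ger0_norm ?plateau_ge0//.
  by rewrite ler_piMl ?plateau_le1.
move=> _ _ h.
have h1 : \int[leb]_s cut_weight r alpha n k s * qre (u * t n) @[k --> \oo] -->
    \int[area R]_(z in (disc r : set (plane R))) g u n z.
  under eq_fun do rewrite E.
  apply: fine_cvg; rewrite fineK; first exact: h.
  exact: integrable_fin_num.
have h2 : \int[leb]_s cut_weight r alpha n k s * qre (u * t n) @[k --> \oo] -->
    moment r alpha n * qre (u * t n).
  by apply: cvgM; [exact: cut_weight_cvg|exact: cvg_cst].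
exact: (cvg_unique _ h1 h2).
Unshelve. all: by end_near. Qed.

End Coefficient.
End WeightedCoefficients.

(** * Slice regular functions *)

Section SliceRegular.
Variable R : realType.
Implicit Types (q p u I : quat R) (a b : R) (z w : R * R).

Lemma qre_mul_cvg (T : Type) (H : set_system T) {FH : Filter H} u (f : T -> quat R) (l : quat R) :
  f @ H --> l -> (fun x => qre (u * f x)) @ H --> qre (u * l).
Proof.
move=> /cvgrPdist_lt fl; apply/cvgrPdist_lt => e e0.
have u1 : 0 < `|u| + 1 by rewrite ltr_wpDl.
have := fl (e / (`|u| + 1)) (divr_gt0 e0 u1).
apply: filterS => x h.
rewrite -qreB -mulrBr; apply: (le_lt_trans (normr_qre_mul _ _)).
apply: (@le_lt_trans _ _ ((`|u| + 1) * `|l - f x|)); first by rewrite ler_wpM2r// lerDl.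
by rewrite mulrC -ltr_pdivlMr.
Qed.

Lemma continuous_qcont (T : topologicalType) (f : T -> quat R) (x : T) :
  {for x, continuous f} -> qcont f x.
Proof. by move=> cf u; exact: qre_mul_cvg. Qed.

Lemma derive_qderiv_x (f : R * R -> quat R) z : derivable f z (1, 0) ->
  qderiv (fun t => f (t, z.2)) z.1 ('D_(1, 0) f z).
Proof.
move=> df u; have h := qre_mul_cvg (u := u) df.
have {}h : h0^-1 *: (((fun t : R => qre (u * f (t, z.2))) \o shift z.1) (h0 *: (1 : R)) - qre (u * f (z.1, z.2)))
    @[h0 --> 0^'] --> qre (u * 'D_(1, 0) f z).
  suff -> : (fun t => t^-1 *: (((fun t : R => qre (u * f (t, z.2))) \o shift z.1) (t *: (1 : R)) - qre (u * f (z.1, z.2)))) =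
      (fun t => qre (u * (t^-1 *: ((f \o shift z) (t *: (1, 0)) - f z)))) by exact: h.
  apply/funext => t.
  have E : ((fun t : R => qre (u * f (t, z.2))) \o shift z.1) (t *: (1 : R)) =
      qre (u * (f \o shift z) (t *: (1, 0))).
    rewrite /comp; congr (qre (u * f _)).
    by case: z {df h} => x y; rewrite /shift /=; congr pair; exact: (esym (etrans (congr1 (+%R^~ _) (mulr0 t)) (add0r _))).
  rewrite E -surjective_pairing -qreB -mulrBr -scalerAr qreZ.
  by [].
apply: DeriveDef; first by apply: cvgP; exact: h.
exact: (cvg_lim _ h).
Qed.

Lemma derive_qderiv_y (f : R * R -> quat R) z : derivable f z (0, 1) ->
  qderiv (fun t => f (z.1, t)) z.2 ('D_(0, 1) f z).
Proof.
move=> df u; have h := qre_mul_cvg (u := u) df.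
have {}h : h0^-1 *: (((fun t : R => qre (u * f (z.1, t))) \o shift z.2) (h0 *: (1 : R)) - qre (u * f (z.1, z.2)))
    @[h0 --> 0^'] --> qre (u * 'D_(0, 1) f z).
  suff -> : (fun t => t^-1 *: (((fun t : R => qre (u * f (z.1, t))) \o shift z.2) (t *: (1 : R)) - qre (u * f (z.1, z.2)))) =
      (fun t => qre (u * (t^-1 *: ((f \o shift z) (t *: (0, 1)) - f z)))) by exact: h.
  apply/funext => t.
  have E : ((fun t : R => qre (u * f (z.1, t))) \o shift z.2) (t *: (1 : R)) =
      qre (u * (f \o shift z) (t *: (0, 1))).
    rewrite /comp; congr (qre (u * f _)).
    by case: z {df h} => x y; rewrite /shift /=; congr pair; exact: (esym (etrans (congr1 (+%R^~ _) (mulr0 t)) (add0r _))).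
  rewrite E -surjective_pairing -qreB -mulrBr -scalerAr qreZ.
  by [].
apply: DeriveDef; first by apply: cvgP; exact: h.
exact: (cvg_lim _ h).
Qed.

Lemma slice_disc_disc (r : R) I : 0 < r -> imag_unit I -> slice_disc r I = disc r.
Proof.
move=> r0 hI; apply/seteqP; split => z; rewrite /slice_disc /disc /=.
  move=> h; have : `|slice_pt I z| ^+ 2 < r ^+ 2 by rewrite ltr_pXn2r ?nnegrE// ltW.
  by rewrite slice_pt_norm// /sqdist /= !subr0.
move=> h; rewrite -(@ltr_pXn2r _ 2) ?nnegrE// ?(ltW r0)// slice_pt_norm//.
by move: h; rewrite /sqdist /= !subr0.
Qed.

Lemma slice_pt_is_linear I : linear (slice_pt I).
Proof.
move=> a z w; rewrite /slice_pt /= !scalerDl scalerDr !scalerA.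
by rewrite addrACA.
Qed.

HB.instance Definition _ I :=
  GRing.isLinear.Build R (R * R)%type (quat R) *:%R (slice_pt I) (slice_pt_is_linear I).

Lemma slice_pt_continuous I : continuous (slice_pt I).
Proof.
move=> z; rewrite /slice_pt.
suff : {for z, continuous (fun z : R * R => z.1 *: (1 : quat R) + z.2 *: I)} by [].
apply: (@continuousD _ _ _ (fun z : R * R => z.1 *: (1 : quat R)) (fun z : R * R => z.2 *: I)).
  by apply: continuousZl; exact: cvg_fst.
by apply: continuousZl; exact: cvg_snd.
Qed.

(** Continuity on the slice comes from the real differentiability of f on the
    ball; the other clauses are those of slice regularity, tested on the
    functionals q |-> Re (u q). *)
Lemma regular_of_slice_regular (r : R) I (f : quat R -> quat R) :
  0 < r -> imag_unit I -> slice_regular r f ->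
  regular_with I (disc r) (f \o slice_pt I)
    ('D_(1, 0) (f \o slice_pt I)) ('D_(0, 1) (f \o slice_pt I)).
Proof.
move=> r0 hI [df rf] z; rewrite -(slice_disc_disc r0 hI) => Dz.
have [d1 d2 c1 c2 CR] := rf I hI z Dz.
split.
- apply: continuous_qcont; apply: continuous_comp; first exact: slice_pt_continuous.
  by apply: differentiable_continuous; exact: df.
- exact: (continuous_qcont c1).
- exact: (continuous_qcont c2).
- by split; [exact: derive_qderiv_x|exact: derive_qderiv_y].
- exact: CR.
Qed.

End SliceRegular.

(** * Monomials *)

Section Monomials.
Variable R : realType.
Implicit Types (q p u I : quat R) (a b : R) (z w : R * R) (n : nat).

Lemma quat_decomp q : q = qre q *: 1 + qi q *: Quat 0 1 0 0 +
  qj q *: Quat 0 0 1 0 + qk q *: Quat 0 0 0 1.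
Proof. by case: q => a b c d; apply: quat_eqP; split => /=; ring. Qed.

Definition qdifferentiable (f : quat R -> quat R) q :=
  [/\ differentiable (fun p => qre (f p)) q, differentiable (fun p => qi (f p)) q,
      differentiable (fun p => qj (f p)) q & differentiable (fun p => qk (f p)) q].

Lemma qdifferentiable_differentiable f q : qdifferentiable f q -> differentiable f q.
Proof.
move=> [d0 d1 d2 d3].
have -> : f = (fun p => qre (f p) *: 1) + (fun p => qi (f p) *: Quat 0 1 0 0) +
    (fun p => qj (f p) *: Quat 0 0 1 0) + (fun p => qk (f p) *: Quat 0 0 0 1).
  by apply/funext => p; exact: quat_decomp.
by do 3?[apply: differentiableD]; apply: differentiableZl.
Qed.

Lemma qre_mul_continuous u : continuous (fun q : quat R => qre (u * q)).
Proof.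
move=> q; have h : (fun p : quat R => p) x @[x --> q] --> q by exact: cvg_id.
have := qre_mul_cvg (u := u) h.
exact.
Qed.

Lemma qre_mul_differentiable u q : differentiable (fun q : quat R => qre (u * q)) q.
Proof.
have lh : linear (fun q : quat R => qre (u * q)).
  by move=> a p p'; rewrite mulrDr qreD -scalerAr qreZ.
pose hL : {linear quat R -> R} := HB.pack (fun q : quat R => qre (u * q))
  (GRing.isLinear.Build _ _ _ _ (fun q : quat R => qre (u * q)) lh).
exact: (@linear_differentiable R (quat R) R hL q (@qre_mul_continuous u)).
Qed.

Lemma qdifferentiable_id q : qdifferentiable id q.
Proof.
split.
- have -> : (fun p : quat R => qre p) = (fun p => qre (1 * p)).
    by apply/funext => p; rewrite mul1r.
  exact: qre_mul_differentiable.
- have -> : (fun p : quat R => qi p) = (fun p => qre (Quat 0 (-1) 0 0 * p)).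
    by apply/funext => p /=; ring.
  exact: qre_mul_differentiable.
- have -> : (fun p : quat R => qj p) = (fun p => qre (Quat 0 0 (-1) 0 * p)).
    by apply/funext => p /=; ring.
  exact: qre_mul_differentiable.
- have -> : (fun p : quat R => qk p) = (fun p => qre (Quat 0 0 0 (-1) * p)).
    by apply/funext => p /=; ring.
  exact: qre_mul_differentiable.
Qed.

Lemma difD (f g : quat R -> R) q : differentiable f q -> differentiable g q ->
  differentiable (fun p => f p + g p) q.
Proof. exact: differentiableD. Qed.

Lemma difB (f g : quat R -> R) q : differentiable f q -> differentiable g q ->
  differentiable (fun p => f p - g p) q.
Proof. exact: differentiableB. Qed.

Lemma difM (f g : quat R -> R) q : differentiable f q -> differentiable g q ->
  differentiable (fun p => f p * g p) q.
Proof. exact: differentiableM. Qed.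

Lemma qdifferentiableM f g q : qdifferentiable f q -> qdifferentiable g q ->
  qdifferentiable (fun p => f p * g p) q.
Proof.
move=> [f0 f1 f2 f3] [g0 g1 g2 g3]; split => /=.
- apply: difB; last exact: difM.
  by apply: difB; last exact: difM; apply: difB; exact: difM.
- apply: difB; last exact: difM.
  by apply: difD; last exact: difM; apply: difD; exact: difM.
- apply: difD; last exact: difM.
  by apply: difD; last exact: difM; apply: difB; exact: difM.
- apply: difD; last exact: difM.
  by apply: difB; last exact: difM; apply: difD; exact: difM.
Qed.

Lemma monomial_differentiable n q : qdifferentiable (fun p => p ^+ n) q.
Proof.
elim: n => [|n IHn].
  by split; rewrite /=; exact: differentiable_cst.
have -> : (fun p => p ^+ n.+1) = (fun p : quat R => p * p ^+ n).
  by apply/funext => p; rewrite exprS.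
exact: qdifferentiableM (qdifferentiable_id q) IHn.
Qed.

(** The slice is commutative, so that the usual formula n z^(n-1) holds, and
    the derivative in y carries an extra factor I. *)
Lemma qderiv_power_x I n z :
  qderiv (fun t => slice_pt I (t, z.2) ^+ n) z.1 (n%:R%:A * slice_pt I z ^+ n.-1).
Proof.
elim: n => [|n IHn] u.
  rewrite scale0r mul0r mulr0.
  have -> : (fun t => qre (u * slice_pt I (t, z.2) ^+ 0)) = (fun=> qre (u * 1)).
    by apply/funext => t; rewrite expr0.
  exact: drvC.
have -> : (fun t => qre (u * slice_pt I (t, z.2) ^+ n.+1)) =
    (fun t => t * qre (u * slice_pt I (t, z.2) ^+ n) + z.2 * qre (u * I * slice_pt I (t, z.2) ^+ n)).
  by apply/funext => t; rewrite exprS slice_pt_mul.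
apply: drvE (drvD (drvM (drvI _) (IHn u)) (drvM (drvC z.2 _) (IHn (u * I)))) _.
rewrite mul0r add0r mul1r -surjective_pairing -addrA -slice_pt_mul -qreD -mulrDr.
congr (qre (u * _)); rewrite qmul_algl -scalerAr qmul_algl; case: n {IHn} => [|n].
  by rewrite scale0r addr0 scale1r.
by rewrite -exprS /= -[n.+2]addn1 natrD scalerDl scale1r addrC.
Qed.

Lemma qderiv_power_y I n z : imag_unit I ->
  qderiv (fun t => slice_pt I (z.1, t) ^+ n) z.2 ((n%:R *: I) * slice_pt I z ^+ n.-1).
Proof.
move=> hI; elim: n => [|n IHn] u.
  rewrite scale0r mul0r mulr0.
  have -> : (fun t => qre (u * slice_pt I (z.1, t) ^+ 0)) = (fun=> qre (u * 1)).
    by apply/funext => t; rewrite expr0.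
  exact: drvC.
have -> : (fun t => qre (u * slice_pt I (z.1, t) ^+ n.+1)) =
    (fun t => z.1 * qre (u * slice_pt I (z.1, t) ^+ n) + t * qre (u * I * slice_pt I (z.1, t) ^+ n)).
  by apply/funext => t; rewrite exprS slice_pt_mul.
apply: drvE (drvD (drvM (drvC z.1 _) (IHn u)) (drvM (drvI _) (IHn (u * I)))) _.
rewrite mul0r add0r mul1r -surjective_pairing addrCA -slice_pt_mul -mulrA -qreD -mulrDr.
congr (qre (u * _)); rewrite -!scalerAl -scalerAr mulrA.
have E : I = slice_pt I (0, 1) by rewrite /slice_pt /= scale0r add0r scale1r.
have -> : slice_pt I z * I = I * slice_pt I z by rewrite {2 3}E slice_ptC.
case: n {IHn} => [|n]; first by rewrite scale0r addr0 scale1r.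
by rewrite -mulrA -exprS /= -[n.+2]addn1 natrD scalerDl scale1r addrC.
Qed.

Lemma slice_power_differentiable (c : quat R) n I z :
  differentiable (fun z => c * slice_pt I z ^+ n) z.
Proof.
have dp : differentiable (fun p => c * p ^+ n) (slice_pt I z).
  apply: qdifferentiable_differentiable; apply: qdifferentiableM (monomial_differentiable n _).
  by split; exact: differentiable_cst.
have ds : differentiable (slice_pt I) z.
  by apply: linear_differentiable; exact: slice_pt_continuous.
exact: (differentiable_comp ds dp).
Qed.

Lemma slice_power_derivable n I z v : derivable ((fun q => q ^+ n) \o slice_pt I) z v.
Proof.
apply: diff_derivable; have := slice_power_differentiable 1 n I z.
have -> // : (fun z => 1 * slice_pt I z ^+ n) = (fun q => q ^+ n) \o slice_pt I.
by apply/funext => t; rewrite mul1r.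
Qed.

Lemma slice_power_derive_x n I z :
  'D_(1, 0) ((fun q => q ^+ n) \o slice_pt I) z = n%:R%:A * slice_pt I z ^+ n.-1.
Proof.
apply: qre_eqP => u.
have [_ <-] := derive_qderiv_x (@slice_power_derivable n I z (1, 0)) u.
by have [_ <-] := qderiv_power_x I n z u.
Qed.

Lemma slice_power_derive_y n I z : imag_unit I ->
  'D_(0, 1) ((fun q => q ^+ n) \o slice_pt I) z = (n%:R *: I) * slice_pt I z ^+ n.-1.
Proof.
move=> hI; apply: qre_eqP => u.
have [_ <-] := derive_qderiv_y (@slice_power_derivable n I z (0, 1)) u.
by have [_ <-] := qderiv_power_y n z hI u.
Qed.

Lemma monomial_slice_regular (r : R) n : slice_regular r (fun q => q ^+ n).
Proof.
split=> [q _|I hI fI z _].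
  exact: qdifferentiable_differentiable (monomial_differentiable n q).
have Ex : (fun t => 'D_(1, 0) fI t) = (fun t => n%:R%:A * slice_pt I t ^+ n.-1).
  by apply/funext => t; exact: slice_power_derive_x.
have Ey : (fun t => 'D_(0, 1) fI t) = (fun t => (n%:R *: I) * slice_pt I t ^+ n.-1).
  by apply/funext => t; exact: slice_power_derive_y.
split.
- exact: slice_power_derivable.
- exact: slice_power_derivable.
- by rewrite Ex; apply: differentiable_continuous; exact: slice_power_differentiable.
- by rewrite Ey; apply: differentiable_continuous; exact: slice_power_differentiable.
- rewrite slice_power_derive_x slice_power_derive_y// mulrA -mulrDl -scalerAr imag_unit_sqr// scalerN.
  by rewrite subrr mul0r.
Qed.

End Monomials.

(** * The series of the Bergman kernel *)

Section KernelSeries.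
Variable R : realType.
Variables (r alpha : R).
Hypothesis r_gt0 : 0 < r.
Hypothesis alpha_gt0 : 0 < alpha.
Implicit Types (q p u I : quat R) (a b : R) (z w : R * R) (n : nat).
Implicit Types (f G : quat R -> quat R).

Notation W := (radial_weight r alpha).

Lemma sqdist0_norm I z : imag_unit I -> sqdist 0 z = `|slice_pt I z| ^+ 2.
Proof. by move=> hI; rewrite slice_pt_norm// /sqdist /= !subr0. Qed.

Lemma bergman_weight_slice I z : imag_unit I ->
  bergman_weight r alpha (slice_pt I z) = W (sqdist 0 z).
Proof. by move=> hI; rewrite /bergman_weight -sqdist0_norm. Qed.

Lemma monomial_bergman n : bergman_space r alpha (fun q => q ^+ n).
Proof.
split; first exact: monomial_slice_regular.
move=> I hI; rewrite (slice_disc_disc r_gt0 hI).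
have := weight_area_integrable r_gt0 alpha_gt0 n.
have -> // : (fun z : plane R => (`|slice_pt I z ^+ n| ^+ 2 *
    bergman_weight r alpha (slice_pt I z))%:E) = (fun z => (sqdist 0 z ^+ n * W (sqdist 0 z))%:E).
by apply/funext => z; rewrite bergman_weight_slice// quat_normX exprAC -sqdist0_norm.
Qed.

Lemma bergman_integrable I f : imag_unit I -> bergman_space r alpha f ->
  (area R).-integrable (disc r : set (plane R))
    (fun z => (`|f (slice_pt I z)| ^+ 2 * W (sqdist 0 z))%:E).
Proof.
move=> hI [_ /(_ I hI)]; rewrite (slice_disc_disc r_gt0 hI).
have -> // : (fun z : plane R => (`|f (slice_pt I z)| ^+ 2 *
    bergman_weight r alpha (slice_pt I z))%:E) = (fun z => (`|f (slice_pt I z)| ^+ 2 * W (sqdist 0 z))%:E).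
by apply/funext => z; rewrite bergman_weight_slice.
Qed.

Definition slice_integrable I G := forall u,
  (area R).-integrable (disc r : set (plane R))
    (fun z => (qre (u * G (slice_pt I z)) * W (sqdist 0 z))%:E).

Lemma slice_integralE I G : imag_unit I ->
  slice_integral r alpha I G =
  Quat (\int[area R]_(z in (disc r : set (plane R))) (qre (G (slice_pt I z)) * W (sqdist 0 z)))
       (\int[area R]_(z in (disc r : set (plane R))) (qi (G (slice_pt I z)) * W (sqdist 0 z)))
       (\int[area R]_(z in (disc r : set (plane R))) (qj (G (slice_pt I z)) * W (sqdist 0 z)))
       (\int[area R]_(z in (disc r : set (plane R))) (qk (G (slice_pt I z)) * W (sqdist 0 z))).
Proof.
move=> hI; pose integ (h : quat R -> R) :=
  \int[area R]_(z in (disc r : set (plane R))) (h (slice_pt I z) * W (sqdist 0 z)).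
transitivity (Quat (integ (qre (R:=R) \o G)) (integ (qi (R:=R) \o G)) (integ (qj (R:=R) \o G)) (integ (qk (R:=R) \o G)));
last by [].
cbv delta [slice_integral lebesgue2]; cbv beta.
lazymatch goal with |- (let integ := ?F in _) = _ => 
 have E : F = integ end.
  apply/funext => h; rewrite (slice_disc_disc r_gt0 hI).
  by apply: eq_Rintegral => z _; rewrite bergman_weight_slice.
by rewrite E.
Qed.

Lemma slice_integral_re I G u : imag_unit I -> slice_integrable I G ->
  qre (u * slice_integral r alpha I G) =
  \int[area R]_(z in (disc r : set (plane R))) (qre (u * G (slice_pt I z)) * W (sqdist 0 z)).
Proof.
move=> hI iG; rewrite slice_integralE//.
have mD := measurable_disc r.
pose X (h : quat R -> R) z := h (G (slice_pt I z)) * W (sqdist 0 z).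
have E (v : quat R) (h : quat R -> R) : (forall q, qre (v * q) = h q) ->
    (area R).-integrable (disc r : set (plane R)) (fun z : plane R => (X h z)%:E).
  by move=> vh; have := iG v; rewrite /X; under eq_fun do rewrite vh.
have i0 := E 1 _ (fun q => congr1 _ (mul1r q)).
have i1 := E (Quat 0 (-1) 0 0) (@qi R) ltac:(by case=> ????/=; ring).
have i2 := E (Quat 0 0 (-1) 0) (@qj R) ltac:(by case=> ????/=; ring).
have i3 := E (Quat 0 0 0 (-1)) (@qk R) ltac:(by case=> ????/=; ring).
have Z a h : (area R).-integrable (disc r : set (plane R)) (fun z : plane R => (X h z)%:E) ->
    (area R).-integrable (disc r : set (plane R)) (fun z : plane R => (a * X h z)%:E).
  by move=> ih; exact: (integrableZl mD a ih).
have B (h k : plane R -> R) :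
    (area R).-integrable (disc r : set (plane R)) (fun z => (h z)%:E) ->
    (area R).-integrable (disc r : set (plane R)) (fun z => (k z)%:E) ->
    (area R).-integrable (disc r : set (plane R)) (fun z => (h z - k z)%:E).
  by move=> ih ik; exact: (integrableB mD ih ik).
have j0 := Z (qre u) _ i0; have j1 := Z (qi u) _ i1.
have j2 := Z (qj u) _ i2; have j3 := Z (qk u) _ i3.
have j01 := B _ _ j0 j1; have j012 := B _ _ j01 j2.
rewrite qre_comp_mul [qre (Quat _ _ _ _)]/= [qi (Quat _ _ _ _)]/= [qj (Quat _ _ _ _)]/= [qk (Quat _ _ _ _)]/=.
rewrite -(RintegralZl (qre u) mD i0) -(RintegralZl (qi u) mD i1).
rewrite -(RintegralZl (qj u) mD i2) -(RintegralZl (qk u) mD i3).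
rewrite -(RintegralB mD j0 j1) -(RintegralB mD j01 j2) -(RintegralB mD j012 j3).
by apply: eq_Rintegral => z _; rewrite /X qre_comp_mul; ring.
Qed.

Lemma slice_integral_conj I G H : imag_unit I -> slice_integrable I G ->
  (forall z, disc r z -> H (slice_pt I z) = qconj (G (slice_pt I z))) ->
  slice_integral r alpha I H = qconj (slice_integral r alpha I G).
Proof.
move=> hI iG HG; rewrite !slice_integralE//.
have mD := measurable_disc r.
pose X (h : quat R -> R) z := h (G (slice_pt I z)) * W (sqdist 0 z).
have E (v : quat R) (h : quat R -> R) : (forall q, qre (v * q) = h q) ->
    (area R).-integrable (disc r : set (plane R)) (fun z : plane R => (X h z)%:E).
  by move=> vh; have := iG v; rewrite /X; under eq_fun do rewrite vh.
have i1 := E (Quat 0 (-1) 0 0) (@qi R) ltac:(by case=> ????/=; ring).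
have i2 := E (Quat 0 0 (-1) 0) (@qj R) ltac:(by case=> ????/=; ring).
have i3 := E (Quat 0 0 0 (-1)) (@qk R) ltac:(by case=> ????/=; ring).
have N (h : quat R -> R) (ih : (area R).-integrable (disc r : set (plane R)) (fun z : plane R => (X h z)%:E)) :
    - (\int[area R]_(z in (disc r : set (plane R))) X h z) =
    \int[area R]_(z in (disc r : set (plane R))) (- h (G (slice_pt I z)) * W (sqdist 0 z)).
  rewrite -mulN1r -(RintegralZl (-1) mD ih); apply: eq_Rintegral => z _.
  by rewrite /X mulN1r mulNr.
rewrite /qconj [qre (Quat _ _ _ _)]/= [qi (Quat _ _ _ _)]/= [qj (Quat _ _ _ _)]/= [qk (Quat _ _ _ _)]/=.
rewrite (N _ i1) (N _ i2) (N _ i3).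
by congr Quat; apply: eq_Rintegral => z; rewrite inE => zD; rewrite HG.
Qed.

(** Conjugate of the reproducing formula for z^n at q, by the Hermitian
    symmetry of K. *)
Lemma kernel_coefficients (K : quat R -> quat R -> quat R) I q n :
  is_bergman_kernel r alpha K -> imag_unit I -> `|q| < r ->
  slice_integrable I (fun z : quat R => qconj z ^+ n * K z q) ->
  slice_integral r alpha I (fun z : quat R => qconj z ^+ n * K z q) = qconj q ^+ n.
Proof.
move=> [_ Kconj Krep] hI qr iG.
rewrite -[LHS]qconjK -(@slice_integral_conj I _ (fun z : quat R => K q z * z ^+ n))//.
  by rewrite -(Krep _ (monomial_bergman n) q qr I hI) qconjX.
move=> z; rewrite -(slice_disc_disc r_gt0 hI) => zr.
by rewrite qconjM qconjX qconjK Kconj.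
Qed.

(** By [kernel_coefficients] and [weighted_coefficient], the Taylor
    coefficient t_n of K(-, q) equals conj(q)^n divided by the n-th moment of
    the weight; the factor pi in the normalization of t_n cancels the one in
    the moment. *)
Lemma kernel_series (K : quat R -> quat R -> quat R) p q :
  is_bergman_kernel r alpha K -> `|p| < r -> `|q| < r ->
  (fun N => \sum_(i < N) (pochhammer (alpha + 1) i / i`!%:R) *:
     ((r^-1 *: p) ^+ i * (r^-1 *: qconj q) ^+ i)) @ \oo --> K p q.
Proof.
move=> hK pr qr; have [Kberg _ _] := hK.
have [I hI [w pw]] := mem_slice p.
pose f := K^~ q.
have fb : bergman_space r alpha f := Kberg q qr.
pose F := f \o slice_pt I.
have rF := regular_of_slice_regular r_gt0 hI fb.1.
have iF := bergman_integrable hI fb.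
have [t [Ht tay]] := taylor_expansion hI r_gt0 rF.
have wD : disc r w by rewrite -(slice_disc_disc r_gt0 hI) /slice_disc/= -pw.
have iG n : slice_integrable I (fun z : quat R => qconj z ^+ n * K z q).
  by move=> u; exact: (coefficient_integrable r_gt0 alpha_gt0 hI rF iF u n).
have tE n : moment r alpha n *: t n = qconj q ^+ n.
  rewrite -(kernel_coefficients hK hI qr (iG n)); apply: qre_eqP => u.
  rewrite slice_integral_re// qre_mulZ.
  exact: (esym (weighted_coefficient r_gt0 alpha_gt0 hI rF iF Ht u n)).
have := tay w wD; rewrite /F /= -pw => lim1.
have pin : (pi : R) != 0 by rewrite lt0r_neq0// pi_gt0.
have -> : (fun N => \sum_(i < N) (pochhammer (alpha + 1) i / i`!%:R) *:
     ((r^-1 *: p) ^+ i * (r^-1 *: qconj q) ^+ i)) =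
   (fun N => (pi : R)^-1 *: \sum_(i < N) p ^+ i * t i).
  apply/funext => N; rewrite scaler_sumr; apply: eq_bigr => i _.
  rewrite !exprZn -scalerAl -!scalerAr !scalerA -tE -scalerAr scalerA; congr (_ *: _).
  rewrite /moment /moment.
  have c0 : pochhammer (alpha + 1) i != 0.
    by apply/prodf_neq0 => k _; rewrite lt0r_neq0// ltr_wpDr// addr_gt0.
  have f0 : (i`!%:R : R) != 0 by rewrite pnatr_eq0 -lt0n fact_gt0.
  move: (pi : R) pin (pochhammer _ _) c0 (i`!%:R : R) f0 => P P0 c c0 g g0.
  rewrite (mulnC 2) exprM.
  have R0 : r ^+ i != 0 by rewrite expf_neq0// lt0r_neq0.
  rewrite !exprVn; move: (r ^+ i) R0 => s s0.
  field.
  by rewrite P0 c0 g0 s0.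
have -> : K p q = (pi : R)^-1 *: ((pi : R) *: K p q) by rewrite scalerA mulVf// scale1r.
apply: cvgZr; exact: lim1.
Qed.

End KernelSeries.

(** * Power series with quaternion coefficients *)

Section QuaternionPowerSeries.
Variable R : realType.
Implicit Types (q p u x : quat R) (a s k C m : R) (c : nat -> R) (g : nat -> quat R) (n N : nat).

(** Convergence can be tested on the functionals q |-> Re (u q), by comparing
    the modulus with the sum of the absolute values of the four components. *)
Lemma qre_cvg (T : Type) (H : set_system T) {FH : Filter H} (f : T -> quat R) (l : quat R) :
  (forall u, (fun t => qre (u * f t)) @ H --> qre (u * l)) -> f @ H --> l.
Proof.
move=> h; apply/cvgrPdist_lt => e e0; have e4 : 0 < e / 4 by rewrite divr_gt0.
have E v (k : quat R -> R) : (forall q, qre (v * q) = k q) ->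
    \forall t \near H, `|k (l - f t)| < e / 4.
  move=> vk; have /cvgrPdist_lt/(_ _ e4) := h v.
  by apply: filterS => t; rewrite -qreB -mulrBr vk.
have h0 := E 1 _ (fun q => congr1 _ (mul1r q)).
have h1 := E (Quat 0 (-1) 0 0) (@qi R) ltac:(by case=> ????/=; ring).
have h2 := E (Quat 0 0 (-1) 0) (@qj R) ltac:(by case=> ????/=; ring).
have h3 := E (Quat 0 0 0 (-1)) (@qk R) ltac:(by case=> ????/=; ring).
near=> t; apply: le_lt_trans (qnorm_le_sum _) _.
rewrite (_ : e = e / 4 + e / 4 + e / 4 + e / 4); last by lra.
by rewrite !ltrD//; near: t.
Unshelve. all: by end_near. Qed.

Lemma geometric_pseries_cvg c C m k : 0 <= m -> 0 <= k -> m * k < 1 ->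
  (forall n, `|c n| <= C * m ^+ n) -> cvgn (pseries c k).
Proof.
move=> m0 k0 mk1 cC; have C0 : 0 <= C by have := cC 0; rewrite expr0 mulr1; apply: le_trans.
have mk0 : 0 <= m * k by rewrite mulr_ge0.
apply: normed_cvg.
apply: (@series_le_cvg _ _ (geometric C (m * k))) => [n|n|n|].
- exact: normr_ge0.
- by rewrite /= mulr_ge0// exprn_ge0.
- by rewrite /= normrM normrX (ger0_norm k0) exprMn mulrA ler_wpM2r// exprn_ge0.
- by apply: is_cvg_geometric_series; rewrite ger0_norm.
Qed.

(** The first two terms of the binomial expansion of (m + d)^(n+1); a form of
    Bernoulli's inequality that is also valid at m = 0. *)
Lemma bernoulli_expansion m d n : 0 <= m -> 0 <= d ->
  n.+1%:R * m ^+ n * d + m ^+ n.+1 <= (m + d) ^+ n.+1.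
Proof.
move=> m0 d0; elim: n => [|n IHn]; first by rewrite expr0 !expr1 !mul1r addrC.
rewrite [leRHS]exprS; apply: le_trans (ler_wpM2l (addr_ge0 m0 d0) IHn).
rewrite -subr_ge0 (_ : _ - _ = n.+1%:R * m ^+ n * d ^+ 2).
  by rewrite !mulr_ge0// ?exprn_ge0.
by rewrite (_ : n.+2%:R = n.+1%:R + 1 :> R) ?natr1// !exprS; ring.
Qed.

(** Induction on N, passing to the shifted sequence. *)
Lemma eventual_ratio_geometric c m N : 1 <= m ->
  (forall n, (N <= n)%N -> `|c n.+1| <= m * `|c n|) ->
  exists C, forall n, `|c n| <= C * m ^+ n.
Proof.
move=> m1; elim: N c => [|N IHN] c hc.
  exists `|c 0|; elim=> [|n IHn]; first by rewrite expr0 mulr1.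
  rewrite exprS mulrCA; apply: le_trans (hc n isT) _.
  by rewrite ler_wpM2l// (le_trans _ m1).
have [C hC] := IHN (fun n => c n.+1) (fun n Nn => hc n.+1 Nn).
have C0 : 0 <= C by have := hC 0; rewrite expr0 mulr1; apply: le_trans.
exists (C + `|c 0|) => -[|n]; first by rewrite expr0 mulr1 lerDr.
have m0 : 0 <= m by apply: le_trans m1.
have E : m ^+ n <= m ^+ n.+1 by rewrite exprS ler_peMl// exprn_ge0.
apply: le_trans (hC n) _; rewrite mulrDl -[leLHS]addr0; apply: lerD.
  by rewrite ler_wpM2l.
by rewrite mulr_ge0// exprn_ge0.
Qed.

Definition geometric_bound g m := exists C, forall n, `|g n| <= C * m ^+ n.

Definition qdiffs g n : quat R := n.+1%:R *: g n.+1.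

Definition qseries g s : quat R :=
  Quat (limn (pseries (fun n => qre (g n)) s)) (limn (pseries (fun n => qi (g n)) s))
       (limn (pseries (fun n => qj (g n)) s)) (limn (pseries (fun n => qk (g n)) s)).

(** n m^n is dominated by m'^n for every m' > m, so differentiating term by
    term loses nothing but an arbitrarily small part of the radius. *)
Lemma geometric_bound_diffs g m m' : 0 <= m -> m < m' ->
  geometric_bound g m -> geometric_bound (qdiffs g) m'.
Proof.
move=> m0 mm' [C hC]; have C0 : 0 <= C by have := hC 0; rewrite expr0 mulr1; apply: le_trans.
have d0 : 0 < m' - m by rewrite subr_gt0.
exists (C * m * m' / (m' - m)) => n; rewrite /qdiffs normrZ ger0_norm//.
have h := bernoulli_expansion n m0 (ltW d0).
rewrite [m + _]addrC subrK in h.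
have {}h : n.+1%:R * m ^+ n * (m' - m) <= m' ^+ n.+1.
  by apply: le_trans h; rewrite lerDl exprn_ge0.
apply: (@le_trans _ _ (n.+1%:R * (C * m ^+ n.+1))); first by rewrite ler_wpM2l.
rewrite (_ : n.+1%:R * _ = C * m * (n.+1%:R * m ^+ n)); last by rewrite exprS; ring.
rewrite (_ : _ / _ * _ = C * m * (m' ^+ n.+1 / (m' - m))); last by rewrite exprS; ring.
by rewrite ler_wpM2l ?mulr_ge0// ler_pdivlMr.
Qed.

Section Sum.
Variables (g : nat -> quat R) (m : R).
Hypotheses (m_ge0 : 0 <= m) (g_bound : geometric_bound g m).

Lemma qre_pseries_cvg u k : 0 <= k -> m * k < 1 ->
  cvgn (pseries (fun n => qre (u * g n)) k).
Proof.
move=> k0 mk; have [C hC] := g_bound.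
apply: (@geometric_pseries_cvg _ (`|u| * C) m k) => // n.
by apply: le_trans (normr_qre_mul _ _) _; rewrite -mulrA ler_wpM2l.
Qed.

Lemma qre_pseries_cvg_norm u s : m * `|s| < 1 ->
  cvgn (pseries (fun n => qre (u * g n)) s).
Proof.
move=> ms; have d0 : 0 < 1 - m * `|s| by rewrite subr_gt0.
have m1 : 0 < m + 1 by rewrite ltr_wpDl.
pose k := `|s| + (1 - m * `|s|) / (m + 1).
have k0 : `|s| < k by rewrite ltrDl divr_gt0.
have mk : m * k < 1.
  rewrite /k mulrDr -ltrBrDl mulrA ltr_pdivrMr// mulrC ltr_pM2l//.
  by rewrite ltrDl.
have ck : cvgn (pseries (fun n => qre (u * g n)) k).
  by apply: qre_pseries_cvg => //; rewrite (le_trans _ (ltW k0)).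
apply: (is_cvg_pseries_inside ck).
by rewrite (ger0_norm (le_trans (normr_ge0 s) (ltW k0))).
Qed.

Lemma qseries_re u s : m * `|s| < 1 ->
  qre (u * qseries g s) = limn (pseries (fun n => qre (u * g n)) s).
Proof.
move=> ms; have cv v := @qre_pseries_cvg_norm v s ms.
have E v (h : quat R -> R) : (forall q, qre (v * q) = h q) ->
    cvgn (pseries (fun n => h (g n)) s).
  by move=> vh; have := cv v; under eq_fun do rewrite vh.
have i0 := E 1 _ (fun q => congr1 _ (mul1r q)).
have i1 := E (Quat 0 (-1) 0 0) (@qi R) ltac:(by case=> ????/=; ring).
have i2 := E (Quat 0 0 (-1) 0) (@qj R) ltac:(by case=> ????/=; ring).
have i3 := E (Quat 0 0 0 (-1)) (@qk R) ltac:(by case=> ????/=; ring).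
apply/esym/cvg_lim; first exact: Rhausdorff.
rewrite qre_comp_mul [qre (qseries _ _)]/= [qi (qseries _ _)]/= [qj (qseries _ _)]/= [qk (qseries _ _)]/=.
have -> : pseries (fun n => qre (u * g n)) s = (fun N =>
    qre u * pseries (fun n => qre (g n)) s N - qi u * pseries (fun n => qi (g n)) s N -
    qj u * pseries (fun n => qj (g n)) s N - qk u * pseries (fun n => qk (g n)) s N).
  apply/funext => N; rewrite /pseries /series [in LHS]/= [in RHS]/= !mulr_sumr -!sumrB.
  by apply: eq_bigr => i _; rewrite !mulrA -!mulrBl.
by apply: cvgB; [apply: cvgB; [apply: cvgB|]|]; apply: cvgM; (exact: cvg_cst || assumption).
Qed.

Lemma qseries0 : qseries g 0 = g 0.
Proof.
have L c : limn (pseries c 0) = c 0.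
  apply: cvg_lim; first exact: Rhausdorff.
  rewrite -cvg_shiftS /pseries.
  rewrite (_ : [sequence _]_n = (fun _ => c 0)); first exact: cvg_cst.
  apply/funext => N; rewrite /series /= big_nat_recl//= expr0 mulr1 big1 ?addr0// => i _.
  by rewrite expr0n mulr0.
by rewrite /qseries !L; case: (g 0).
Qed.

Lemma qseries_cvg : m < 1 -> (fun N => \sum_(i < N) g i) @ \oo --> qseries g 1.
Proof.
move=> m1; have m1' : m * `|1 : R| < 1 by rewrite normr1 mulr1.
apply: qre_cvg => u; rewrite qseries_re//.
have := @qre_pseries_cvg_norm u 1 m1'.
suff -> : (fun N => qre (u * \sum_(i < N) g i)) = pseries (fun n => qre (u * g n)) 1 by [].
apply/funext => N; rewrite mulr_sumr (qre_sum N (fun i => u * g i)) /pseries /series [RHS]/= big_mkord.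
by apply: eq_bigr => i _; rewrite expr1n mulr1.
Qed.

End Sum.

(** Term-by-term differentiation on the closed interval |s| <= 1; the
    coefficients decay geometrically, hence the series and its two formal
    derivatives converge at some k > 1. *)
Lemma qseries_derive g m s : 0 <= m -> m < 1 -> `|s| <= 1 -> geometric_bound g m ->
  qderiv (qseries g) s (qseries (qdiffs g) s).
Proof.
move=> m0 m1 s1 gm.
pose m2 := (m + 1) / 2; pose m3 := (m2 + 1) / 2; pose k := 2 / (m3 + 1).
have mm2 : m < m2 by rewrite /m2; lra.
have m21 : m2 < 1 by rewrite /m2; lra.
have m20 : 0 <= m2 by rewrite /m2; lra.
have m23 : m2 < m3 by rewrite /m3; lra.
have m31 : m3 < 1 by rewrite /m3; lra.
have m30 : 0 < m3 + 1 by rewrite /m3; lra.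
have k0 : 0 <= k by rewrite /k divr_ge0// ltW.
have k1 : 1 < k by rewrite /k ltr_pdivlMr// mul1r; lra.
have mk : m3 * k < 1 by rewrite /k mulrA ltr_pdivrMr// mul1r; lra.
have gm2 := geometric_bound_diffs m0 mm2 gm.
have gm3 := geometric_bound_diffs m20 m23 gm2.
have D f u : (fun n => qre (u * qdiffs f n)) = pseries_diffs (fun n => qre (u * f n)).
  by apply/funext => n; rewrite /pseries_diffs /qdiffs qre_mulZ.
have small t l : l < 1 -> 0 <= l -> `|t : R| <= 1 -> l * `|t| < 1.
  by move=> l1 l0 t1; apply: le_lt_trans l1; rewrite ler_piMr.
move=> u; rewrite (qseries_re m20 gm2)//; last exact: small.
rewrite D.
have sk : `|s| < `|k| by rewrite (ger0_norm k0); apply: le_lt_trans k1.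
have m2k : m2 * k < 1 by apply: le_lt_trans mk; rewrite ler_wpM2r// ltW.
have mk' : m * k < 1 by apply: le_lt_trans m2k; rewrite ler_wpM2r// ltW.
have c0 := @qre_pseries_cvg g m m0 gm u k k0 mk'.
have c1 := @qre_pseries_cvg _ m2 m20 gm2 u k k0 m2k.
have c2 := @qre_pseries_cvg _ m3 (le_trans m20 (ltW m23)) gm3 u k k0 mk.
rewrite D in c1; rewrite !D in c2.
have dd := pseries_snd_diffs c0 c1 c2 sk.
apply: (near_eq_is_derive _ dd).
rewrite (ger0_norm k0) in sk.
have cn : (fun t : R => `|t|) @ s --> `|s| by apply: cvg_norm; exact: cvg_id.
near=> t; apply/esym/(qseries_re m0 gm).
apply: le_lt_trans mk'; rewrite ler_wpM2l// ltW//; near: t.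
exact: (@cvgr_lt _ _ _ _ _ _ cn k sk).
Unshelve. all: by end_near. Qed.

End QuaternionPowerSeries.

(** * Binomial series *)

Section BinomialSeries.
Variable R : realType.
Implicit Types (q p u x Z : quat R) (a s k C m : R) (n N : nat).

Definition binomial_term a q x n : quat R :=
  (pochhammer a n / n`!%:R) *: (q ^+ n * x ^+ n).

Lemma pochhammerS a n : pochhammer a n.+1 = pochhammer a n * (a + n%:R).
Proof. by rewrite /pochhammer big_ord_recr. Qed.

Lemma binomial_termS a q x n :
  n.+1%:R *: binomial_term a q x n.+1 = (a + n%:R) *: (q * binomial_term a q x n * x).
Proof.
rewrite /binomial_term -scalerAr -scalerAl exprS exprSr !mulrA !scalerA; congr (_ *: _).
have f0 : (n`!%:R : R) != 0 by rewrite pnatr_eq0 -lt0n fact_gt0.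
have n0 : (n.+1%:R : R) != 0 by rewrite pnatr_eq0.
rewrite pochhammerS factS natrM; move: (n`!%:R : R) f0 (n.+1%:R : R) n0 (pochhammer a n) => f f0 k k0 P.
by field; rewrite f0 k0.
Qed.

Lemma binomial_term_norm a q x n :
  `|binomial_term a q x n| = `|pochhammer a n / n`!%:R| * (`|q| * `|x|) ^+ n.
Proof. by rewrite normrZ quat_normM !quat_normX exprMn. Qed.

(** The ratio |a + n| / (n + 1) of consecutive coefficients tends to 1, hence
    is eventually at most m. *)
Lemma binomial_coefficient_bound a m : 1 < m ->
  exists C, forall n, `|pochhammer a n / n`!%:R| <= C * m ^+ n.
Proof.
move=> m1; have d0 : 0 < m - 1 by rewrite subr_gt0.
pose N := Num.truncn (`|a| / (m - 1)).
apply: (@eventual_ratio_geometric _ _ _ N.+1) => [|n Nn]; first exact: ltW.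
have f0 : (n`!%:R : R) != 0 by rewrite pnatr_eq0 -lt0n fact_gt0.
have n0 : (n.+1%:R : R) != 0 by rewrite pnatr_eq0.
rewrite pochhammerS factS natrM.
rewrite (_ : _ / _ = (a + n%:R) / n.+1%:R * (pochhammer a n / n`!%:R)); last first.
  move: (n`!%:R : R) f0 (n.+1%:R : R) n0 (pochhammer a n) => f f0 k k0 P.
  by field; rewrite f0 k0.
rewrite normrM ler_wpM2r// normrM normfV (ger0_norm (ler0n _ n.+1)) ler_pdivrMr//.
apply: le_trans (ler_normD _ _) _; rewrite (ger0_norm (ler0n _ n)).
have : `|a| / (m - 1) < n%:R.
  by apply: lt_le_trans (truncnS_gt _) _; rewrite ler_nat.
rewrite ltr_pdivrMr// => h.
rewrite -natr1; move: (n%:R : R) (ler0n R n) h => t t0 h.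
move: (`|a|) h => b h.
nra.
Qed.

Section Equation.
Variables (a : R) (q x : quat R).
Hypothesis qx1 : `|q| * `|x| < 1.
Notation g := (binomial_term a q x).

Lemma binomial_term_bound : exists2 m, 0 <= m < 1 & geometric_bound g m.
Proof.
pose rho := `|q| * `|x|; have rho0 : 0 <= rho by rewrite mulr_ge0.
(* 1 < m and m rho < 1 *)
pose m := 2 / (1 + rho).
have r1 : 0 < 1 + rho by rewrite ltr_wpDr.
have m1 : 1 < m by rewrite /m ltr_pdivlMr// mul1r; move: qx1; rewrite -/rho; lra.
have [C hC] := binomial_coefficient_bound a m1.
exists (m * rho).
  rewrite mulr_ge0 ?(ltW (lt_trans ltr01 m1))//=.
  by rewrite /m mulrAC ltr_pdivrMr// mul1r; move: qx1; rewrite -/rho; lra.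
exists C => n; rewrite binomial_term_norm -/rho [in leRHS]exprMn mulrA.
by rewrite ler_wpM2r// exprn_ge0.
Qed.

Lemma qreC q1 q2 : qre (q1 * q2) = qre (q2 * q1).
Proof. by rewrite !qre_comp_mul; ring. Qed.

(** The recurrence (n + 1) g_(n+1) = (a + n) q g_n x, read as an identity
    between power series. Cyclicity of Re turns Re (u q Z x) into Re ((x u q)
    Z), so that only scalar series occur. *)
Lemma binomial_series_ode s : `|s| <= 1 ->
  qseries (qdiffs g) s = s *: (q * qseries (qdiffs g) s * x) + a *: (q * qseries g s * x).
Proof.
move=> s1; have [m /andP[m0 m1] gm] := binomial_term_bound.
pose m2 := (m + 1) / 2.
have mm2 : m < m2 by rewrite /m2; lra.
have m21 : m2 < 1 by rewrite /m2; lra.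
have m20 : 0 <= m2 by rewrite /m2; lra.
have gm2 := geometric_bound_diffs m0 mm2 gm.
have small l : l < 1 -> 0 <= l -> l * `|s| < 1.
  by move=> l1 l0; apply: le_lt_trans l1; rewrite ler_piMr.
have ms := small _ m1 m0; have m2s := small _ m21 m20.
apply: qre_eqP => u; pose v := x * u * q.
have E Z : qre (u * (q * Z * x)) = qre (v * Z).
  by rewrite mulrA qreC !mulrA.
rewrite mulrDr qreD !qre_mulZ !E.
rewrite (qseries_re m20 gm2 u)// (qseries_re m20 gm2 v)// (qseries_re m0 gm v)//.
pose h n := qre (v * g n).
have D : (fun n => qre (v * qdiffs g n)) = pseries_diffs h.
  by apply/funext => n; rewrite /pseries_diffs /qdiffs qre_mulZ.
have c0 : cvgn (pseries h s) := @qre_pseries_cvg_norm _ g m m0 gm v s ms.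
have c1 : cvgn (pseries (pseries_diffs h) s).
  by rewrite -D; exact: (@qre_pseries_cvg_norm _ _ m2 m20 gm2 v s m2s).
have c2 := pseries_diffs_equiv c1.
rewrite D; apply: cvg_lim; first exact: Rhausdorff.
have -> : (fun n => qre (u * qdiffs g n)) = (fun n => (a + n%:R) * h n).
  by apply/funext => n; rewrite /qdiffs binomial_termS qre_mulZ E.
have -> : pseries (fun n => (a + n%:R) * h n) s =
    (fun N => s * series (fun i => i%:R * h i * s ^+ i.-1) N + a * pseries h s N).
  apply/funext => N; rewrite /pseries /series [in LHS]/= [in RHS]/= !mulr_sumr -big_split.
  apply: eq_bigr => i _.
  case: i => [|i]; first by rewrite /= !mul0r mulr0 add0r addr0 mulrA.
  by rewrite /= exprS; move: (h i.+1) (i.+1%:R : R) (s ^+ i) => H k T; ring.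
by apply: cvgD; apply: cvgM => //; exact: cvg_cst.
Qed.

Lemma binomial_series_derive s : `|s| <= 1 ->
  qderiv (qseries g) s (qseries (qdiffs g) s).
Proof.
move=> s1; have [m /andP[m0 m1] gm] := binomial_term_bound.
exact: qseries_derive m0 m1 s1 gm.
Qed.

Lemma binomial_series0 : qseries g 0 = 1.
Proof.
by rewrite qseries0 /binomial_term /pochhammer big_ord0 fact0 divr1 scale1r mulr1.
Qed.

Lemma binomial_series1 : qseries g 1 = Ipow a q x.
Proof.
have [m /andP[m0 m1] gm] := binomial_term_bound.
apply/esym/cvg_lim; first exact: norm_hausdorff.
have := qseries_cvg m0 gm m1; rewrite /series.
have -> // : (fun N => \sum_(i < N) g i) = (fun n => \sum_(0 <= k < n) g k).
by apply/funext => N; rewrite big_mkord.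
Qed.

End Equation.

End BinomialSeries.

(** * Uniqueness for a linear equation *)

Section LinearEquation.
Variable R : realType.
Implicit Types (q p u x Z : quat R) (a s k C m M : R) (f g : R -> quat R).

Notation e1 := (Quat 0 (-1) 0 0 : quat R).
Notation e2 := (Quat 0 0 (-1) 0 : quat R).
Notation e3 := (Quat 0 0 0 (-1) : quat R).

Lemma qcomponentsE q : [/\ qre (1 * q) = qre q, qre (e1 * q) = qi q,
  qre (e2 * q) = qj q & qre (e3 * q) = qk q].
Proof. by case: q => b c d e; split => /=; ring. Qed.

(** Expresses Re (p q) through real numbers that are again of the form Re (v
    p) and Re (v q); derivatives are only known for such functions. *)
Lemma qre_mul_components p q : qre (p * q) =
  qre p * qre (1 * q) - qre (e1 * p) * qre (e1 * q)
  - qre (e2 * p) * qre (e2 * q) - qre (e3 * p) * qre (e3 * q).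
Proof.
have [_ -> -> ->] := qcomponentsE p; have [-> -> -> ->] := qcomponentsE q.
exact: qre_comp_mul.
Qed.

Lemma qderivM f g s p q : qderiv f s p -> qderiv g s q ->
  qderiv (fun t => f t * g t) s (p * g s + f s * q).
Proof.
move=> df dg u.
have -> : (fun t => qre (u * (f t * g t))) = (fun t =>
    qre (u * f t) * qre (1 * g t) - qre (e1 * u * f t) * qre (e1 * g t)
  - qre (e2 * u * f t) * qre (e2 * g t) - qre (e3 * u * f t) * qre (e3 * g t)).
  by apply/funext => t; rewrite mulrA qre_mul_components !mulrA.
have P v w := drvM (df v) (dg w).
apply: drvE (drvB (drvB (drvB (P u 1) (P (e1 * u) e1)) (P (e2 * u) e2)) (P (e3 * u) e3)) _.
rewrite (mulrDr u) qreD (mulrA u p) (mulrA u (f s)) (qre_mul_components (u * p)) (qre_mul_components (u * f s)).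
by rewrite !mulrA; ring.
Qed.

Lemma qderivB f g s p q : qderiv f s p -> qderiv g s q ->
  qderiv (fun t => f t - g t) s (p - q).
Proof.
move=> df dg u.
have -> : (fun t => qre (u * (f t - g t))) = (fun t => qre (u * f t) - qre (u * g t)).
  by apply/funext => t; rewrite mulrBr qreB.
by apply: drvE (drvB (df u) (dg u)) _; rewrite mulrBr qreB.
Qed.

Lemma qderiv_eq f s p q : qderiv f s p -> p = q -> qderiv f s q.
Proof. by move=> + <-. Qed.

(** Gronwall's argument: |D' | <= M |D| makes |D(s)|^2 exp (- 2 M s)
    nonincreasing, and it vanishes at 0. *)
Lemma linear_growth_zero (D D' : R -> quat R) M :
  (forall s, 0 <= s <= 1 -> qderiv D s (D' s)) ->
  (forall s, 0 <= s <= 1 -> `|D' s| <= M * `|D s|) ->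
  D 0 = 0 -> D 1 = 0.
Proof.
move=> dD bD D0.
(* |D|^2, written through functionals whose derivatives are known. *)
pose N s := qre (1 * D s) ^+ 2 + qre (e1 * D s) ^+ 2 + qre (e2 * D s) ^+ 2 + qre (e3 * D s) ^+ 2.
have NE s : N s = `|D s| ^+ 2.
  by rewrite /N qnorm_sqr; have [-> -> -> ->] := qcomponentsE (D s).
pose n' s := 2 * qre (qconj (D s) * D' s).
have dN s : 0 <= s <= 1 -> is_derive s (1:R) N (n' s).
  move=> s01; have d v := drvX 2 (dD s s01 v).
  apply: drvE (drvD (drvD (drvD (d 1) (d e1)) (d e2)) (d e3)) _.
  rewrite /n' (qre_comp_mul (qconj (D s))).
  have [-> -> -> ->] := qcomponentsE (D s); have [-> -> -> ->] := qcomponentsE (D' s).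
  by rewrite /= !expr1; ring.
pose psi s := N s * expR (- (2 * M) * s).
pose psi' s := (n' s - 2 * M * N s) * expR (- (2 * M) * s).
have dpsi s : 0 <= s <= 1 -> is_derive s (1:R) psi (psi' s).
  move=> s01; have dl := drvM (drvC (- (2 * M)) s) (drvI s).
  apply: drvE (drvM (dN s s01) (drv_comp dl (is_derive_expR _))) _.
  by rewrite /psi'; ring.
have psi'le s : 0 <= s <= 1 -> psi' s <= 0.
  move=> s01; rewrite /psi' pmulr_lle0 ?expR_gt0// subr_le0 /n' NE -mulrA ler_pM2l//.
  apply: le_trans (ler_norm _) _; apply: le_trans (normr_qre_mul _ _) _.
  by rewrite qconj_norm expr2 mulrA (mulrC `|D s|) ler_wpM2r// bD.
have cpsi : {within `[0, 1]%classic, continuous psi}.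
  apply: continuous_in_subspaceT => s; rewrite inE /= in_itv/= => s01.
  exact: drv_continuous (dpsi s s01).
have ds s : s \in `]0, 1[ -> is_derive s (1:R) psi (psi' s).
  by rewrite in_itv/= => /andP[s0 s1]; apply: dpsi; rewrite !ltW.
have [c c01 E] := MVT ltr01 ds cpsi.
have psi0 : psi 0 = 0 by rewrite /psi NE D0 normr0 expr0n mul0r.
have : psi 1 <= 0.
  rewrite -[psi 1]subr0 -{1}psi0 E subr0 mulr1; apply: psi'le.
  by move: c01; rewrite in_itv/= => /andP[/ltW -> /ltW ->].
rewrite /psi pmulr_lle0 ?expR_gt0// NE => h.
by apply/eqP; rewrite -normr_eq0 -sqrf_eq0 eq_le h sqr_ge0.
Qed.

(** Taking norms in the equation for the difference D of two solutions gives
    (1 - |q| |x|) |D'| <= |a| |q| |x| |D|. *)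
Lemma linear_ode_unique a q x (Y Y' Z Z' : R -> quat R) : `|q| * `|x| < 1 ->
  (forall s, 0 <= s <= 1 -> qderiv Y s (Y' s)) ->
  (forall s, 0 <= s <= 1 -> qderiv Z s (Z' s)) ->
  (forall s, 0 <= s <= 1 -> Y' s = s *: (q * Y' s * x) + a *: (q * Y s * x)) ->
  (forall s, 0 <= s <= 1 -> Z' s = s *: (q * Z' s * x) + a *: (q * Z s * x)) ->
  Y 0 = Z 0 -> Y 1 = Z 1.
Proof.
move=> qx dY dZ eY eZ YZ0.
pose rho := `|q| * `|x|.
pose D s := Y s - Z s; pose D' s := Y' s - Z' s.
have rho1 : 0 < 1 - rho by rewrite subr_gt0.
suff : D 1 = 0 by move/eqP; rewrite subr_eq0 => /eqP.
apply: (@linear_growth_zero D D' (`|a| * rho / (1 - rho))) => [s s01|s s01|].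
- exact: qderivB (dY s s01) (dZ s s01).
- have E : D' s = s *: (q * D' s * x) + a *: (q * D s * x).
    rewrite /D' {1}eY// {1}eZ// opprD addrACA -!scalerBr.
    by rewrite -!mulrBl -!mulrBr.
  have h : `|D' s| <= rho * `|D' s| + `|a| * (rho * `|D s|).
    rewrite {1}E; apply: le_trans (ler_normD _ _) _; rewrite !normrZ !quat_normM.
    have [s0 s1] := andP s01.
    rewrite /rho -!(mulrA `|q|) !(mulrC `|x|); apply: lerD => //.
    by rewrite (ger0_norm s0) ler_piMl// !mulr_ge0.
  rewrite mulrAC ler_pdivlMr// mulrC mulrBl mul1r lerBlDl.
  by rewrite mulrA in h.
- by rewrite /D YZ0 subrr.
Qed.

End LinearEquation.

(** * Real powers in a slice *)

Section SlicePowers.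
Variable R : realType.
Implicit Types (q p u x : quat R) (a b s t : R) (c l z w : R * R).
Variable J : quat R.
Hypothesis J_unit : imag_unit J.

(** The exponential of the point l.1 + l.2 J. *)
Definition slice_exp l : quat R := expR l.1 *: slice_pt J (cos l.2, sin l.2).

Lemma slice_expE l : slice_exp l = slice_pt J (expR l.1 * cos l.2, expR l.1 * sin l.2).
Proof. by rewrite /slice_exp /slice_pt /= scalerDr !scalerA. Qed.

Lemma slice_expD l l' : slice_exp (l + l') = slice_exp l * slice_exp l'.
Proof.
rewrite !slice_expE slice_ptM//=; congr slice_pt; congr pair.
  by rewrite expRD cosD; ring.
by rewrite expRD sinD; ring.
Qed.

Lemma slice_exp_derive (l1 l2 : R -> R) s d1 d2 :
  is_derive s (1:R) l1 d1 -> is_derive s (1:R) l2 d2 ->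
  qderiv (fun t => slice_exp (l1 t, l2 t)) s
    (slice_pt J (d1, d2) * slice_exp (l1 s, l2 s)).
Proof.
move=> D1 D2 u.
have E l : qre (u * slice_exp l) =
    expR l.1 * (cos l.2 * qre u + sin l.2 * qre (u * J)).
  rewrite /slice_exp qre_mulZ /slice_pt (mulrDr u) qreD !qre_mulZ mulr1.
  by [].
have -> : (fun t => qre (u * slice_exp (l1 t, l2 t))) =
    (fun t => expR (l1 t) * (cos (l2 t) * qre u + sin (l2 t) * qre (u * J))).
  by apply/funext => t; rewrite E.
have De := drv_comp D1 (is_derive_expR (l1 s)).
have Dc := drv_comp D2 (is_derive_cos (l2 s)).
have Ds := drv_comp D2 (is_derive_sin (l2 s)).
apply: drvE (drvM De (drvD (drvM Dc (drvC (qre u) s)) (drvM Ds (drvC (qre (u * J)) s)))) _.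
rewrite slice_expE slice_ptM// [_.1]/= [_.2]/= /slice_pt (mulrDr u) qreD !qre_mulZ mulr1.
by move: (qre (u * J)) (qre u) => A B /=; ring.
Qed.

(** The formula for [qpow] uses the angle in [0, pi] and the direction of the
    imaginary part; for l.2 < 0 both change sign, and for l.2 = 0 the
    direction is irrelevant since the sine vanishes. *)
Lemma qpow_slice_exp l b : - pi < l.2 < pi ->
  qpow (slice_exp l) b = slice_exp (b * l.1, b * l.2).
Proof.
case: l => m theta /= /andP[tpi tpi'].
have [J0 J1] := imag_unitE J_unit.
have e0 := expR_gt0 m.
have reE : qre (slice_exp (m, theta)) = expR m * cos theta.
  by rewrite slice_expE /slice_pt qreD !qreZ J0 mulr0 addr0 mulr1.
have imE : qim (slice_exp (m, theta)) = (expR m * sin theta) *: J.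
  rewrite slice_expE /slice_pt quat_algE; apply: quat_eqP.
  by split; rewrite /= ?J0 ?add0r ?mulr0.
have normE : `|slice_exp (m, theta)| = expR m.
  apply/eqP; rewrite -(@eqrXn2 _ 2)// ?expR_ge0//.
  by rewrite slice_expE slice_pt_norm//= !exprMn -mulrDr cos2Dsin2 mulr1.
have nJ : `|J| = 1.
  by apply/eqP; rewrite -(@eqrXn2 _ 2)// qnorm_sqr J0 expr0n add0r J1 expr1n.
rewrite /qpow reE imE normE normrZ nJ mulr1 scalerA mulrAC divff ?lt0r_neq0// mul1r.
rewrite /powR (negbTE (lt0r_neq0 e0)) expRK /slice_exp /slice_pt /=.
have acosE : acos (cos theta) = `|theta|.
  have [t0|t0] := lerP 0 theta.
    by rewrite ger0_norm//; apply: cosK; rewrite in_itv/= t0 (ltW tpi').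
  by rewrite ltr0_norm//; apply: cosKN; rewrite (ltW tpi) (ltW t0).
rewrite acosE; congr (_ *: (_ + _)).
  by have [t0|t0] := lerP 0 theta; [rewrite ger0_norm|rewrite ltr0_norm// mulrN cosN].
have [t0|t0|<-] := ltrgtP 0 theta; last by rewrite normr0 mulr0 sin0 !mul0r !scale0r.
  have s0 : 0 < sin theta by apply: sin_gt0_pi; rewrite t0.
  by rewrite !gtr0_norm ?mulr_gt0// scalerA divfK// lt0r_neq0// mulr_gt0.
have s0 : sin theta < 0.
  by rewrite -oppr_gt0 -sinN sin_gt0_pi// oppr_gt0 t0 ltrNl.
have es0 : expR m * sin theta < 0 by rewrite pmulr_rlt0.
by rewrite !ltr0_norm// mulrN sinN invrN mulrNN scalerA divfK// ltr0_neq0.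
Qed.

(** The principal logarithm on the half-plane of positive real part, where the
    argument is a smooth function given by the arctangent. *)
Definition half_plane_log c : R * R := (ln (c.1 ^+ 2 + c.2 ^+ 2) / 2, atan (c.2 / c.1)).

Lemma slice_exp_log c : 0 < c.1 -> slice_exp (half_plane_log c) = slice_pt J c.
Proof.
case: c => X Y /= X0; rewrite slice_expE /=.
have X2 : 0 < X ^+ 2 by rewrite exprn_gt0.
have N0 : 0 < X ^+ 2 + Y ^+ 2 by rewrite ltr_wpDr// sqr_ge0.
set m := expR _; have m0 : 0 < m by exact: expR_gt0.
(* m is the modulus of c. *)
have m2 : m ^+ 2 = X ^+ 2 + Y ^+ 2.
  by rewrite /m -expRM_natl -[LHS]/(expR (2 * (_ / 2))) mulrCA divff// mulr1 lnK.
have c0 : 0 < cos (atan (Y / X)) by rewrite cos_atan invr_gt0 sqrtr_gt0 ltr_wpDr// sqr_ge0.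
have mc : m * cos (atan (Y / X)) = X.
  apply/eqP; rewrite -(@eqrXn2 _ 2)//; [|by rewrite mulr_ge0// ltW|exact: ltW].
  rewrite exprMn m2 cos_atan exprVn sqr_sqrtr; last by rewrite addr_ge0// sqr_ge0.
  rewrite -[X in _ * (X + _)^-1](divff (lt0r_neq0 X2)) expr_div_n -mulrDl invf_div.
  by rewrite mulrC divfK// lt0r_neq0.
have ms : m * sin (atan (Y / X)) = Y.
  have := atanK (Y / X); rewrite /tan => /(canRL (mulfVK (lt0r_neq0 c0))) ->.
  by rewrite mulrCA mc divfK// lt0r_neq0.
by rewrite mc ms.
Qed.

(** The coordinates of 1 - s z. *)
Definition unit_segment z s : R * R := (1 - s * z.1, - (s * z.2)).

Lemma unit_segment_gt0 z s : z.1 ^+ 2 + z.2 ^+ 2 < 1 -> 0 <= s <= 1 ->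
  0 < (unit_segment z s).1.
Proof.
case: z => z1 z2 /= h /andP[s0 s1].
have z11 : z1 < 1 by nra.
by case: (lerP 0 z1) => z10; nra.
Qed.

(** The coordinates of - z / (1 - s z), see [log_derivativeE]. *)
Definition log_derivative z s : R * R :=
  let c := unit_segment z s in let N := c.1 ^+ 2 + c.2 ^+ 2 in
  ((- (c.1 * z.1) - c.2 * z.2) / N, (c.2 * z.1 - c.1 * z.2) / N).

Lemma log_derivativeE z s : 0 < (unit_segment z s).1 ->
  slice_pt J (log_derivative z s) * slice_pt J (unit_segment z s) = - slice_pt J z.
Proof.
rewrite /log_derivative; move: (unit_segment z s) => [X Y] /= X0.
have N0 : X ^+ 2 + Y ^+ 2 != 0 by rewrite lt0r_neq0// ltr_wpDr ?sqr_ge0 ?exprn_gt0.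
rewrite slice_ptM//= (_ : - slice_pt J z = slice_pt J (- z.1, - z.2)); last first.
  by rewrite /slice_pt /= !scaleNr opprD.
by congr slice_pt; congr pair; field.
Qed.

Lemma half_plane_log_derive z s : 0 < (unit_segment z s).1 ->
  is_derive s (1:R) (fun t => (half_plane_log (unit_segment z t)).1) (log_derivative z s).1 /\
  is_derive s (1:R) (fun t => (half_plane_log (unit_segment z t)).2) (log_derivative z s).2.
Proof.
move=> X0; rewrite /half_plane_log /log_derivative; cbv zeta.
have dX : is_derive s (1:R) (fun t => (unit_segment z t).1) (- z.1).
  apply: drvE (drvB (drvC 1 s) (drvM (drvI s) (drvC z.1 s))) _; ring.
have dY : is_derive s (1:R) (fun t => (unit_segment z t).2) (- z.2).
  apply: drvE (drvN (drvM (drvI s) (drvC z.2 s))) _; ring.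
pose X t := (unit_segment z t).1; pose Y t := (unit_segment z t).2.
rewrite -/(X s) -/(Y s) in X0 *; rewrite -/X in dX; rewrite -/Y in dY.
have N0 : 0 < X s ^+ 2 + Y s ^+ 2 by rewrite ltr_wpDr ?sqr_ge0 ?exprn_gt0.
have X00 := lt0r_neq0 X0; have N00 := lt0r_neq0 N0.
have dN := drvD (drvX 2 dX) (drvX 2 dY).
split.
  apply: drvE (drvM (drv_comp dN (is_derive1_ln N0)) (drvC 2^-1 s)) _.
  by rewrite /= !expr1; move: (X s) (Y s) (ln _) X00 N00 => A B l A0 B0; field.
have dV := drvV X00 dX.
apply: drvE (drv_comp (drvM dY dV) (is_derive1_atan _)) _.
move: (X s) (Y s) X00 N00 => A B A0 B0 /=; field.
by rewrite B0.
Qed.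

Section Product.
Variables (z w : R * R).
Hypotheses (z1 : z.1 ^+ 2 + z.2 ^+ 2 < 1) (w1 : w.1 ^+ 2 + w.2 ^+ 2 < 1).

(** A logarithm of (1 - s z) (1 - s w). As a sum of two principal logarithms
    it has imaginary part in ]-pi, pi[, hence is itself principal. *)
Definition segment_log s := half_plane_log (unit_segment z s) + half_plane_log (unit_segment w s).

Definition segment_power b s := slice_exp (b * (segment_log s).1, b * (segment_log s).2).

Lemma segment_power1 s : 0 <= s <= 1 ->
  segment_power 1 s = slice_pt J (unit_segment z s) * slice_pt J (unit_segment w s).
Proof.
move=> s01; rewrite /segment_power !mul1r -surjective_pairing slice_expD.
by rewrite !slice_exp_log//; exact: unit_segment_gt0.
Qed.

Lemma segment_power_qpow b s : 0 <= s <= 1 ->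
  segment_power b s = qpow (segment_power 1 s) b.
Proof.
move=> s01; rewrite /segment_power !mul1r -surjective_pairing qpow_slice_exp//.
rewrite /segment_log /half_plane_log /=.
have := atan_gtNpi2 ((unit_segment z s).2 / (unit_segment z s).1).
have := atan_ltpi2 ((unit_segment z s).2 / (unit_segment z s).1).
have := atan_gtNpi2 ((unit_segment w s).2 / (unit_segment w s).1).
have := atan_ltpi2 ((unit_segment w s).2 / (unit_segment w s).1).
move: (atan _) (atan _) (pi : R) => A B P h1 h2 h3 h4.
by apply/andP; split; lra.
Qed.

Lemma segment_powerS b s :
  segment_power b s = segment_power 1 s * segment_power (b - 1) s.
Proof.
rewrite /segment_power -slice_expD; congr slice_exp.
by congr pair => /=; ring.
Qed.

Lemma segment_power_comm b s c :
  slice_pt J c * segment_power b s = segment_power b s * slice_pt J c.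
Proof. by rewrite /segment_power slice_expE slice_ptC. Qed.

Lemma segment_power_start b : segment_power b 0 = 1.
Proof.
have L v : half_plane_log (unit_segment v 0) = 0.
  by rewrite /half_plane_log /unit_segment /= !mul0r oppr0 addr0 expr0n addr0 expr1n ln1 !mul0r atan0.
rewrite /segment_power /segment_log !L addr0 /= !mulr0 /slice_exp /= expR0 cos0 sin0 scale1r.
by rewrite /slice_pt /= scale0r addr0 scale1r.
Qed.

(** The derivative of the exponent is b times that of the logarithm; one
    factor (1 - s z) (1 - s w) is split off from the power in order to clear
    the denominators. *)
Lemma segment_power_derive b s : 0 <= s <= 1 ->
  qderiv (segment_power b) s
    ((b *: (- (slice_pt J z * slice_pt J (unit_segment w s))
            - slice_pt J (unit_segment z s) * slice_pt J w)) * segment_power (b - 1) s).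
Proof.
move=> s01.
have zp := unit_segment_gt0 z1 s01; have wp := unit_segment_gt0 w1 s01.
have [dz1 dz2] := half_plane_log_derive zp.
have [dw1 dw2] := half_plane_log_derive wp.
have D1 := drvM (drvC b s) (drvD dz1 dw1).
have D2 := drvM (drvC b s) (drvD dz2 dw2).
apply: (qderiv_eq (slice_exp_derive D1 D2)).
rewrite -/(segment_power b s) segment_powerS mulrA; congr (_ * _).
rewrite !mul0r !add0r segment_power1//.
set dz := log_derivative z s; set dw := log_derivative w s.
have -> : slice_pt J (b * (dz.1 + dw.1), b * (dz.2 + dw.2)) =
    b *: (slice_pt J dz + slice_pt J dw).
  by rewrite /slice_pt /= addrACA -!scalerDl scalerDr !scalerA.
rewrite -scalerAl; congr (_ *: _); rewrite mulrDl.
rewrite [in X in X + _]mulrA log_derivativeE// mulNr; congr (_ + _).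
by rewrite slice_ptC// mulrA log_derivativeE// mulNr slice_ptC.
Qed.

End Product.

End SlicePowers.

(** * The product formula *)

Section ProductFormula.
Variable R : realType.
Implicit Types (q p u x A B : quat R) (a b s t T N : R) (c l z w : R * R).

(** Turns an identity between linear combinations of noncommuting monomials
    into one between real numbers, where the monomials are atoms and the
    coefficients commute. *)
Lemma quat_functional_eq A B :
  (forall phi : quat R -> R, (forall p q, phi (p + q) = phi p + phi q) ->
    (forall t p, phi (t *: p) = t * phi p) -> (forall p, phi (- p) = - phi p) ->
    phi A = phi B) -> A = B.
Proof.
move=> h; apply: qre_eqP => u; apply: (h (fun p => qre (u * p))) => [p q|t p|p].
- by rewrite (mulrDr u) qreD.
- exact: qre_mulZ.
- by rewrite mulrN qreN.
Qed.

Section Algebra.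
Variables (q qb x B B' : quat R) (T N a s : R).
Hypotheses (qD : q + qb = T%:A) (qM : q * qb = N%:A).
Hypothesis B_ode : B' = s *: (qb * B' * x) + (- a) *: (qb * B * x).
Let P := 1 - (s * T) *: x + (s ^+ 2 * N) *: (x * x).
Let dP := - (T *: x) + (2 * s * N) *: (x * x).

Let trace_act Z : T *: Z = q * Z + qb * Z.
Proof. by rewrite -mulrDl qD qmul_algl. Qed.

Let norm_act Z : N *: Z = q * (qb * Z).
Proof. by rewrite mulrA qM qmul_algl. Qed.

(** In the operators L Z = q Z x and L' Z = qb Z x, right multiplication by P
    is (1 - s L) (1 - s L'), and the hypothesis reads (1 - s L') B' = - a L'
    B. Hence B' P = - a (1 - s L) L' B. *)
Lemma quadratic_product : B' * P = - a *: (qb * B * x) + (s * a) *: (q * (qb * B * x) * x).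
Proof.
have E1 : T *: (B' * x) = q * B' * x + qb * B' * x by rewrite trace_act !mulrA.
have E2 : N *: (B' * (x * x)) = q * (qb * B' * x) * x by rewrite norm_act !mulrA.
have E3 : q * B' * x = s *: (q * (qb * B' * x) * x) + (- a) *: (q * (qb * B * x) * x).
  by rewrite {1}B_ode mulrDr mulrDl -!scalerAr -!scalerAl.
have E4 : B' * P = B' - s *: (T *: (B' * x)) + s ^+ 2 *: (N *: (B' * (x * x))).
  by rewrite /P mulrDr mulrBr mulr1 -!scalerAr !scalerA.
rewrite E4 E1 E2; apply: quat_functional_eq => phi D Z O.
have h1 := congr1 phi B_ode; have h3 := congr1 phi E3.
rewrite !(D, Z, O) in h1 h3 *.
rewrite [X in X - _ + _]h1 h3; ring.
Qed.

(** The derivative of B P^(-a) is D P^(-a-1). With the operators of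
    [quadratic_product], right multiplication by dP is - L (1 - s L') - L' (1
    - s L), so that D = a L (1 - s L') B and (1 - s L) D = a L (B P). *)
Lemma quadratic_product_ode (D := B' * P - a *: (B * dP)) :
  D = s *: (q * D * x) + a *: (q * (B * P) * x).
Proof.
have DE : D = a *: (q * B * x) - (s * a) *: (q * (qb * B * x) * x).
  have E1 : T *: (B * x) = q * B * x + qb * B * x by rewrite trace_act !mulrA.
  have E2 : N *: (B * (x * x)) = q * (qb * B * x) * x by rewrite norm_act !mulrA.
  have E4 : B * dP = - (T *: (B * x)) + (2 * s) *: (N *: (B * (x * x))).
    by rewrite /dP mulrDr mulrN -!scalerAr !scalerA.
  rewrite /D quadratic_product E4 E1 E2; apply: quat_functional_eq => phi pD pZ pO.
  by rewrite !(pD, pZ, pO); ring.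
have E5 : q * (B * P) * x = q * B * x - s *: (q * (T *: (B * x)) * x)
    + s ^+ 2 *: (q * (N *: (B * (x * x))) * x).
  rewrite /P mulrDr mulrBr mulr1 mulrDr mulrBr mulrDl mulrBl.
  by rewrite -!scalerAr -!scalerAl !scalerA.
have E1 : T *: (B * x) = q * B * x + qb * B * x by rewrite trace_act !mulrA.
have E2 : N *: (B * (x * x)) = q * (qb * B * x) * x by rewrite norm_act !mulrA.
rewrite E5 E1 E2 DE !(mulrDr, mulrDl, mulrN, mulNr) -!scalerAr -!scalerAl.
apply: quat_functional_eq => phi pD pZ pO.
by rewrite !(pD, pZ, pO); ring.
Qed.

End Algebra.

Section Formula.
Variables (J I : quat R) (a : R) (v y : R * R).
Hypotheses (J_unit : imag_unit J) (I_unit : imag_unit I).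
Let q := slice_pt I v.
Let x := slice_pt J y.
Hypotheses (q1 : `|q| < 1) (x1 : `|x| < 1).

(* The points of the slice of x that stand for q x and conj(q) x, when q is
   replaced by its copy v.1 + v.2 J in that slice. *)
Let z : R * R := (v.1 * y.1 - v.2 * y.2, v.1 * y.2 + v.2 * y.1).
Let w : R * R := (v.1 * y.1 + v.2 * y.2, v.1 * y.2 - v.2 * y.1).

Let qx1 : `|q| * `|x| < 1.
Proof.
have [q0 x0] := (normr_ge0 q, normr_ge0 x).
by move: (`|q|) (`|x|) q1 x1 q0 x0 => A B A1 B1 A0 B0; nra.
Qed.

Let sq1 : (v.1 ^+ 2 + v.2 ^+ 2) * (y.1 ^+ 2 + y.2 ^+ 2) < 1.
Proof.
rewrite -(slice_pt_norm _ I_unit) -(slice_pt_norm _ J_unit) -exprMn.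
by rewrite expr_lt1// mulr_ge0.
Qed.

Let z1 : z.1 ^+ 2 + z.2 ^+ 2 < 1.
Proof. by apply: le_lt_trans sq1; rewrite /z /=; lra. Qed.

Let w1 : w.1 ^+ 2 + w.2 ^+ 2 < 1.
Proof. by apply: le_lt_trans sq1; rewrite /w /=; lra. Qed.

Let T := 2 * v.1.
Let N := v.1 ^+ 2 + v.2 ^+ 2.

Let segment_product s :
  slice_pt J (unit_segment z s) * slice_pt J (unit_segment w s) =
  1 - (s * T) *: x + (s ^+ 2 * N) *: (x * x).
Proof.
rewrite /x slice_ptM// slice_ptM// /unit_segment /z /w /T /N /slice_pt /=.
apply: quat_functional_eq => phi pD pZ pO.
by rewrite !(pD, pZ, pO); ring.
Qed.

Let segment_product_derivative s :
  - (slice_pt J z * slice_pt J (unit_segment w s))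
  - slice_pt J (unit_segment z s) * slice_pt J w =
  - (T *: x) + (2 * s * N) *: (x * x).
Proof.
rewrite /x !slice_ptM// /unit_segment /z /w /T /N /slice_pt /=.
apply: quat_functional_eq => phi pD pZ pO.
by rewrite !(pD, pZ, pO); ring.
Qed.

Let trace_q : q + qconj q = T%:A.
Proof.
have [J0 _] := imag_unitE I_unit.
rewrite /q slice_pt_conj// /slice_pt addrACA scalerN subrr addr0 -scalerDl.
by rewrite /T mulr2n mulrDl mul1r.
Qed.

Let norm_q : q * qconj q = N%:A.
Proof. by rewrite qmul_conj /q slice_pt_norm. Qed.

(** Both sides are the values at s = 1 of solutions of the equation of
    [binomial_series_ode] starting from 1. *)
Lemma binomial_product :
  Ipow a q x = Ipow (- a) (qconj q) x * segment_power J z w (- a) 1.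
Proof.
have qbx1 : `|qconj q| * `|x| < 1 by rewrite qconj_norm.
have norm_le1 s : 0 <= s <= 1 -> `|s| <= 1 by move=> /andP[s0 s1]; rewrite ger0_norm.
pose B := qseries (binomial_term (- a) (qconj q) x).
pose B' := qseries (qdiffs (binomial_term (- a) (qconj q) x)).
pose V b := segment_power J z w b.
pose P s := 1 - (s * T) *: x + (s ^+ 2 * N) *: (x * x).
pose dP s := - (T *: x) + (2 * s * N) *: (x * x).
have V1 s : 0 <= s <= 1 -> V 1 s = P s.
  by move=> s01; rewrite /V segment_power1// segment_product.
have VS s : 0 <= s <= 1 -> V (- a) s = P s * V (- a - 1) s.
  by move=> s01; rewrite -V1// /V -segment_powerS.
have Vx b s : x * V b s = V b s * x by exact: segment_power_comm.
pose Y s := B s * V (- a) s.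
pose D s := B' s * P s - a *: (B s * dP s).
pose Y' s := D s * V (- a - 1) s.
have dY s : 0 <= s <= 1 -> qderiv Y s (Y' s).
  move=> s01; have dB := binomial_series_derive (- a) qbx1 (norm_le1 s s01).
  have dV := segment_power_derive J_unit z1 w1 (- a) s01.
  apply: (qderiv_eq (qderivM dB dV)).
  rewrite -/(B s) -/(B' s) segment_product_derivative -/(dP s) -/(V (- a) s) -/(V (- a - 1) s) VS//.
  rewrite /Y' /D mulrBl mulrA; congr (_ + _).
  by move: (V (- a - 1) s) => U; rewrite mulrA scaleNr mulrN mulNr -scalerAr.
have oY s : 0 <= s <= 1 -> Y' s = s *: (q * Y' s * x) + a *: (q * Y s * x).
  move=> s01; have h := binomial_series_ode (- a) qbx1 (norm_le1 s s01).
  have k : D s = s *: (q * D s * x) + a *: (q * (B s * P s) * x).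
    exact: (quadratic_product_ode trace_q norm_q h).
  rewrite /Y' [in LHS]k [LHS]mulrDl -!scalerAl; congr (_ *: _ + _ *: _).
    by rewrite -!(mulrA q) -!(mulrA (D s)) Vx.
  by rewrite /Y VS// -!mulrA Vx.
have := @linear_ode_unique _ a q x (qseries (binomial_term a q x))
  (qseries (qdiffs (binomial_term a q x))) Y Y' qx1 _ dY _ oY.
rewrite /Y /B !binomial_series1// /V segment_power_start// !binomial_series0 mulr1.
apply=> // s s01.
  by apply: binomial_series_derive => //; exact: norm_le1.
by apply: binomial_series_ode => //; exact: norm_le1.
Qed.

Lemma binomial_product_qpow :
  Ipow a q x = Ipow (- a) (qconj q) x *
    qpow (1 - (2 * qre q) *: x + (`|q| ^+ 2) *: x ^+ 2) (- a).
Proof.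
have i01 : 0 <= (1 : R) <= 1 by rewrite lexx ler01.
rewrite binomial_product (segment_power_qpow J_unit _ _ (- a) i01). rewrite segment_power1// segment_product.
have -> : qre q = v.1.
  have [I0 _] := imag_unitE I_unit.
  by rewrite /q /slice_pt qreD !qreZ I0 mulr0 addr0 mulr1.
by rewrite /q slice_pt_norm// mul1r expr1n mul1r expr2.
Qed.

End Formula.

End ProductFormula.

(** * The two formulas for the kernel *)

Section KernelFormula.
Variable R : realType.
Implicit Types (q p : quat R) (r alpha a : R).

Lemma scaled_ball r q : 0 < r -> `|q| < r -> `|r^-1 *: q| < 1.
Proof. by move=> r0 qr; rewrite normrZ gtr0_norm ?invr_gt0// mulrC ltr_pdivrMr// mul1r. Qed.

Lemma kernel_Ipow r alpha (K : quat R -> quat R -> quat R) q p : 0 < r -> 0 < alpha ->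
  is_bergman_kernel r alpha K -> `|q| < r -> `|p| < r ->
  K q p = Ipow (alpha + 1) (r^-1 *: q) (r^-1 *: qconj p).
Proof.
move=> r0 alpha0 hK qr pr; apply/esym/cvg_lim; first exact: norm_hausdorff.
have := kernel_series r0 alpha0 hK qr pr; rewrite /series.
under eq_fun do rewrite -(big_mkord predT (fun i => (pochhammer (alpha + 1) i / i`!%:R) *:
     ((r^-1 *: q) ^+ i * (r^-1 *: qconj p) ^+ i))).
exact.
Qed.

Lemma Ipow_product a q x : `|q| < 1 -> `|x| < 1 ->
  Ipow a q x = Ipow (- a) (qconj q) x *
    qpow (1 - (2 * qre q) *: x + (`|q| ^+ 2) *: x ^+ 2) (- a).
Proof.
have [I hI [v ->]] := mem_slice q; have [J hJ [y ->]] := mem_slice x.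
exact: binomial_product_qpow.
Qed.

End KernelFormula.

Theorem theorem3p1 (R : realType) (r alpha : R) (r_gt0 : 0 < r)
    (alpha_gt0 : 0 < alpha) (K : quat R -> quat R -> quat R)
    (K_kernel : is_bergman_kernel r alpha K) (q p : quat R)
    (q_ball : `|q| < r) (p_ball : `|p| < r) :
  K q p =
    Ipow (- alpha - 1) (r^-1 *: qconj q) (r^-1 *: qconj p) *
    qpow (1 - (2 * qre q / r ^+ 2) *: qconj p
            + (`|q| ^+ 2 / r ^+ 4) *: qconj p ^+ 2) (- alpha - 1)
  /\ K q p = Ipow (alpha + 1) (r^-1 *: q) (r^-1 *: qconj p).
Proof.
have KE := kernel_Ipow r_gt0 alpha_gt0 K_kernel q_ball p_ball.
split=> //; rewrite KE Ipow_product; last 2 first.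
- exact: scaled_ball.
- by apply: scaled_ball => //; rewrite qconj_norm.
have r0 := lt0r_neq0 r_gt0.
have conjE : qconj (r^-1 *: q) = r^-1 *: qconj q.
  by apply: quat_eqP; split; rewrite /= ?mulrN.
have traceE : (2 * qre (r^-1 *: q)) *: (r^-1 *: qconj p) = (2 * qre q / r ^+ 2) *: qconj p.
  by rewrite scalerA qreZ; congr (_ *: _); field.
have normE : (`|r^-1 *: q| ^+ 2) *: (r^-1 *: qconj p) ^+ 2 =
    (`|q| ^+ 2 / r ^+ 4) *: qconj p ^+ 2.
  have E : `|r^-1 *: q| ^+ 2 * r^-1 ^+ 2 = `|q| ^+ 2 / r ^+ 4.
    rewrite (normrZ r^-1) gtr0_norm ?invr_gt0//.
    by move: (`|q| : R) => n; field.
  by rewrite (exprZn r^-1 (qconj p)) scalerA E.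
by rewrite conjE traceE normE opprD.
Qed.
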